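(* Let $K$ be a field with $\operatorname{char} K \neq 2$, let $a,c \in K^\times$, $\varepsilon \in \{1,-1\}$, $\alpha \in K$ with $\alpha^4=1$, and let $x_1,x_2,x_3$ be independent indeterminates over $K$. Let $G$ be the group of $K$-automorphisms of $K(x_1,x_2,x_3)$ generated by $$\sigma_1: x_1 \mapsto \frac{a}{x_2},\ x_2 \mapsto x_1,\ x_3 \mapsto \alpha x_3,\qquad \sigma_2: x_1 \mapsto \varepsilon x_1,\ x_2 \mapsto \frac{\varepsilon a}{x_2},\ x_3 \mapsto \frac{c}{x_3}.$$ If $-1 \in K^{\times 2}$ or $\alpha = 1$, then $K(x_1,x_2,x_3)^G$ is rational over $K$. If $-1 \notin K^{\times 2}$ and $\alpha=-1$, then $K(x_1,x_2,x_3)^G$ is rational over $K$ if and only if $K(x_1,x_2,x_3)^{\langle\tau\rangle}$ is rational over $K$, where $\tau: x_1\mapsto -x_1,\ x_2\mapsto \frac{-1}{x_2},\ x_3 \mapsto \frac{\varepsilon a x_1^2-c}{x_3}$; and this holds if and only if at least one of $\pm a,\pm c,\varepsilon ac$ belongs to $K^{\times 2}$.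
   Context: Rational over $K$ means purely transcendental over $K$. $K^{\times 2}$ is the set of nonzero squares of $K$. For a group $H$ of automorphisms of a field $F$, $F^H$ is the fixed subfield. (The group $G$ is isomorphic to the dihedral group $D_4$.) *)

(* Defs.v *)
From HB Require Import structures.
From mathcomp Require Import all_boot all_order all_algebra.
From mathcomp Require Import mpoly.

Set Implicit Arguments.
Unset Strict Implicit.
Unset Printing Implicit Defensive.

Import GRing.Theory.
Local Open Scope ring_scope.

(* An extension F / K is given by its structure morphism [iota]; subsets of F
   are Prop-valued predicates. *)
Section Extensions.
Variables (K F : fieldType) (iota : {rmorphism K -> F}).

Definition is_subfield (L : F -> Prop) : Prop :=
  [/\ L 1,
      forall u v, L u -> L v -> L (u - v),
      forall u v, L u -> L v -> L (u * v)
    & forall u, L u -> L u^-1].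

(* K(S), the smallest subfield of F containing K and S *)
Definition adjoin (S : F -> Prop) (u : F) : Prop :=
  forall L : F -> Prop,
    is_subfield L -> (forall k, L (iota k)) -> (forall v, S v -> L v) -> L u.

Definition alg_independent (S : F -> Prop) : Prop :=
  forall (n : nat) (y : 'I_n -> F),
    injective y -> (forall i, S (y i)) ->
    forall p : {mpoly K[n]}, mmap iota y p = 0 -> p = 0.

Definition purely_transcendental (L : F -> Prop) : Prop :=
  exists2 S : F -> Prop, alg_independent S & forall u, L u <-> adjoin S u.

Definition is_automorphism_over (s : {rmorphism F -> F}) : Prop :=
  bijective s /\ forall k, s (iota k) = iota k.

End Extensions.

Inductive generated (F : Type) (gens : (F -> F) -> Prop) : (F -> F) -> Prop :=
| generated_base f : gens f -> generated gens f
| generated_id : generated gens id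
| generated_comp f g :
    generated gens f -> generated gens g -> generated gens (f \o g)
| generated_inv f g :
    generated gens f -> cancel f g -> cancel g f -> generated gens g.

Definition fixed_field (F : Type) (H : (F -> F) -> Prop) (u : F) : Prop :=
  forall h, H h -> h u = u.

Definition nonzero_square (K : fieldType) (u : K) : Prop :=
  exists2 b : K, b != 0 & u = b ^+ 2.

Notation ratfun3 K := {fraction {mpoly K[3]}}.

Definition ratfun3C (K : fieldType) : {rmorphism K -> ratfun3 K} :=
  @tofrac {mpoly K[3]} \o @mpolyC 3 K.

Definition X1 (K : fieldType) : ratfun3 K := tofrac 'X_(@Ordinal 3 0 isT).
Definition X2 (K : fieldType) : ratfun3 K := tofrac 'X_(@Ordinal 3 1 isT).
Definition X3 (K : fieldType) : ratfun3 K := tofrac 'X_(@Ordinal 3 2 isT).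

(* Main.v *)
Require Import Defs.
From HB Require Import structures.
From mathcomp Require Import all_boot all_order all_algebra.
From mathcomp Require Import mpoly ring zify.
From Stdlib Require Import Classical ClassicalEpsilon.

Set Implicit Arguments.
Unset Strict Implicit.
Unset Printing Implicit Defensive.

Import GRing.Theory.
Local Open Scope ring_scope.

(** On [K(x1, x2)] the fixed field of [sigma1 ^ 2] is [K(w, r)] with
    [w = (x1 x2 - a) / (x1 - x2)] and [r = (x1 x2 + a) / (x1 + x2)], on which
    [sigma1] and [sigma2] act monomially.  Taking invariants by one involution
    at a time, each step being a quadratic extension with an explicit
    anti-invariant element, shows that for [alpha = 1] and for [alpha ^ 2 = -1]
    the fixed field is generated by three elements, and that for [alpha = -1] it
    is the function field of [(p^2 + q^2) (y^2 - b) = x^2 - c], where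
    [b = eps a].  The fixed field of [tau] is the same with [(b, c)] in place of
    [(-b, -c)].  This threefold is rational as soon as one of [-1], [b], [-b],
    [c], [-c], [b c] is a square.

    Conversely such a field is [M^tau] for [M = K(x1, x2, x3)] and
    [tau : x1 -> -x1, x2 -> b'/x2, x3 -> k (x1^2 - b' d^2) / x3], possibly after
    adjoining the square root [d] of [-c/b].  With [t = x1^2], the quaternion
    algebra [(t, -k)] is unramified.  If [M^tau] is purely transcendental,
    restricting to the line from a rational point to the generic point shows
    that the algebra is constant, hence split, so that [-k] is a norm
    [G (tau G)] with [G] in [M].  Unique factorization in one variable at a time
    reduces this to a norm equation over [K(x1)], and comparing coefficients
    there forces [b'], [-k] or [-k b'] to be a square. *)

(** The algebra [(t, -k)] is tested at a prime of odd multiplicity in [t], where its residue is the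
    class of [-k]. There [P^2 - t Q^2 = b'] makes [b'] a square and [U^2 - t V^2 = k (t - b' d^2)]
    makes [-k b' d^2] a square, so [-k] is one. The second equation must have constant term [-k b']
    times a square, which is why [d] is adjoined. A square class of [K] that dies in [K(d)] is
    trivial or that of [-c/b], so three classes over [K(d)] become six over [K]. Constant implies
    split because [t = x1^2] is a square in [M]: a constant [e] with [e t] a norm is itself a norm
    over [M], and specialization brings this down to [K]. Rational points and specialization require
    [K] infinite. A finite field has at most two square classes, so one of [b], [-1], [-b] is a
    square there and this case is excluded beforehand. For rationality, independence is never
    computed: three generators over which the indeterminates are algebraic are independent by
    counting, and most nonvanishing facts come from the same count. *)

Definition decide (P : Prop) : bool :=
  if excluded_middle_informative P then true else false.

Lemma decideP (P : Prop) : reflect P (decide P).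
Proof. by rewrite /decide; case: excluded_middle_informative => ?; constructor. Qed.

(** * Subfields as predicates and as types *)

Section Subfield.
Variables (F : fieldType) (L : F -> Prop) (HL : is_subfield L).

Lemma sf1 : L 1. Proof. by case: HL. Qed.
Lemma sfB u v : L u -> L v -> L (u - v). Proof. by case: HL => _ + _ _; apply. Qed.
Lemma sfM u v : L u -> L v -> L (u * v). Proof. by case: HL => _ _ + _; apply. Qed.
Lemma sfV u : L u -> L u^-1. Proof. by case: HL => _ _ _; apply. Qed.
Lemma sf0 : L 0. Proof. by rewrite -(subrr 1); apply: sfB; apply: sf1. Qed.
Lemma sfN u : L u -> L (- u).
Proof. by rewrite -sub0r; apply: sfB; apply: sf0. Qed.
Lemma sfD u v : L u -> L v -> L (u + v).
Proof. by move=> Lu Lv; rewrite -[v]opprK; apply/sfB/sfN. Qed.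
Lemma sfX u n : L u -> L (u ^+ n).
Proof.
by move=> Lu; elim: n => [|n IHn]; [exact: sf1 | rewrite exprS; apply: sfM].
Qed.
Lemma sf_natmul u n : L u -> L (u *+ n).
Proof.
by move=> Lu; elim: n => [|n IHn]; [exact: sf0 | rewrite mulrS; apply: sfD].
Qed.
Lemma sf_div u v : L u -> L v -> L (u / v).
Proof. by move=> Lu Lv; apply/sfM/sfV. Qed.
Lemma sf_sum (I : Type) (r : seq I) (P : pred I) (G : I -> F) :
  (forall i, L (G i)) -> L (\sum_(i <- r | P i) G i).
Proof. by move=> LG; apply: big_ind => //; [exact: sf0 | exact: sfD]. Qed.
Lemma sf_horner (p : {poly F}) u : (forall i, L p`_i) -> L u -> L p.[u].
Proof.
by move=> Lp Lu; rewrite horner_coef; apply: sf_sum => i; apply/sfM/sfX.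
Qed.

(** The proof that [L] is a subfield is an argument, so that closure under the operations can be
    attached to the predicate as an instance and [subf] inherits a field structure. *)
Definition subf_pred (_ : is_subfield L) : {pred F} := fun u => decide (L u).

Lemma subf_predP : GRing.divring_closed (subf_pred HL).
Proof.
split=> [|u v|u v]; rewrite !unfold_in; first exact/decideP/sf1.
  by move=> /decideP Lu /decideP Lv; apply/decideP/sfB.
by move=> /decideP Lu /decideP Lv; apply/decideP/sf_div.
Qed.

HB.instance Definition _ :=
  GRing.isDivringClosed.Build F (subf_pred HL) subf_predP.

Record subf := Subf { subf_val : F; _ : subf_val \in subf_pred HL }.

HB.instance Definition _ := [isSub for subf_val].
HB.instance Definition _ := [Choice of subf by <:].
HB.instance Definition _ := [SubChoice_isSubIntegralDomain of subf by <:].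
HB.instance Definition _ := [SubIntegralDomain_isSubField of subf by <:].

Lemma subf_valP (u : subf) : L (val u).
Proof. by case: u => v Hv; apply/decideP. Qed.

Lemma subf_ex u : L u -> exists v : subf, val v = u.
Proof.
move=> Lu; have u_in : u \in subf_pred HL by apply/decideP.
by exists (Subf u_in).
Qed.

Lemma subf_poly (p : {poly F}) :
  (forall i, L p`_i) -> exists q : {poly subf}, p = map_poly (val : subf -> F) q.
Proof.
move=> Lp; have ex i : exists v : subf, val v == p`_i.
  by have [v <-] := subf_ex (Lp i); exists v.
exists (\poly_(i < size p) xchoose (ex i)); apply/polyP=> i.
rewrite coef_map coef_poly; case: ltnP => [_|le_pi]; last by rewrite nth_default.
exact/esym/eqP/(xchooseP (ex i)).
Qed.

End Subfield.

Section Fractions.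
Variables (R : comNzRingType) (F : fieldType) (e : {rmorphism R -> F}).

(** Taken as the test subfield in the definition of [adjoin], this turns membership in a generated
    field into an explicit quotient of two values of [e]. *)
Lemma frac_sf : is_subfield (fun u => exists a b : R, e b != 0 /\ u = e a / e b).
Proof.
split=> [|u1 u2|u1 u2|u1].
- by exists 1, 1; rewrite rmorph1 oner_neq0 divr1.
- move=> [a1 [b1 [nz1 ->]]] [a2 [b2 [nz2 ->]]].
  exists (a1 * b2 - a2 * b1), (b1 * b2).
  by rewrite rmorphB !rmorphM mulf_neq0 //; split=> //; field; rewrite nz1 nz2.
- move=> [a1 [b1 [nz1 ->]]] [a2 [b2 [nz2 ->]]].
  exists (a1 * a2), (b1 * b2).
  by rewrite !rmorphM mulf_neq0 //; split=> //; field; rewrite nz1 nz2.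
- move=> [a1 [b1 [nz1 ->]]]; have [a0|nza] := eqVneq (e a1) 0.
    by exists 0, 1; rewrite rmorph1 oner_neq0 a0 rmorph0 !mul0r invr0.
  by exists b1, a1; rewrite invf_div.
Qed.

Lemma frac_sf_mem u : (exists a, u = e a) -> exists a b : R, e b != 0 /\ u = e a / e b.
Proof. by case=> a ->; exists a, 1; rewrite rmorph1 oner_neq0 divr1. Qed.

End Fractions.

(** * Relative algebraic closure *)

(** Coefficients stay in [F] and are merely required to lie in [L], so that different base fields
    can be compared inside [F]. *)
Definition algc (F : fieldType) (L : F -> Prop) (u : F) : Prop :=
  exists2 p : {poly F}, p != 0 & (forall i, L p`_i) /\ root p u.

Section AlgebraicClosure.
Variable F : fieldType.
Implicit Types L : F -> Prop.

Lemma algc_over L (HL : is_subfield L) u :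
  algc L u <-> algebraicOver (val : subf HL -> F) u.
Proof.
split=> [[p nz_p [Lp pu]]|[q nz_q qu]].
  have [q def_p] := subf_poly HL Lp; exists q; last by rewrite -def_p.
  by apply: contraNneq nz_p => q0; rewrite def_p q0 rmorph0.
exists (map_poly val q); first by rewrite map_poly_eq0.
by split=> // i; rewrite coef_map; apply: subf_valP.
Qed.

Lemma algc_mono L L' u : (forall v, L v -> L' v) -> algc L u -> algc L' u.
Proof. by move=> LL' [p nz_p [Lp pu]]; exists p => //; split=> // i; apply: LL'. Qed.

Lemma algc_id L u : is_subfield L -> L u -> algc L u.
Proof.
move=> HL Lu; have [v <-] := subf_ex HL Lu.
exact/(algc_over HL)/algebraic_id.
Qed.

Lemma algc_sf L : is_subfield L -> is_subfield (algc L).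
Proof.
move=> HL; split=> [|u v|u v|u]; rewrite ?(algc_over HL).
- exact: algebraic1.
- exact: algebraic_sub.
- exact: algebraic_mul.
- exact: algebraic_inv.
Qed.

Lemma algc_trans L u : is_subfield L -> algc (algc L) u -> algc L u.
Proof.
move=> HL [p nz_p [Lp pu]].
apply/(algc_over HL)/integral_algebraic/(integral_root nz_p pu).
apply/integral_poly => i; apply/integral_algebraic/(algc_over HL).
exact: Lp.
Qed.

(** [u] is a root of [X^2 - u^2], whose coefficients are algebraic over [L]. Most dependence claims
    below reduce to this by completing a square. *)
Lemma algc_sqrt L u : is_subfield L -> algc L (u ^+ 2) -> algc L u.
Proof.
move=> HL Lu; apply: (algc_trans HL).
exists ('X^2 - (u ^+ 2)%:P); first by rewrite monic_neq0 ?monicXnsubC.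
split; last by rewrite rootE !hornerE subrr.
move=> i; rewrite coefB coefXn coefC.
have HA := algc_sf HL; apply: (sfB HA); first exact/(sf_natmul HA)/(sf1 HA).
by case: ifP => _ //; apply: sf0.
Qed.

End AlgebraicClosure.

Definition hev (N F : fieldType) (f : {rmorphism N -> F}) v : {rmorphism {poly N} -> F} :=
  horner_eval v \o map_poly f.

Lemma hevE (N F : fieldType) (f : {rmorphism N -> F}) v p : hev f v p = (map_poly f p).[v].
Proof. by []. Qed.

Lemma hevC (N F : fieldType) (f : {rmorphism N -> F}) v c : hev f v c%:P = f c.
Proof. by rewrite hevE map_polyC hornerC. Qed.

Lemma hevX (N F : fieldType) (f : {rmorphism N -> F}) v : hev f v 'X = v.
Proof. by rewrite hevE map_polyX hornerX. Qed.

(** A common denominator [B(v)] is built up coefficient by coefficient. The inner variable of [Q] is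
    the one specialized to [v]. *)
Lemma clear_denominators (N F : fieldType) (f : {rmorphism N -> F}) v (p : {poly F}) :
  (forall i, exists A B : {poly N},
     (map_poly f B).[v] != 0 /\ p`_i = (map_poly f A).[v] / (map_poly f B).[v]) ->
  exists (B : {poly N}) (Q : {poly {poly N}}), (map_poly f B).[v] != 0 /\
    (map_poly f B).[v] *: p = map_poly (horner_eval v) (map_poly (map_poly f) Q).
Proof.
elim/poly_ind: p => [_|p c IHp sp].
  by exists 1, 0; rewrite !rmorph1 hornerC oner_neq0 scaler0 !rmorph0.
have [i|B [Q [nzB def_p]]] := IHp.
  by have := sp i.+1; rewrite coefD coefMX coefC addr0.
have := sp 0%N; rewrite coefD coefMX coefC add0r => -[A [C [nzC def_c]]].
exists (B * C), (C%:P * Q * 'X + (B * A)%:P).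
rewrite rmorphM hornerM mulf_neq0 //; split=> //.
rewrite !rmorphD !rmorphM /= -def_p !map_polyX !map_polyC /= /horner_eval.
have <- : (map_poly f C).[v]%:P * c%:P = (map_poly f A).[v]%:P.
  by rewrite def_c -polyCM mulrC divfK.
by rewrite -!mul_polyC !polyCM; ring.
Qed.

(** * Generated subfields and the exchange property *)

Section Adjoin.
Variables (K F : fieldType) (iota : {rmorphism K -> F}).
Implicit Types (S : F -> Prop) (s : seq F).

Lemma adjoin_sf S : is_subfield (adjoin iota S).
Proof.
split=> [|u v Hu Hv|u v Hu Hv|u Hu] L HL LK LS.
- exact: sf1.
- by apply: (sfB HL); [apply: Hu | apply: Hv].
- by apply: (sfM HL); [apply: Hu | apply: Hv].
- by apply: (sfV HL); apply: Hu.
Qed.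

Lemma adjoin_const S k : adjoin iota S (iota k).
Proof. by move=> L _ + _; apply. Qed.

Lemma adjoin_mem S u : S u -> adjoin iota S u.
Proof. by move=> Su L _ _; apply. Qed.

Lemma adjoin_sub S S' u :
  (forall v, S v -> adjoin iota S' v) -> adjoin iota S u -> adjoin iota S' u.
Proof. by move=> SS'; apply=> //; [apply: adjoin_sf | apply: adjoin_const]. Qed.

Definition gen s := adjoin iota (fun u => u \in s).
Definition cls s := algc (gen s).

Lemma gen_sf s : is_subfield (gen s). Proof. exact: adjoin_sf. Qed.
Lemma gen_const s k : gen s (iota k). Proof. exact: adjoin_const. Qed.
Lemma gen_mem s u : u \in s -> gen s u.
Proof. exact: (@adjoin_mem (fun u => u \in s)). Qed.
Lemma gen_sub s s' u : (forall v, v \in s -> gen s' v) -> gen s u -> gen s' u.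
Proof. exact: adjoin_sub. Qed.

Lemma cls_sf s : is_subfield (cls s). Proof. exact/algc_sf/gen_sf. Qed.
Lemma cls_gen s u : gen s u -> cls s u. Proof. exact/algc_id/gen_sf. Qed.
Lemma cls_const s k : cls s (iota k). Proof. by apply: cls_gen; apply: gen_const. Qed.
Lemma cls_mem s u : u \in s -> cls s u.
Proof. by move=> su; apply: cls_gen; apply: gen_mem. Qed.
Lemma cls_sqrt s u : cls s (u ^+ 2) -> cls s u. Proof. exact/algc_sqrt/gen_sf. Qed.

Lemma cls_sub s s' u : (forall v, v \in s -> cls s' v) -> cls s u -> cls s' u.
Proof.
move=> ss' su; apply: (algc_trans (gen_sf s')); apply: algc_mono su => v.
by apply=> //; [exact: cls_sf | exact: cls_const].
Qed.

Section Exchange.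
Variable s : seq F.
Let N : fieldType := subf (gen_sf s).
Let valN : {rmorphism N -> F} := (val : {rmorphism subf (gen_sf s) -> F}).

Lemma gen_cons_frac v u : gen (v :: s) u ->
  exists A B : {poly subf (gen_sf s)},
    (map_poly val B).[v] != 0 /\ u = (map_poly val A).[v] / (map_poly val B).[v].
Proof.
pose e := hev valN v; move=> gu; apply: (gu _ (frac_sf e)) => [k|w].
  have [c def_c] := subf_ex (gen_sf s) (@gen_const s k).
  by apply: frac_sf_mem; exists c%:P; rewrite /e hevC.
rewrite inE => /predU1P[->|sw]; apply: frac_sf_mem; first by exists 'X; rewrite /e hevX.
have [c def_c] := subf_ex (gen_sf s) (gen_mem sw).
by exists c%:P; rewrite /e hevC.
Qed.

(** Let [Q(v, x) = 0] be a relation over [K(s)]. Read as a polynomial in [v], it has a coefficient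
    that is a nonzero polynomial in [x], and this cannot vanish because [x] is transcendental over
    [K(s)]. Hence the relation really involves [v]. *)
Lemma cls_exchange v x : cls (v :: s) x -> ~ cls s x -> cls (x :: s) v.
Proof.
move=> [p nz_p [sp px]] nsx.
have [B [Q [nzB def_p]]] := clear_denominators (fun i => gen_cons_frac (sp i)).
have HG := gen_sf (x :: s).
(* [swapXY] makes this the relation as a polynomial in [v], with coefficients evaluated at [x]. *)
exists (map_poly (horner_eval x) (map_poly (map_poly valN) (swapXY Q))).
  apply/negP => /eqP r0.
  have nzQ : swapXY Q != 0.
    rewrite swapXY_eq0; apply: contraNneq nz_p => Q0.
    by move/eqP: def_p; rewrite Q0 !rmorph0 scaler_eq0 (negPf nzB).
  have [i nzQi] : exists i, (swapXY Q)`_i != 0.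
    by exists (size (swapXY Q)).-1; rewrite -lead_coefE lead_coef_eq0.
  case: nsx; apply/(algc_over (gen_sf s)); exists (swapXY Q)`_i => //.
  by have /polyP/(_ i) := r0; rewrite !coef_map coef0 => /eqP; rewrite rootE.
split=> [i|].
  rewrite !coef_map; apply: (sf_horner HG) => [j|]; last by apply: gen_mem; apply: mem_head.
  rewrite coef_map; apply: gen_sub (subf_valP _) => w sw.
  by apply: gen_mem; rewrite inE sw orbT.
have hE y (P : {poly {poly F}}) z : (map_poly (horner_eval y) P).[z] = P.[z%:P].[y].
  by rewrite -{1}[z](hornerC z y) -/(horner_eval y z%:P) horner_map.
rewrite rootE hE -swapXY_map horner2_swapXY -hE -def_p hornerZ (rootP px).
by rewrite mulr0.
Qed.

End Exchange.
End Adjoin.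

(** * Algebraic independence *)

Lemma mpoly_rmorphE n (R S : comNzRingType) (f : {rmorphism {mpoly R[n]} -> S}) p :
  f p = mmap (f \o @mpolyC n R) (fun i => f 'X_i) p.
Proof.
rewrite {1}[p]mpolyE rmorph_sum /mmap; apply: eq_bigr => m _.
rewrite -mul_mpolyC rmorphM; congr (_ * _).
by rewrite mpolyXE_id rmorph_prod; apply: eq_bigr => i _; rewrite rmorphXn.
Qed.

Lemma mpoly_rmorph_ext n (R S : comNzRingType) (f g : {rmorphism {mpoly R[n]} -> S}) :
  (forall c, f c%:MP = g c%:MP) -> (forall i, f 'X_i = g 'X_i) -> f =1 g.
Proof.
move=> eqC eqX p; rewrite (mpoly_rmorphE f) (mpoly_rmorphE g).
rewrite /mmap; apply: eq_bigr => m _; rewrite /= eqC; congr (_ * _).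
exact: mmap1_eq.
Qed.

Section LastVariable.
Variables (n : nat) (R : comNzRingType).

Let hlast (i : 'I_n.+1) : {poly {mpoly R[n]}} :=
  if unlift ord_max i is Some j then ('X_j)%:P else 'X.

(** Together with [mpoly_init] this is the isomorphism of polynomials in [n + 1] variables with
    polynomials in the last one over those in the first [n]; it supports inductions on [n]. *)
Definition mpoly_last : {mpoly R[n.+1]} -> {poly {mpoly R[n]}} :=
  mmap (polyC \o @mpolyC n R) hlast.
HB.instance Definition _ := GRing.RMorphism.copy mpoly_last
  (mmap (polyC \o @mpolyC n R) hlast).

Definition mpoly_init : {mpoly R[n]} -> {mpoly R[n.+1]} :=
  mmap (@mpolyC n.+1 R) (fun i => 'X_(lift ord_max i)).
HB.instance Definition _ := GRing.RMorphism.copy mpoly_init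
  (mmap (@mpolyC n.+1 R) (fun i => 'X_(lift ord_max i))).

Lemma mpoly_initC c : mpoly_init c%:MP = c%:MP. Proof. exact: mmapC. Qed.
Lemma mpoly_initX i : mpoly_init 'X_i = 'X_(lift ord_max i).
Proof. by rewrite /mpoly_init mmapX mmap1U. Qed.
Lemma mpoly_lastC c : mpoly_last c%:MP = (c%:MP)%:P. Proof. exact: mmapC. Qed.
Lemma mpoly_lastX i :
  mpoly_last 'X_i = if unlift ord_max i is Some j then ('X_j)%:P else 'X.
Proof. by rewrite /mpoly_last mmapX mmap1U. Qed.

Lemma mpoly_last_init p : mpoly_last (mpoly_init p) = p%:P.
Proof.
move: p; apply: (@mpoly_rmorph_ext _ _ _ (mpoly_last \o mpoly_init) polyC) => [c|i] /=.
  by rewrite mpoly_initC mpoly_lastC.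
by rewrite mpoly_initX mpoly_lastX liftK.
Qed.

Lemma mpoly_lastK p : (map_poly mpoly_init (mpoly_last p)).['X_ord_max] = p.
Proof.
pose g := horner_eval ('X_ord_max : {mpoly R[n.+1]}) \o map_poly mpoly_init \o mpoly_last.
move: p; apply: (@mpoly_rmorph_ext _ _ _ g idfun) => [c|i] /=.
  by rewrite mpoly_lastC map_polyC /horner_eval /= hornerC mpoly_initC.
rewrite mpoly_lastX; case: unliftP => [j|] ->.
  by rewrite map_polyC /horner_eval /= hornerC mpoly_initX.
by rewrite map_polyX /horner_eval hornerX.
Qed.

Lemma mpoly_last_eq0 p : mpoly_last p = 0 -> p = 0.
Proof. by move=> p0; rewrite -[p]mpoly_lastK p0 rmorph0 horner0. Qed.

Lemma mpoly_last_surj (Q : {poly {mpoly R[n]}}) :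
  mpoly_last (map_poly mpoly_init Q).['X_ord_max] = Q.
Proof.
rewrite -horner_map /= mpoly_lastX unlift_none -map_poly_comp.
rewrite (eq_map_poly (g := polyC)); last exact: mpoly_last_init.
exact: comp_polyXr.
Qed.

Lemma mmap_mpoly_last (S : comNzRingType) (f : {rmorphism R -> S}) (v : nat -> S) p :
  mmap f (fun i : 'I_n.+1 => v i) p =
  (map_poly (mmap f (fun i : 'I_n => v i)) (mpoly_last p)).[v n].
Proof.
pose e := mmap f (fun i : 'I_n => v i).
pose g := horner_eval (v n) \o map_poly e \o mpoly_last.
move: p; apply: (@mpoly_rmorph_ext _ _ _ (mmap f (fun i : 'I_n.+1 => v i)) g) => [c|i] /=.
  by rewrite mmapC mpoly_lastC map_polyC /horner_eval /= hornerC /e mmapC.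
rewrite mmapX mmap1U mpoly_lastX; case: unliftP => [j|] ->.
  rewrite map_polyC /horner_eval /= hornerC /e mmapX mmap1U.
  by congr v; apply: (lift_max j).
by rewrite map_polyX /horner_eval hornerX.
Qed.

End LastVariable.

Section Independence.
Variables (K F : fieldType) (iota : {rmorphism K -> F}).

(** Values are indexed by [nat], not by ordinals, so that one sequence [v] serves for every number
    of variables and inductions on [n] involve no casts. *)
Definition mev n (v : nat -> F) : {mpoly K[n]} -> F := mmap iota (fun i : 'I_n => v i).
HB.instance Definition _ n v := GRing.RMorphism.copy (@mev n v)
  (mmap iota (fun i : 'I_n => v i)).

Lemma mevC n v c : mev v (c%:MP : {mpoly K[n]}) = iota c.
Proof. exact: mmapC. Qed.

Lemma mevX n v i : mev v ('X_i : {mpoly K[n]}) = v i.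
Proof. by rewrite [LHS]mmapX mmap1U. Qed.

Definition indep n v := forall p : {mpoly K[n]}, mev v p = 0 -> p = 0.

Definition genv n (v : nat -> F) := adjoin iota (fun u => exists2 i, (i < n)%N & u = v i).

Lemma mev_genv n v (p : {mpoly K[n]}) : genv n v (mev v p).
Proof.
have HG : is_subfield (genv n v) by apply: adjoin_sf.
rewrite /mev /mmap; apply: (sf_sum HG) => m; apply: (sfM HG).
  exact: adjoin_const.
rewrite /mmap1; apply: (big_ind (genv n v)) => [||i _]; [exact: sf1|exact: sfM|].
by apply: (sfX HG); apply: adjoin_mem; exists i.
Qed.

Lemma genv_frac n v u : genv n v u ->
  exists p q : {mpoly K[n]}, mev v q != 0 /\ u = mev v p / mev v q.
Proof.
move=> gu; apply: (gu _ (frac_sf (mev v))) => [k|w [i lt_in ->]]; apply: frac_sf_mem.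
  by exists k%:MP; rewrite /= mevC.
by exists 'X_(Ordinal lt_in); rewrite /= mevX.
Qed.

Lemma genv_clear n v (p : {poly F}) : (forall i, genv n v p`_i) ->
  exists (B : {mpoly K[n]}) (Q : {poly {mpoly K[n]}}),
    mev v B != 0 /\ mev v B *: p = map_poly (mev v) Q.
Proof.
elim/poly_ind: p => [_|p c IHp gp].
  by exists 1, 0; rewrite !rmorph1 oner_neq0 scaler0 !rmorph0.
have [i|B [Q [nzB def_p]]] := IHp.
  by have := gp i.+1; rewrite coefD coefMX coefC addr0.
have := gp 0%N; rewrite coefD coefMX coefC add0r => /genv_frac[A [C [nzC def_c]]].
exists (B * C), (C%:P * Q * 'X + (B * A)%:P).
rewrite rmorphM mulf_neq0 //; split=> //.
rewrite rmorphD !rmorphM /= -def_p !map_polyX !map_polyC /=.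
have <- : (mev v C)%:P * c%:P = (mev v A)%:P.
  by rewrite def_c -polyCM mulrC divfK.
by rewrite -!mul_polyC !polyCM; ring.
Qed.

(** Through [mpoly_last], a relation among the first [n + 1] values is an equation for [v n] with
    coefficients polynomial in the others; conversely an equation over the generated field becomes
    such a relation after clearing denominators. *)
Lemma indepS n v : indep n.+1 v <-> indep n v /\ ~ algc (genv n v) (v n).
Proof.
split=> [ind_v|[ind_v nalg] p].
  have ind' Q : (map_poly (mev v) Q).[v n] = 0 -> Q = 0 :> {poly {mpoly K[n]}}.
    move=> Q0; rewrite -[Q]mpoly_last_surj [X in mpoly_last X]ind_v ?rmorph0 //.
    by rewrite /mev mmap_mpoly_last mpoly_last_surj.
  split=> [p p0|[p nz_p [gp pv]]].
    by apply/(@polyC_inj {mpoly K[n]})/ind'; rewrite map_polyC hornerC.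
  have [B [Q [nzB def_p]]] := genv_clear gp.
  have Q0 : Q = 0 by apply: ind'; rewrite -def_p hornerZ (rootP pv) mulr0.
  move/eqP: def_p; rewrite Q0 rmorph0 scaler_eq0 (negPf nzB) /=.
  exact/negP.
rewrite /mev mmap_mpoly_last => p0; apply: mpoly_last_eq0.
apply/eqP; apply: contra_notT nalg => nz_p; exists (map_poly (mev v) (mpoly_last p)).
  apply: contraNneq nz_p => q0; apply/eqP/polyP => i; rewrite coef0.
  by apply: ind_v; have /polyP/(_ i) := q0; rewrite coef_map coef0.
by split=> [i|]; [rewrite coef_map; apply: mev_genv | apply/rootP].
Qed.

Lemma indep0 v : indep 0 v.
Proof.
move=> p p0; have [c def_p] : exists c, p = c%:MP.
  exists p@_0%MM; apply/mpolyP => m; rewrite mcoeffC.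
  suff -> : m = 0%MM by rewrite eqxx mulr1.
  by apply/mnmP => -[].
move: p0; rewrite def_p [mev _ _]mmapC => /eqP; rewrite fmorph_eq0 => /eqP->.
exact: mpolyC0.
Qed.

(** [alg_independent] speaks of arbitrary injective families in the set. Such a family chooses
    distinct positions in [s], and the renaming [r] of variables is injective because it is undone
    by [g], which sends the variables outside the family to 0. *)
Lemma indep_alg_independent (s : seq F) :
  indep (size s) (nth 0 s) -> alg_independent iota (fun u => u \in s).
Proof.
move=> ind_s n y inj_y ys p p0.
have lt_f i : (index (y i) s < size s)%N by rewrite index_mem ys.
pose f i := Ordinal (lt_f i).
have inj_f : injective f.
  move=> i j /(congr1 (fun k : 'I_(size s) => nth 0 s k)) /=.
  by rewrite !nth_index ?ys // => /inj_y.
pose r := mmap (@mpolyC (size s) K) (fun i : 'I_n => 'X_(f i)).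
pose g := mmap (@mpolyC n K)
  (fun j : 'I_(size s) => if [pick i | f i == j] is Some i then 'X_i else 0).
have gK : cancel r g.
  apply: (@mpoly_rmorph_ext _ _ _ (g \o r) idfun) => [c|i] /=.
    by rewrite /r mmapC /g mmapC.
  rewrite /r mmapX mmap1U /g mmapX mmap1U; case: pickP => [j /eqP/inj_f-> //|].
  by move/(_ i); rewrite eqxx.
suff r0 : r p = 0 by rewrite -[p]gK r0 /g rmorph0.
apply: ind_s; apply: etrans p0; move: p.
apply: (@mpoly_rmorph_ext _ _ _ (mev (nth 0 s) \o r) (mmap iota y)) => [c|i] /=.
  by rewrite /r mmapC /mev !mmapC.
by rewrite /r mmapX mmap1U /mev !mmapX !mmap1U /= nth_index.
Qed.

End Independence.

(** * Transcendence degree three *)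

Section Transcendence.
Variables (K F : fieldType) (iota : {rmorphism K -> F}).
Notation gen := (gen iota).
Notation cls := (cls iota).

Lemma genv_nth (s : seq F) n u : (n <= size s)%N ->
  genv iota n (nth 0 s) u <-> gen (take n s) u.
Proof.
move=> le_ns; split; apply: adjoin_sub => v.
  case=> i lt_in ->; apply: adjoin_mem; rewrite -(nth_take 0 lt_in).
  by rewrite mem_nth // size_takel.
move=> /(nthP 0)[i]; rewrite size_takel // => lt_in <-; apply: adjoin_mem.
by exists i; rewrite // nth_take.
Qed.

Lemma indep_nthS (s : seq F) n : (n < size s)%N ->
  indep iota n.+1 (nth 0 s) <->
  indep iota n (nth 0 s) /\ ~ cls (take n s) (nth 0 s n).
Proof.
move=> lt_ns; rewrite indepS.
have eq_n u : genv iota n (nth 0 s) u <-> gen (take n s) u.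
  exact/genv_nth/ltnW.
split=> -[ind_s nalg]; split=> //; apply: contra_not nalg.
  by apply: algc_mono => v /eq_n.
by apply: algc_mono => v /eq_n.
Qed.

Definition trdeg3 (x1 x2 x3 : F) := indep iota 3 (nth 0 [:: x1; x2; x3]).

Lemma trdeg3P x1 x2 x3 : trdeg3 x1 x2 x3 <->
  [/\ ~ cls [::] x1, ~ cls [:: x1] x2 & ~ cls [:: x1; x2] x3].
Proof.
rewrite /trdeg3; split=> [/indep_nthS|[H1 H2 H3]].
  by case=> // + H3 => /indep_nthS[] // + H2 => /indep_nthS[] // _ H1.
by do 3![apply/indep_nthS => //; split=> //]; apply: indep0.
Qed.

(* Steinitz exchange for three elements against two. *)
Lemma trdeg3_not_cls2 x1 x2 x3 u v : trdeg3 x1 x2 x3 ->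
  cls [:: u; v] x1 -> cls [:: u; v] x2 -> cls [:: u; v] x3 -> False.
Proof.
move=> /trdeg3P[n1 n2 n3] c1 c2 c3.
have [w cw] : exists w, forall z, cls [:: u; v] z -> cls [:: w; x1] z.
  have [c1v|n1v] := excluded_middle_informative (cls [:: v] x1).
    have cv : cls [:: x1] v by apply: cls_exchange c1v n1.
    exists u => z; apply: cls_sub => y; rewrite !inE => /orP[]/eqP->.
      by apply: cls_mem; rewrite inE eqxx.
    by apply: cls_sub cv => t; rewrite inE => /eqP->; apply: cls_mem; rewrite !inE eqxx orbT.
  have cu : cls [:: x1; v] u by apply: cls_exchange n1v.
  exists v => z; apply: cls_sub => y; rewrite !inE => /orP[]/eqP->.
    by apply: cls_sub cu => t; rewrite !inE => /orP[]/eqP->;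
      apply: cls_mem; rewrite !inE eqxx ?orbT.
  by apply: cls_mem; rewrite inE eqxx.
have cw' : cls [:: x2; x1] w by apply: cls_exchange n2; apply: cw.
apply: n3; apply: cls_sub (cw _ c3) => y; rewrite !inE => /orP[]/eqP->.
  by apply: cls_sub cw' => t; rewrite !inE => /orP[]/eqP->;
    apply: cls_mem; rewrite !inE eqxx ?orbT.
by apply: cls_mem; rewrite !inE eqxx.
Qed.

(** A dependence among the [z]'s would allow one of them to be dropped, and two elements cannot
    algebraically span three independent ones. *)
Lemma trdeg3_cls x1 x2 x3 z1 z2 z3 : trdeg3 x1 x2 x3 ->
    cls [:: z1; z2; z3] x1 -> cls [:: z1; z2; z3] x2 -> cls [:: z1; z2; z3] x3 ->
  trdeg3 z1 z2 z3.
Proof.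
move=> indx c1 c2 c3.
have no2 u v : cls [:: u; v] z1 -> cls [:: u; v] z2 -> cls [:: u; v] z3 -> False.
  move=> d1 d2 d3; apply: (trdeg3_not_cls2 (u := u) (v := v) indx).
  - by apply: cls_sub c1 => y; rewrite !inE => /or3P[]/eqP->.
  - by apply: cls_sub c2 => y; rewrite !inE => /or3P[]/eqP->.
  - by apply: cls_sub c3 => y; rewrite !inE => /or3P[]/eqP->.
apply/trdeg3P; split=> cz.
- apply: (no2 z2 z3); try by apply: cls_mem; rewrite !inE eqxx ?orbT.
  by apply: cls_sub cz.
- apply: (no2 z1 z3); try by apply: cls_mem; rewrite !inE eqxx ?orbT.
  by apply: cls_sub cz => y; rewrite inE => /eqP->; apply: cls_mem; rewrite !inE eqxx.
- by apply: (no2 z1 z2) => //; apply: cls_mem; rewrite !inE eqxx ?orbT.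
Qed.

Lemma trdeg3_purely_transcendental (L : F -> Prop) x1 x2 x3 z1 z2 z3 :
    trdeg3 x1 x2 x3 -> (forall u, L u <-> gen [:: z1; z2; z3] u) ->
    cls [:: z1; z2; z3] x1 -> cls [:: z1; z2; z3] x2 -> cls [:: z1; z2; z3] x3 ->
  purely_transcendental iota L.
Proof.
move=> indx defL c1 c2 c3; exists (fun u => u \in [:: z1; z2; z3]) => //.
exact/indep_alg_independent/(trdeg3_cls indx).
Qed.

End Transcendence.

(** * Norms from quadratic extensions along a line *)

Section PolyDescent.
Variable E : fieldType.
Implicit Types (p q pi rho f : {poly E}) (m : E).

Lemma dvdp_ex p q : p %| q -> exists r : {poly E}, q = r * p.
Proof. by move=> /dvdpP[r ->]; exists r. Qed.

Lemma irreducible_poly_coprime pi p : irreducible_poly pi -> ~~ (pi %| p) -> coprimep pi p.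
Proof.
move=> [sz_pi irr_pi] ndiv; rewrite coprimep_def.
apply: contraNT ndiv => /irr_pi /(_ (dvdp_gcdl _ _)).
by move=> /andP[_ /dvdp_trans]; apply; apply: dvdp_gcdr.
Qed.

Lemma irreducible_poly_dvdM pi p q :
  irreducible_poly pi -> (pi %| p * q) = (pi %| p) || (pi %| q).
Proof.
move=> irr_pi; have [dvd_p|ndvd_p] := boolP (pi %| p); first by rewrite dvdp_mulr.
by rewrite Gauss_dvdpr // irreducible_poly_coprime.
Qed.

Lemma irreducible_poly_dvdX2 pi p : irreducible_poly pi -> (pi %| p ^+ 2) = (pi %| p).
Proof. by move=> irr_pi; rewrite expr2 irreducible_poly_dvdM // orbb. Qed.

Lemma irreducible_poly_factor p : (1 < size p)%N ->
  exists2 pi, irreducible_poly pi & pi %| p.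
Proof.
move=> p_gt1.
pose P n := decide (exists q, [/\ size q = n, (1 < n)%N & q %| p]).
have exP : exists n, P n by exists (size p); apply/decideP; exists p; rewrite dvdpp.
case: (ex_minnP exP) => n /decideP[pi [<- pi_gt1 pi_p]] min_pi.
exists pi => //; split=> // q q_neq1 q_pi.
have nz_pi : pi != 0 by rewrite -size_poly_gt0 ltnW.
have nz_q : q != 0 by apply: contraTneq q_pi => ->; rewrite dvd0p.
have q_gt1 : (1 < size q)%N by rewrite ltn_neqAle eq_sym q_neq1 size_poly_gt0.
have le_pq : (size pi <= size q)%N.
  by apply: min_pi; apply/decideP; exists q; split=> //; apply: dvdp_trans pi_p.
by rewrite -dvdp_size_eqp // eqn_leq dvdp_leq.
Qed.

(** Being 0 modulo [pi] counts as being a square. *)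
Definition sqmod pi p := exists z : {poly E}, pi %| z ^+ 2 - p.

Lemma sqmod_dvd pi rho p : rho %| pi -> sqmod pi p -> sqmod rho p.
Proof. by move=> rho_pi [z zp]; exists z; apply: dvdp_trans zp. Qed.

Lemma sqmod_congr pi p q : pi %| p - q -> sqmod pi p -> sqmod pi q.
Proof.
by move=> pq [z zp]; exists z; rewrite -(subrKA p) dvdp_add.
Qed.

Lemma inv_mod pi p : irreducible_poly pi -> ~~ (pi %| p) -> exists v : {poly E}, pi %| p * v - 1.
Proof.
move=> irr_pi ndvd; have := irreducible_poly_coprime irr_pi ndvd.
move=> /Bezout_eq1_coprimepP[[u v] /= uv]; exists v.
rewrite -uv opprD addrCA [v * p]mulrC subrr addr0 dvdpNr.
exact: dvdp_mulIr.
Qed.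

Lemma sqmod_div pi p q : irreducible_poly pi -> ~~ (pi %| p) ->
  sqmod pi p -> sqmod pi (p * q) -> sqmod pi q.
Proof.
move=> irr_pi ndvd [y yp] [z zpq].
have ndvd_y : ~~ (pi %| y).
  apply: contra ndvd => pi_y; rewrite -[p](subKr (y ^+ 2)).
  by rewrite dvdp_sub // irreducible_poly_dvdX2.
have [v yv] := inv_mod irr_pi ndvd_y; exists (z * v).
have -> : (z * v) ^+ 2 - q = v ^+ 2 * (z ^+ 2 - p * q) - v ^+ 2 * q * (y ^+ 2 - p)
  + q * (y * v + 1) * (y * v - 1) by ring.
by apply: dvdp_add; [apply: dvdp_sub|]; apply: dvdp_mull.
Qed.

(** Infinite descent on [W]. If [pi] divides [W], then it divides [X], hence [a Y^2], hence [Y], and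
    the equation can be divided by [pi^2]. Once [pi] does not divide [W], reducing modulo [pi] and
    inverting [W] gives the square root. *)
Lemma sqmod_descent pi (a g X Y W : {poly E}) : irreducible_poly pi -> W != 0 -> ~~ (pi %| a) ->
  X ^+ 2 - pi * a * Y ^+ 2 = g * W ^+ 2 -> sqmod pi g.
Proof.
move=> irr_pi; have nz_pi := irredp_neq0 irr_pi.
elim: {W}_.+1 {-2}W (ltnSn (size W)) X Y => // n IHn W leWn X Y nzW ndvd_a XY.
have [|ndvdW] := boolP (pi %| W); last first.
  have [v Wv] := inv_mod irr_pi ndvdW; exists (X * v).
  have -> : (X * v) ^+ 2 - g = v ^+ 2 * (g * W ^+ 2 + pi * a * Y ^+ 2) - g.
    by rewrite -XY; ring.
  have -> : v ^+ 2 * (g * W ^+ 2 + pi * a * Y ^+ 2) - g =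
    g * (W * v + 1) * (W * v - 1) + v ^+ 2 * a * Y ^+ 2 * pi by ring.
  by rewrite dvdp_add // dvdp_mull.
move=> /dvdp_ex[W1 defW].
have /dvdp_ex[X1 defX] : pi %| X.
  rewrite -irreducible_poly_dvdX2 // -(subrK (pi * a * Y ^+ 2) (X ^+ 2)) XY defW.
  have -> : g * (W1 * pi) ^+ 2 + pi * a * Y ^+ 2 = (g * W1 ^+ 2 * pi + a * Y ^+ 2) * pi by ring.
  exact: dvdp_mull.
have XY1 : X1 ^+ 2 * pi - a * Y ^+ 2 = g * W1 ^+ 2 * pi.
  by apply: (mulfI nz_pi); move: XY; rewrite defX defW => XY; rewrite -[RHS]mulrC;
    transitivity ((X1 * pi) ^+ 2 - pi * a * Y ^+ 2); [ring | rewrite XY; ring].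
have /dvdp_ex[Y1 defY] : pi %| Y.
  have : pi %| a * Y ^+ 2.
    have -> : a * Y ^+ 2 = (X1 ^+ 2 - g * W1 ^+ 2) * pi.
      by rewrite mulrBl -XY1; ring.
    exact: dvdp_mull.
  by rewrite irreducible_poly_dvdM // (negPf ndvd_a) irreducible_poly_dvdX2.
have nzW1 : W1 != 0 by apply: contraNneq nzW => W10; rewrite defW W10 mul0r.
apply: (IHn W1 _ X1 Y1) => //.
  by move: leWn; rewrite defW size_mul //; case: irr_pi => + _; move: (size W1) (size pi) => ? ?; lia.
apply: (mulfI nz_pi); rewrite -[RHS]mulrC -XY1 defY; ring.
Qed.

(** Norms from [E(sqrt m)]; [m] is allowed to be a square. *)
Definition nrm m u := exists g h : E, u = g ^+ 2 - m * h ^+ 2.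

Lemma nrmM m u v : nrm m u -> nrm m v -> nrm m (u * v).
Proof.
by move=> [g [h ->]] [g' [h' ->]]; exists (g * g' + m * h * h'), (g * h' + h * g'); ring.
Qed.

Lemma nrm_sqr m u : nrm m (u ^+ 2).
Proof. by exists u, 0; rewrite expr0n mulr0 subr0. Qed.

Lemma nrm_div m u v : v != 0 -> nrm m (u * v) -> nrm m v -> nrm m u.
Proof.
move=> nzv uv nv; have -> : u = u * v * v * (v^-1) ^+ 2 by field.
by apply/nrmM/nrm_sqr/nrmM.
Qed.

(** For [m = r^2] the form [g^2 - m h^2] is hyperbolic and represents everything. *)
Lemma nrm_split r u : 2%:R != 0 :> E -> r != 0 -> nrm (r ^+ 2) u.
Proof.
move=> nz2 nzr; exists ((u + 1) / 2%:R), ((u - 1) / (2%:R * r)).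
by field; rewrite nz2 nzr.
Qed.

(* [m] is a square modulo every prime of odd multiplicity in [f]. *)
Definition good m f := forall pi (f' h h' : {poly E}), irreducible_poly pi -> h != 0 ->
  f * h ^+ 2 = pi * f' * h' ^+ 2 -> ~~ (pi %| f') -> sqmod pi m%:P.

(** Elementary form of the fact that an algebra [(m, f)] over [E(x)] unramified on the affine line
    is constant, so that its values at two points agree. Induction on the degree: a prime [pi]
    dividing [f] exactly once satisfies [u^2 - m = w pi] with [w] of smaller degree than [pi]. At
    each point [w pi] takes a norm as value, so [pi] can be traded for [w], which is good again. *)
Lemma good_nrm m e0 e1 f : 2%:R != 0 :> E -> m != 0 -> good m f ->
  f.[e0] != 0 -> f.[e1] != 0 -> nrm m (f.[e0] * f.[e1]).
Proof.
move=> nz2 nzm.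
have [[r def_m]|nsq_m] := excluded_middle_informative (exists r, m = r ^+ 2).
  move=> _ _ _; rewrite def_m; apply: nrm_split => //.
  by apply: contraNneq nzm => r0; rewrite def_m r0 expr0n.
elim: {f}_.+1 {-2}f (ltnSn (size f)) => // n IHn f lefn good_f f0 f1.
have [|f_gt1] := leqP (size f) 1.
  by move=> /size1_polyC ->; rewrite !hornerC -expr2; apply: nrm_sqr.
have [pi irr_pi /dvdp_ex[g def_f]] := irreducible_poly_factor f_gt1.
have nz_pi := irredp_neq0 irr_pi.
have nz_g : g != 0 by apply: contraNneq f0 => g0; rewrite def_f g0 mul0r horner0.
have pi_gt1 : (1 < size pi)%N by case: irr_pi.
have size_g : (size g < size f)%N.
  by rewrite def_f size_mul //; move: pi_gt1; move: (size g) (size pi) => ? ?; lia.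
have size_pi : (size pi <= size f)%N.
  have := size_poly_gt0 g; rewrite nz_g def_f size_mul //.
  by move: (size g) (size pi) => ? ?; lia.
move: f0 f1; rewrite def_f !hornerM !mulf_eq0 !negb_or => /andP[g0 pi0] /andP[g1 pi1].
(* A factor [pi^2] changes neither goodness nor the norm class. *)
have [/dvdp_ex[g' def_g]|ndvd_g] := boolP (pi %| g).
  have nz_g' : g' != 0 by apply: contraNneq nz_g => g'0; rewrite def_g g'0 mul0r.
  move: g0 g1; rewrite def_g !hornerM !mulf_eq0 !negb_or => /andP[g0 _] /andP[g1 _].
  have -> : g'.[e0] * pi.[e0] * pi.[e0] * (g'.[e1] * pi.[e1] * pi.[e1]) =
     g'.[e0] * g'.[e1] * (pi.[e0] * pi.[e1]) ^+ 2 by ring.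
  apply/nrmM/nrm_sqr/IHn => //.
    move: size_g lefn pi_gt1; rewrite def_g size_mul //.
    by move: (size g') (size f) (size pi) => ? ? ?; lia.
  move=> rho f' h h' irr_rho nzh eq_g' ndvd; apply: (good_f rho f' h (pi * h')) => //.
  transitivity (pi ^+ 2 * (g' * h ^+ 2)); first by rewrite def_f def_g; ring.
  by rewrite eq_g'; ring.
have [z z_m] : sqmod pi m%:P.
  by apply: (good_f pi g 1 1) => //; rewrite ?oner_neq0 // def_f; ring.
have sq_pi : sqmod pi m%:P by exists z.
(* The remainder has smaller degree than [pi], and therefore so has the cofactor [w]. *)
pose u : {poly E} := z %% pi.
have /dvdp_ex[w def_w] : pi %| u ^+ 2 - m%:P.
  have [q def_z] : exists q : {poly E}, z = q * pi + u by exists (z %/ pi); apply: divp_eq.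
  have -> : u ^+ 2 - m%:P = (z ^+ 2 - m%:P) - q * (z + u) * pi by rewrite def_z; ring.
  by rewrite dvdp_sub // dvdp_mull.
(* Square [m] has been dealt with, so [u^2 - m] and its factor [w] have no zero in [E]. *)
have u_m e : u.[e] ^+ 2 - m != 0.
  by apply/negP => /eqP/subr0_eq um; case: nsq_m; exists u.[e].
have uE e : u.[e] ^+ 2 - m = w.[e] * pi.[e].
  by rewrite -hornerM -def_w !hornerE.
have w_e e : w.[e] != 0.
  by apply: contraNneq (u_m e) => w0; rewrite uE w0 mul0r.
have nz_w : w != 0 by apply: contraNneq (w_e 0) => ->; rewrite horner0.
have size_u : (size u < size pi)%N by rewrite ltn_modp.
have size_w : (size w < size pi)%N.
  have w_gt0 : (0 < size w)%N by rewrite size_poly_gt0.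
  have : (size (u ^+ 2 - m%:P)%R <= maxn (size u + size u).-1 1)%N.
    rewrite (leq_trans (size_polyD _ _)) // size_polyN expr2.
    by rewrite geq_max !leq_max size_polyMleq size_polyC_leq1 orbT.
  rewrite def_w size_mul //; move: pi_gt1 w_gt0 size_u.
  by move: (size w) (size u) (size pi) => ? ? ?; lia.
have nrm_w : nrm m (w.[e0] * w.[e1]).
  apply: IHn => //; first by apply: leq_trans size_w _; apply: leq_trans size_pi _.
  move=> rho f' h h' irr_rho nzh eq_w ndvd.
  (* At primes not dividing [pi], the identity [u^2 - pi w = m] feeds the descent. *)
  have [rho_pi|nrho_pi] := boolP (rho %| pi); first exact: sqmod_dvd sq_pi.
  apply: (@sqmod_descent rho (pi * f') _ (h * u) h' h) => //.
    by rewrite irreducible_poly_dvdM // negb_or nrho_pi.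
  transitivity (h ^+ 2 * u ^+ 2 - pi * (w * h ^+ 2)); first by rewrite eq_w; ring.
  rewrite [pi * _]mulrA [pi * w]mulrC -def_w; ring.
have nrm_g : nrm m (g.[e0] * g.[e1]).
  apply: IHn => //; first by apply: leq_trans size_g _.
  move=> rho f' h h' irr_rho nzh eq_g ndvd.
  have [rho_pi|nrho_pi] := boolP (rho %| pi); first exact: sqmod_dvd sq_pi.
  apply: (good_f rho (pi * f') h h') => //.
    by rewrite def_f mulrAC eq_g; ring.
  by rewrite irreducible_poly_dvdM // negb_or nrho_pi.
have -> : g.[e0] * pi.[e0] * (g.[e1] * pi.[e1]) =
  g.[e0] * g.[e1] * (pi.[e0] * pi.[e1]) by ring.
apply: nrmM => //; apply: (nrm_div _ _ nrm_w); first by rewrite mulf_neq0.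
have -> : pi.[e0] * pi.[e1] * (w.[e0] * w.[e1]) = (u.[e0] ^+ 2 - m) * (u.[e1] ^+ 2 - m).
  by rewrite !uE; ring.
by apply: nrmM; [exists u.[e0], 1 | exists u.[e1], 1]; rewrite expr1n mulr1.
Qed.

(** [T / D^2] is [t], and the hypotheses are the two conics cleared of denominators. Odd order of
    [t] at [pi] includes poles: there the right side of the second conic is [k t] to leading order,
    and since [-t] is a norm from the extension by [sqrt t], so is [-k] to leading order, hence a
    square modulo [pi]. *)
Lemma good_two_conics (b k d : E) (T D P Q U V : {poly E}) :
    b != 0 -> k != 0 -> d != 0 -> D != 0 ->
    P ^+ 2 - T * Q ^+ 2 = b%:P * (D ^+ 2) ^+ 2 ->
    U ^+ 2 - T * V ^+ 2 = k%:P * (T - (b * d ^+ 2)%:P * D ^+ 2) * D ^+ 2 ->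
  good (- k) T.
Proof.
move=> nzb nzk nzd nzD R1 R2 pi f' h h' irr_pi nzh eqT ndvd.
have pi_gt1 : (1 < size pi)%N by case: irr_pi.
have ndvdC c : c != 0 -> ~~ (pi %| c%:P).
  move=> nzc; apply/negP => /dvdp_leq; rewrite polyC_eq0 nzc size_polyC nzc => /(_ isT).
  by rewrite leqNgt pi_gt1.
have nzDh : D * h != 0 by rewrite mulf_neq0.
have sq_b : sqmod pi b%:P.
  apply: (@sqmod_descent pi f' _ (P * h) (h' * Q) (D ^+ 2 * h)) => //.
    by rewrite mulf_neq0 ?expf_neq0.
  have -> : (P * h) ^+ 2 - pi * f' * (h' * Q) ^+ 2 =
     P ^+ 2 * h ^+ 2 - (pi * f' * h' ^+ 2) * Q ^+ 2 by ring.
  rewrite -eqT; transitivity (h ^+ 2 * (P ^+ 2 - T * Q ^+ 2)); first by ring.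
  by rewrite R1; ring.
(* Cancelling the gcd writes [t] as [pi f' (h1 / W1)^2] with [h1], [W1] coprime, so that [pi]
   divides [W1] exactly when [t] has a pole. *)
pose z := gcdp h' (D * h).
have nz_z : z != 0 by rewrite gcdp_eq0 (negPf nzDh) andbF.
have /dvdp_ex[h1 def_h1] : z %| h' by apply: dvdp_gcdl.
have /dvdp_ex[W1 def_W1] : z %| D * h by apply: dvdp_gcdr.
have nzW1 : W1 != 0 by apply: contraNneq nzDh => W10; rewrite def_W1 W10 mul0r.
have co_h1W1 : coprimep h1 W1.
  have <- : h' %/ z = h1 by rewrite def_h1 mulpK.
  have <- : (D * h) %/ z = W1 by rewrite def_W1 mulpK.
  by apply: coprimep_div_gcd; rewrite nzDh orbT.
have R3 : (U * h ^+ 2) ^+ 2 - pi * f' * (h * h' * V) ^+ 2 =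
    k%:P * (pi * f' * h1 ^+ 2 - b%:P * (d%:P * W1) ^+ 2) * (z ^+ 2 * W1) ^+ 2.
  have -> : (U * h ^+ 2) ^+ 2 - pi * f' * (h * h' * V) ^+ 2 =
     h ^+ 4 * U ^+ 2 - (pi * f' * h' ^+ 2) * h ^+ 2 * V ^+ 2 by ring.
  transitivity (h ^+ 4 * (U ^+ 2 - T * V ^+ 2)); first by rewrite -eqT; ring.
  rewrite R2 polyCM rmorphXn /=.
  transitivity (k%:P * (T * h ^+ 2 - b%:P * d%:P ^+ 2 * (D * h) ^+ 2) * (D * h) ^+ 2).
    by ring.
  by rewrite eqT def_W1 def_h1; ring.
have [pi_W1|npi_W1] := boolP (pi %| W1); last first.
  have sq_kb : sqmod pi (k%:P * (pi * f' * h1 ^+ 2 - b%:P * (d%:P * W1) ^+ 2)).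
    by apply: sqmod_descent R3 => //; rewrite mulf_neq0 ?expf_neq0.
  have : sqmod pi ((d%:P * W1) ^+ 2 * (b%:P * (- k)%:P)).
    apply: sqmod_congr sq_kb; rewrite polyCN.
    have -> : k%:P * (pi * f' * h1 ^+ 2 - b%:P * (d%:P * W1) ^+ 2)
       - (d%:P * W1) ^+ 2 * (b%:P * - k%:P) = k%:P * f' * h1 ^+ 2 * pi by ring.
    exact: dvdp_mull.
  have ndW : ~~ (pi %| (d%:P * W1) ^+ 2).
    by rewrite irreducible_poly_dvdX2 // irreducible_poly_dvdM // negb_or ndvdC.
  move=> /(sqmod_div irr_pi ndW); case; first by exists (d%:P * W1); rewrite subrr dvdp0.
  move=> y yb; apply: (sqmod_div irr_pi (ndvdC _ nzb) sq_b); by exists y.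
have npi_h1 : ~~ (pi %| h1).
  apply/negP => pi_h1; have := coprimepP _ _ co_h1W1 pi pi_h1 pi_W1.
  by rewrite -size_poly_eq1 => /eqP sz; rewrite sz in pi_gt1.
case/dvdp_ex: pi_W1 => W2 def_W2.
have /dvdp_ex[X1 def_X] : pi %| U * h ^+ 2.
  rewrite -irreducible_poly_dvdX2 // -(subrK (pi * f' * (h * h' * V) ^+ 2) ((U * _) ^+ 2)).
  rewrite R3 {2}def_W2; set q := _ + _.
  have -> : q = (k%:P * (pi * f' * h1 ^+ 2 - b%:P * (d%:P * W1) ^+ 2) * (z ^+ 2 * W2) ^+ 2 * pi
     + f' * (h * h' * V) ^+ 2) * pi by rewrite /q; ring.
  exact: dvdp_mull.
(* At a pole, dividing [R3] by [pi] and multiplying by [-f'] exchanges the two squares on the left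
   and restores the shape required by the descent. *)
have sq : sqmod pi (- f' * (k%:P * (f' * h1 ^+ 2 - b%:P * d%:P ^+ 2 * pi * W2 ^+ 2))).
  apply: (@sqmod_descent pi f' _ (f' * (h * h' * V)) X1 (z ^+ 2 * W1)) => //.
    by rewrite mulf_neq0 ?expf_neq0.
  apply: (mulfI (irredp_neq0 irr_pi)).
  transitivity (- f' * ((X1 * pi) ^+ 2 - pi * f' * (h * h' * V) ^+ 2)); first by ring.
  by rewrite -def_X R3 {1}def_W2; ring.
have ndW : ~~ (pi %| (f' * h1) ^+ 2).
  by rewrite irreducible_poly_dvdX2 // irreducible_poly_dvdM // negb_or ndvd.
apply: (sqmod_div irr_pi ndW); first by exists (f' * h1); rewrite subrr dvdp0.
apply: sqmod_congr sq; rewrite polyCN.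
have -> : - f' * (k%:P * (f' * h1 ^+ 2 - b%:P * d%:P ^+ 2 * pi * W2 ^+ 2))
  - (f' * h1) ^+ 2 * - k%:P = f' * k%:P * b%:P * d%:P ^+ 2 * W2 ^+ 2 * pi by ring.
exact: dvdp_mull.
Qed.

End PolyDescent.

(** * Infinite fields and lines through a rational point *)

Definition infinite (K : fieldType) := forall s : seq K, exists x, x \notin s.

(** In a finite field the nonzero squares [S] make up at least half of the nonzero elements [N].
    Here [S], [b S] and [m S] would be disjoint subsets of [N], giving [3 |S| <= 2 |S|]. *)
Lemma three_nonsquares_infinite (K : fieldType) (b m : K) : b != 0 -> m != 0 ->
    ~ nonzero_square b -> ~ nonzero_square m -> ~ nonzero_square (b * m) ->
  infinite K.
Proof.
move=> nzb nzm nsb nsm nsbm s0; apply: NNPP => finK.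
have s0P x : x \in s0 by apply: contra_notT finK; exists x.
pose N := [seq x <- undup s0 | x != 0]; pose S := undup [seq x ^+ 2 | x <- N].
have NE x : (x \in N) = (x != 0) by rewrite mem_filter mem_undup s0P andbT.
have SE y : y \in S -> nonzero_square y.
  by rewrite mem_undup => /mapP[x]; rewrite NE => nzx ->; exists x.
have SN y : y \in S -> y != 0 by move=> /SE[x nzx ->]; rewrite expf_neq0.
have inS x : x != 0 -> x ^+ 2 \in S.
  by move=> nzx; rewrite mem_undup; apply/mapP; exists x; rewrite ?NE.
have uniqS c : c != 0 -> uniq [seq c * y | y <- S].
  by move=> nzc; rewrite map_inj_uniq ?undup_uniq //; apply: mulfI.
have disj c c' y y' : y \in S -> y' \in S -> c * y = c' * y' -> c' != 0 ->
    nonzero_square (c * c').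
  move=> /SE[x nzx ->] /SE[x' nzx' ->] eqy nzc'; exists (c' * x' / x).
    by rewrite !mulf_neq0 ?invr_eq0.
  have -> : c = c' * x' ^+ 2 / x ^+ 2 by rewrite -eqy mulfK ?expf_neq0.
  by field.
pose B := [seq 1 * y | y <- S] ++ [seq b * y | y <- S] ++ [seq m * y | y <- S].
have uniqB : uniq B.
  rewrite !cat_uniq !uniqS ?oner_neq0 // !has_cat !andbT /=; apply/andP; split.
    rewrite negb_or; apply/andP; split; apply/hasPn => _ /mapP[y Sy ->];
      apply/mapP => -[y' Sy' eqy].
      by apply: nsb; rewrite -[b]mulr1; apply: disj eqy _; rewrite ?oner_neq0.
    by apply: nsm; rewrite -[m]mulr1; apply: disj eqy _; rewrite ?oner_neq0.
  apply/hasPn => _ /mapP[y Sy ->]; apply/mapP => -[y' Sy' eqy].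
  by apply: nsbm; rewrite mulrC; apply: disj eqy _.
have leB : (size B <= size N)%N.
  apply: uniq_leq_size => // z; rewrite NE !mem_cat => /or3P[]/mapP[y /SN nzy ->];
  by rewrite mulf_neq0 ?oner_neq0.
pose root y := nth 0 s0 (find (fun x => x ^+ 2 == y) s0).
have rootP x : root (x ^+ 2) ^+ 2 = x ^+ 2.
  by apply/eqP/(@nth_find _ 0 (fun z => z ^+ 2 == x ^+ 2)); apply/hasP; exists x.
have leN : (size N <= size ([seq root y | y <- S] ++ [seq - root y | y <- S]))%N.
  apply: uniq_leq_size; first by rewrite filter_uniq ?undup_uniq.
  move=> x; rewrite NE mem_cat => nzx; have := rootP x.
  move=> /eqP; rewrite eqf_sqr => /orP[]/eqP rx; apply/orP; [left|right]; apply/mapP;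
    by exists (x ^+ 2); rewrite ?inS // rx ?opprK.
have S1 : (0 < size S)%N.
  have : 1 ^+ 2 \in S by rewrite inS ?oner_neq0.
  by case: (S) => [|y S'].
move: S1 leB leN; rewrite !size_cat !size_map.
by move: (size S) (size N) => ? ?; lia.
Qed.

Lemma infinite_nonroot (K : fieldType) (p : {poly K}) :
  infinite K -> p != 0 -> exists x, p.[x] != 0.
Proof.
move=> infK nzp; apply: NNPP => allroot.
have [s uniq_s size_s] : exists2 s : seq K, uniq s & size s = size p.
  elim: (size p) => [|n [s us ss]]; first by exists [::].
  by have [x nsx] := infK s; exists (x :: s); rewrite /= ?nsx ?ss.
have := max_poly_roots nzp _ uniq_s; rewrite size_s ltnn => H.
suff : all (root p) s by move=> /H.
apply/allP => x _; rewrite rootE; apply: contra_notT allroot.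
by move=> px; exists x.
Qed.

Lemma mpoly_nonroot (K : fieldType) n (p : {mpoly K[n]}) :
  infinite K -> p != 0 -> exists v, mev idfun v p != 0.
Proof.
move=> infK; elim: n p => [|n IHn] p nzp.
  exists (fun _ => 0); apply: contra nzp => /eqP p0; apply/eqP.
  exact: (indep0 p0).
have nzq : mpoly_last p != 0 by apply: contraNneq nzp => /mpoly_last_eq0->.
have [|v vq] := IHn (lead_coef (mpoly_last p)); first by rewrite lead_coef_eq0.
have [|x qx] := @infinite_nonroot K (map_poly (mev idfun v) (mpoly_last p)) infK.
  apply: contraNneq vq => q0; have /polyP/(_ (size (mpoly_last p)).-1) := q0.
  by rewrite coef_map coef0 -lead_coefE => ->.
pose v' i := if (i < n)%N then v i else x; exists v'.
have eqv : (mev idfun v' : {mpoly K[n]} -> K) =1 mev idfun v.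
  apply: (@mpoly_rmorph_ext _ _ _ (mev idfun v') (mev idfun v)) => [c|i] /=.
    by rewrite !mevC.
  by rewrite !mevX /v' ltn_ord.
rewrite /mev (mmap_mpoly_last idfun v') {2}/v' ltnn; apply: contra qx.
by move=> r0; rewrite -(eq_map_poly eqv).
Qed.

Section Line.
Variables (K : fieldType) (n : nat) (E : fieldType).
Variable e : {rmorphism {mpoly K[n]} -> E}.
Hypothesis e_inj : forall p, e p = 0 -> p = 0.
Variable q : nat -> K.

Let ptC : {rmorphism K -> {poly E}} := (polyC \o e) \o @mpolyC n K.
(** Coordinates of the line that passes through [q] at parameter 0 and through the generic point at
    parameter 1. *)
Let ptX (i : 'I_n) : {poly E} :=
  (e (q i)%:MP)%:P + 'X * (e ('X_i - (q i)%:MP))%:P.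
Let line : {rmorphism {mpoly K[n]} -> {poly E}} := mmap ptC ptX.

Lemma line0 p : (line p).[0] = e (mev idfun q p)%:MP.
Proof.
pose f1 : {rmorphism {mpoly K[n]} -> E} := horner_eval 0 \o line.
pose f2 : {rmorphism {mpoly K[n]} -> E} := (e \o @mpolyC n K) \o mev idfun q.
move: p; apply: (@mpoly_rmorph_ext _ _ _ f1 f2) => [c|i]; rewrite /f1 /f2 /= /horner_eval.
  by rewrite mevC mmapC /= hornerC.
by rewrite mevX mmapX mmap1U /ptX !hornerE.
Qed.

Lemma line1 p : (line p).[1] = e p.
Proof.
pose f1 : {rmorphism {mpoly K[n]} -> E} := horner_eval 1 \o line.
move: p; apply: (@mpoly_rmorph_ext _ _ _ f1 e) => [c|i]; rewrite /f1 /= /horner_eval.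
  by rewrite !mmapC /= hornerC.
by rewrite mmapX mmap1U /ptX !hornerE rmorphB; ring.
Qed.

(** Both conics restrict to the line, so the restriction of [T] is good for [-k] and its values at
    the parameters 0 and 1 agree up to a norm. *)
Lemma line_norm (b k d : K) (T D P Q U V : {mpoly K[n]}) :
    2%:R != 0 :> K -> b != 0 -> k != 0 -> d != 0 -> D != 0 -> mev idfun q T != 0 ->
    P ^+ 2 - T * Q ^+ 2 = b%:MP * (D ^+ 2) ^+ 2 ->
    U ^+ 2 - T * V ^+ 2 = k%:MP * (T - (b * d ^+ 2)%:MP * D ^+ 2) * D ^+ 2 ->
  nrm (- e k%:MP) (e ((mev idfun q T)%:MP * T)).
Proof.
move=> nz2 nzb nzk nzd nzD nzTq R1 R2.
have eC c : c != 0 -> e c%:MP != 0.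
  by apply: contraNneq => /e_inj/eqP; rewrite mpolyC_eq0.
have lC c : line c%:MP = (e c%:MP)%:P by rewrite [LHS]mmapC.
have nz2E : 2%:R != 0 :> E by rewrite -(rmorph_nat (e \o @mpolyC n K)) /= eC.
have nzT : T != 0 by apply: contraNneq nzTq => ->; rewrite rmorph0.
have good_T : good (- e k%:MP) (line T).
  apply: (@good_two_conics E (e b%:MP) (e k%:MP) (e d%:MP) _
            (line D) (line P) (line Q) (line U) (line V)); rewrite ?eC //.
  - apply: contraNneq nzD => lD; apply/eqP/e_inj.
    by rewrite -line1 lD horner0.
  - have := congr1 line R1; rewrite !(rmorphXn, rmorphB, rmorphM) /= lC.
    by [].
  - have -> : e b%:MP * e d%:MP ^+ 2 = (e \o @mpolyC n K) (b * d ^+ 2).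
      by rewrite rmorphM rmorphXn.
    move: R2; rewrite -lC /= -lC; set bd2 := (b * _)%:MP => R2.
    by have := congr1 line R2; rewrite !(rmorphXn, rmorphB, rmorphM) /=.
have := @good_nrm E (- e k%:MP) 0 1 (line T) nz2E _ good_T.
rewrite line0 line1 -rmorphM; apply; rewrite ?oppr_eq0 ?eC //.
by apply: contraNneq nzT => /e_inj->.
Qed.

End Line.

Lemma fracP (R : idomainType) (x : {fraction R}) :
  exists a b : R, b != 0 /\ x = (tofrac a) / (tofrac b).
Proof.
elim/quotW: x => x; exists (\n_x), (\d_x); rewrite denom_ratioP; split=> //.
apply: (canRL (mulfK _)); first by rewrite tofrac_eq0 denom_ratioP.
unlock FracField.tofrac; rewrite -[LHS]FracField.pi_mul.
apply/eqmodP/eqP; rewrite /FracField.mulf /=.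
by rewrite !numden_Ratio ?mulf_neq0 ?oner_neq0 ?denom_ratioP // !mulr1 mulrC.
Qed.

Lemma nrm_clear (R : comNzRingType) (E : fieldType) (e : {rmorphism R -> E}) (k y : R) :
    (forall x, exists a b, e b != 0 /\ x = e a / e b) -> nrm (- e k) (e y) ->
  exists G H W, e W != 0 /\ e (y * W ^+ 2) = e (G ^+ 2 + k * H ^+ 2).
Proof.
move=> fracE [x1 [x2]]; have [g [w [nzw ->]]] := fracE x1.
have [h [w' [nzw' ->]]] := fracE x2 => def_y.
exists (g * w'), (h * w), (w * w'); rewrite rmorphM mulf_neq0 //; split=> //.
by rewrite !(rmorphXn, rmorphD, rmorphM) /= def_y; field; rewrite nzw nzw'.
Qed.

(** The witness [c] is the value of [T] at a rational point where it does not vanish; such a point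
    exists because [K] is infinite. *)
Lemma frac_line_norm (K : fieldType) n (b k d : K) (T D P Q U V : {mpoly K[n]}) :
    infinite K -> 2%:R != 0 :> K -> b != 0 -> k != 0 -> d != 0 -> D != 0 -> T != 0 ->
    P ^+ 2 - T * Q ^+ 2 = b%:MP * (D ^+ 2) ^+ 2 ->
    U ^+ 2 - T * V ^+ 2 = k%:MP * (T - (b * d ^+ 2)%:MP * D ^+ 2) * D ^+ 2 ->
  exists2 c, c != 0 & exists G H W : {mpoly K[n]},
    W != 0 /\ c%:MP * T * W ^+ 2 = G ^+ 2 + k%:MP * H ^+ 2.
Proof.
move=> infK nz2 nzb nzk nzd nzD nzT R1 R2.
have [q nzTq] := mpoly_nonroot infK nzT; exists (mev idfun q T) => //.
pose e : {rmorphism {mpoly K[n]} -> {fraction {mpoly K[n]}}} := @tofrac _.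
have e_inj (p : {mpoly K[n]}) : e p = 0 -> p = 0.
  by move/eqP; rewrite tofrac_eq0 => /eqP.
have fracE x : exists a b, e b != 0 /\ x = e a / e b.
  by have [a1 [b1 [nzb1 ->]]] := fracP x; exists a1, b1; rewrite tofrac_eq0.
have := line_norm e_inj nz2 nzb nzk nzd nzD nzTq R1 R2.
move=> /(nrm_clear fracE)[G [H [W [nzW eqW]]]].
exists G, H, W; split; first by apply: contraNneq nzW => ->; rewrite rmorph0.
by apply/eqP; rewrite -subr_eq0; apply/eqP/e_inj; rewrite rmorphB; apply/eqP; rewrite subr_eq0; apply/eqP.
Qed.

(** * Norms from a function field with an involution *)

Section PolyLowest.
Variable N : fieldType.
Implicit Types p q : {poly N}.

Lemma poly_lowest p : p != 0 -> exists k p', p = 'X^k * p' /\ p'.[0] != 0.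
Proof.
elim: {p}_.+1 {-2}p (ltnSn (size p)) => // n IHn p lepn nzp.
have [p0|nzp0] := eqVneq p.[0] 0; last by exists 0%N, p; rewrite expr0 mul1r.
have [q def_p] : exists q : {poly N}, p = q * 'X.
  have /factor_theorem[q ->] : root p 0 by apply/rootP.
  by exists q; rewrite subr0.
have nzq : q != 0 by apply: contraNneq nzp => q0; rewrite def_p q0 mul0r.
have [|k [p' [def_q nzp']]] := IHn q _ nzq.
  by move: lepn; rewrite def_p size_mulX.
by exists k.+1, p'; split=> //; rewrite def_p def_q exprS; ring.
Qed.

Lemma poly_lowest_eq i j p q : p.[0] != 0 -> q.[0] != 0 ->
  'X^i * p = 'X^j * q -> i = j /\ p = q.
Proof.
wlog le_ij : i j p q / (i <= j)%N => [wlog_le p0 q0 eq_pq|p0 q0].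
  have [/wlog_le H|/ltnW/wlog_le H] := leqP i j; first exact: H.
  by have [-> ->] := H _ _ q0 p0 (esym eq_pq).
rewrite -(subnKC le_ij) exprD -mulrA => /mulfI def_p.
have {}def_p : p = 'X^(j - i) * q.
  by apply: def_p; rewrite -size_poly_eq0 size_polyXn.
case: (j - i)%N def_p => [|k] def_p; first by rewrite addn0 def_p expr0 mul1r.
by move: p0; rewrite def_p hornerM hornerXn expr0n mul0r eqxx.
Qed.

End PolyLowest.

Section NormStep.
Variables (N F : fieldType) (s : {rmorphism N -> N}) (j : {rmorphism N -> F}).
Variables (tau : {rmorphism F -> F}) (rho : F) (f : N).
Hypothesis sK : involutive s.
Hypothesis tau_j : forall a, tau (j a) = j (s a).
Hypothesis rho_trans : forall p : {poly N}, (map_poly j p).[rho] = 0 -> p = 0.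
Hypotheses (nzf : f != 0) (sf_f : s f = f) (tau_rho : tau rho = j f / rho).

Let nz_rho : rho != 0.
Proof.
apply/eqP => r0; have /eqP : ('X : {poly N}) = 0 by apply: rho_trans; rewrite map_polyX hornerX.
by rewrite polyX_eq0.
Qed.

(** Twisted reciprocal polynomial: as [tau rho = f / rho], its value at [rho] is [rho^d] times the
    image under [tau] of the value of [A]. *)
Let recip d (A : {poly N}) := \poly_(i < d.+1) (s A`_(d - i) * f ^+ (d - i)).

Let recipE d (A : {poly N}) : (size A <= d.+1)%N ->
  (map_poly j (recip d A)).[rho] = rho ^+ d * tau (map_poly j A).[rho].
Proof.
move=> szA.
rewrite (@horner_coef_wide _ d.+1 (map_poly j A)) ?size_map_poly // rmorph_sum mulr_sumr.
rewrite (@horner_coef_wide _ d.+1); last by rewrite size_map_poly size_poly.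
rewrite (reindex_inj rev_ord_inj); apply: eq_bigr => i _ /=.
have le_id : (i <= d)%N by rewrite -ltnS.
rewrite !coef_map coef_poly subSS ltnS leq_subr subKn //=.
rewrite !rmorphM !rmorphXn /= tau_j tau_rho expr_div_n.
have -> : rho ^+ d = rho ^+ (d - i) * rho ^+ i by rewrite -exprD subnK.
have := expf_neq0 i nz_rho; move: (rho ^+ i) => ri nz_ri.
by field.
Qed.

Let inj_rho (p q : {poly N}) : (map_poly j p).[rho] = (map_poly j q).[rho] -> p = q.
Proof.
move=> pq; apply/eqP; rewrite -subr_eq0; apply/eqP/rho_trans.
by rewrite rmorphB hornerD hornerN pq subrr.
Qed.

(** Multiplication by powers of [rho] turns the hypothesis into an identity of polynomials. As [A]
    is coprime to [B], it divides the reciprocal of [B]; equal degrees make the quotient a constant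
    [e]. Comparing extreme coefficients determines [c]. *)
Lemma norm_step_coprime (A B : {poly N}) (c : N) (a b : nat) :
    coprimep A B -> A.[0] != 0 -> B.[0] != 0 ->
    j f ^+ a * (map_poly j A).[rho] * tau (map_poly j A).[rho] =
    j c * j f ^+ b * (map_poly j B).[rho] * tau (map_poly j B).[rho] ->
  exists (n : N) (i : nat), n != 0 /\ c = n * s n * f ^+ i.
Proof.
move=> coAB A0 B0 eqAB.
have nzA : A != 0 by apply: contraNneq A0 => ->; rewrite horner0.
have nzB : B != 0 by apply: contraNneq B0 => ->; rewrite horner0.
pose dA := (size A).-1; pose dB := (size B).-1.
have szA : size A = dA.+1 by rewrite prednK ?size_poly_gt0.
have szB : size B = dB.+1 by rewrite prednK ?size_poly_gt0.
have rA0 : (recip dA A).[0] = s (lead_coef A) * f ^+ dA.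
  by rewrite horner_coef0 coef_poly subn0 /= lead_coefE szA.
have rB0 : (recip dB B).[0] = s (lead_coef B) * f ^+ dB.
  by rewrite horner_coef0 coef_poly subn0 /= lead_coefE szB.
have eq1 : 'X^dB * ((f ^+ a)%:P * A * recip dA A) = 'X^dA * ((c * f ^+ b)%:P * B * recip dB B).
  apply: inj_rho; rewrite -!hevE !(rmorphXn, rmorphM) !hevX !hevC !hevE.
  rewrite !recipE ?szA ?szB //.
  transitivity (rho ^+ dA * rho ^+ dB * (j f ^+ a * (map_poly j A).[rho] * tau (map_poly j A).[rho])).
    by ring.
  by rewrite eqAB; ring.
have nzc : c != 0.
  apply: contraTneq nzA => c0; move: eq1; rewrite c0 mul0r !mul0r mulr0 => /eqP.
  rewrite !mulf_eq0 expf_eq0 polyX_eq0 andbF /= polyC_eq0 expf_eq0 (negPf nzf) andbF /=.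
  case/orP=> [->//|/eqP r0]; move/eqP: rA0; rewrite r0 horner0 eq_sym mulf_eq0.
  by rewrite fmorph_eq0 lead_coef_eq0 expf_eq0 (negPf nzf) andbF orbF => ->.
(* No other factor vanishes at 0, so the powers of [X] must match; this gives equal degrees. *)
have [||eq_d eq2] := poly_lowest_eq _ _ eq1.
- rewrite !hornerM hornerC rA0 !mulf_neq0 ?expf_neq0 // fmorph_eq0 lead_coef_eq0 //.
- by rewrite !hornerM hornerC rB0 !mulf_neq0 ?expf_neq0 // fmorph_eq0 lead_coef_eq0.
have /dvdp_ex[q def_q] : A %| recip dB B.
  rewrite -(Gauss_dvdpr _ coAB) -(dvdpZr _ _ (mulf_neq0 nzc (expf_neq0 b nzf))).
  rewrite -mul_polyC mulrA -eq2 mulrAC; exact: dvdp_mull.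
have nzrB : recip dB B != 0.
  apply: contraNneq (expf_neq0 dB nzf) => r0; move/eqP: rB0; rewrite r0 horner0 eq_sym.
  by rewrite mulf_eq0 fmorph_eq0 lead_coef_eq0 (negPf nzB).
have nzq : q != 0 by apply: contraNneq nzrB => q0; rewrite def_q q0 mul0r.
have /size1_polyC def_e : (size q <= 1)%N.
  have : (size (recip dB B) <= dB.+1)%N by apply: size_poly.
  rewrite def_q size_mul // szA eq_d.
  by move: (size q) => ?; lia.
set e := q`_0 in def_e; have nze : e != 0 by rewrite def_e polyC_eq0 in nzq.
have eqB i : (i <= dB)%N -> s B`_(dB - i) * f ^+ (dB - i) = e * A`_i.
  move=> le_i; have := congr1 (fun p : {poly N} => p`_i) def_q.
  by rewrite coef_poly ltnS le_i def_e coefCM.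
have eqA : f ^+ a * s A`_0 = c * f ^+ b * e * B`_dB.
  have eq3 : (f ^+ a)%:P * recip dA A = (c * f ^+ b * e)%:P * B.
    apply: (mulfI nzA); rewrite mulrA [A * _]mulrC eq2 def_q def_e polyCM; ring.
  have := congr1 (fun p : {poly N} => p`_dB) eq3.
  by rewrite !coefCM coef_poly -eq_d ltnSn subnn expr0 mulr1.
have := eqB 0%N (leq0n _); rewrite subn0 => /(congr1 s).
rewrite !rmorphM rmorphXn sK sf_f => eq0.
have nzBd : B`_dB != 0 by rewrite -lead_coefE lead_coef_eq0.
(* Here [c = f^(a + dB - b) / (e s(e))]; the extra [f^b] in the witness keeps the exponent of [f]
   nonnegative. *)
exists (e * f ^+ b)^-1, (a + dB + b)%N; rewrite invr_eq0 mulf_neq0 ?expf_neq0 //; split=> //.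
have nzse : s e != 0 by rewrite fmorph_eq0.
have nzfb : f ^+ b != 0 by rewrite expf_neq0.
apply: (mulIf (mulf_neq0 (mulf_neq0 nze nzse) (mulf_neq0 nzfb nzBd))).
transitivity (s e * (c * f ^+ b * e * B`_dB)); first by ring.
rewrite -eqA mulrCA -eq0 fmorphV rmorphM rmorphXn sf_f !exprD.
by field; rewrite nze nzse nzfb.
Qed.

(** Powers of [rho] and common factors are split off first. Since [rho * tau rho = f], the former
    contribute only powers of [f], and even powers of [f] are absorbed into [n * s n]. *)
Lemma norm_step (A B : {poly N}) (c : N) :
    A != 0 -> B != 0 ->
    (map_poly j A).[rho] / (map_poly j B).[rho] *
      tau ((map_poly j A).[rho] / (map_poly j B).[rho]) = j c ->
  exists n, n != 0 /\ (c = n * s n \/ c = n * s n * f).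
Proof.
move=> nzA nzB eqc.
have [a [A1 [defA A10]]] := poly_lowest nzA; have [b [B1 [defB B10]]] := poly_lowest nzB.
pose g := gcdp A1 B1.
have nzA1 : A1 != 0 by apply: contraNneq A10 => ->; rewrite horner0.
have nzg : g != 0 by rewrite gcdp_eq0 (negPf nzA1).
have [A2 defA1] : exists A2 : {poly N}, A1 = A2 * g by apply/dvdp_ex/dvdp_gcdl.
have [B2 defB1] : exists B2 : {poly N}, B1 = B2 * g by apply/dvdp_ex/dvdp_gcdr.
have co2 : coprimep A2 B2.
  have <- : A1 %/ g = A2 by rewrite defA1 mulpK.
  have <- : B1 %/ g = B2 by rewrite defB1 mulpK.
  by apply: coprimep_div_gcd; rewrite nzA1.
move: A10 B10; rewrite defA1 defB1 !hornerM !mulf_eq0 !negb_or => /andP[A20 g0] /andP[B20 _].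
have nz (p : {poly N}) : p != 0 -> (map_poly j p).[rho] != 0.
  by move=> nzp; apply: contraNneq nzp => /rho_trans->.
have nzB2 : B2 != 0 by apply: contraNneq B20 => ->; rewrite horner0.
have [|n [i [nzn def_c]]] := norm_step_coprime (c := c) (a := a) (b := b) co2 A20 B20.
  have nzr1 := nz _ nzg; have nzr2 := nz _ nzB2.
  have nzt1 : tau (map_poly j g).[rho] != 0 by rewrite fmorph_eq0.
  have nzt2 : tau (map_poly j B2).[rho] != 0 by rewrite fmorph_eq0.
  rewrite -eqc defA defB defA1 defB1 -!hevE !(rmorphXn, rmorphM, fmorphV) !hevX !hevE.
  rewrite /= tau_rho !expr_div_n.
  have nzjf : j f != 0 by rewrite fmorph_eq0.
  field; rewrite nzr1 nzr2 nzt1 nzt2 !expf_neq0 //.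
exists (n * f ^+ (i./2)); split; first by rewrite mulf_neq0 ?expf_neq0.
have fi : f ^+ i = f ^+ odd i * (f ^+ i./2) ^+ 2.
  by rewrite -exprM -exprD muln2 odd_double_half.
rewrite rmorphM rmorphXn /= sf_f def_c fi.
by case: (odd i); [right|left]; rewrite ?expr1 ?expr0; ring.
Qed.

End NormStep.

Section Restriction.
Variables (F : fieldType) (L : F -> Prop) (HL : is_subfield L).
Variables (tau : {rmorphism F -> F}) (tauL : forall u, L u -> L (tau u)).

Lemma restrict_subproof (u : subf HL) : tau (val u) \in subf_pred HL.
Proof. by apply/decideP; apply: tauL; apply: subf_valP. Qed.

Definition restrict (u : subf HL) : subf HL := Subf (restrict_subproof u).

Lemma restrict_val u : val (restrict u) = tau (val u). Proof. by []. Qed.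

Lemma restrict_is_zmod_morphism : zmod_morphism restrict.
Proof. by move=> u v; apply: val_inj; rewrite restrict_val !rmorphB. Qed.

Lemma restrict_is_monoid_morphism : monoid_morphism restrict.
Proof.
by split=> [|u v]; apply: val_inj; rewrite restrict_val ?rmorph1 ?rmorphM.
Qed.

HB.instance Definition _ :=
  GRing.isZmodMorphism.Build _ _ restrict restrict_is_zmod_morphism.
HB.instance Definition _ :=
  GRing.isMonoidMorphism.Build _ _ restrict restrict_is_monoid_morphism.

(** The form of [norm_step] used inside [F]: a subfield stable under [tau] serves as coefficient
    field through its subtype. *)
Lemma norm_step_sub (rho f c G : F) :
    (forall u, L u -> tau (tau u) = u) -> ~ algc L rho ->
    L f -> f != 0 -> tau f = f -> tau rho = f / rho ->
    L c -> c != 0 -> G * tau G = c ->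
    (exists A B : {poly subf HL}, (map_poly val B).[rho] != 0 /\
       G = (map_poly val A).[rho] / (map_poly val B).[rho]) ->
  exists n, [/\ L n, n != 0 & c = n * tau n \/ c = n * tau n * f].
Proof.
move=> tauK ntr Lf nzf tau_f tau_rho Lc nzc GG [A [B [nzB defG]]].
have rho_trans (p : {poly subf HL}) : (map_poly val p).[rho] = 0 -> p = 0.
  move=> p0; apply/eqP; apply: contra_notT ntr => nzp.
  by apply/(algc_over HL); exists p => //; apply/rootP.
have [f' def_f] := subf_ex HL Lf; have [c' def_c] := subf_ex HL Lc.
have nzG : G != 0 by apply: contraNneq nzc => G0; rewrite -GG G0 mul0r.
have sK : involutive restrict.
  by move=> u; apply: val_inj; rewrite !restrict_val tauK //; apply: subf_valP.
have nzf' : f' != 0.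
  by apply: contraNneq nzf => f0; rewrite -def_f f0 rmorph0.
have sf' : restrict f' = f' by apply: val_inj; rewrite restrict_val def_f.
have nzA : A != 0.
  by apply: contraNneq nzG => A0; rewrite defG A0 rmorph0 horner0 mul0r.
have nzB' : B != 0.
  by apply: contraNneq nzB => B0; rewrite B0 rmorph0 horner0.
have [|||n [nzn Hn]] := @norm_step _ F restrict val tau rho f' sK _ rho_trans nzf' sf' _ A B c' nzA nzB'.
- by [].
- exact: etrans tau_rho (congr1 (fun z => z / rho) (esym def_f)).
- by move: GG; rewrite defG -def_c.
exists (val n); split; first exact: subf_valP.
  by rewrite fmorph_eq0.
by case: Hn => /(congr1 val) Hn; [left|right]; rewrite -def_c -?def_f;
  apply: etrans Hn _; rewrite !rmorphM.
Qed.

End Restriction.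

(** * A criterion for non-rationality *)

Section AdjoinFinite.
Variables (K F : fieldType) (iota : {rmorphism K -> F}) (S : F -> Prop).

Definition finitely_adjoined u := exists2 s : seq F, (forall v, v \in s -> S v) & gen iota s u.

Lemma gen_cat_l (s s' : seq F) u : gen iota s u -> gen iota (s ++ s') u.
Proof. by apply: gen_sub => v sv; apply: gen_mem; rewrite mem_cat sv. Qed.

Lemma gen_cat_r (s s' : seq F) u : gen iota s u -> gen iota (s' ++ s) u.
Proof. by apply: gen_sub => v sv; apply: gen_mem; rewrite mem_cat sv orbT. Qed.

(** A transcendence basis given as a predicate may be infinite. The finitely adjoined elements form
    a subfield containing [K] and [S], so the definition of [adjoin] applies to them. *)
Lemma adjoin_finite u : adjoin iota S u -> finitely_adjoined u.
Proof.
apply.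
- split=> [|u1 u2|u1 u2|u1].
  + by exists [::] => //; apply: sf1; apply: gen_sf.
  + move=> [s1 S1 g1] [s2 S2 g2]; exists (s1 ++ s2).
      by move=> v; rewrite mem_cat => /orP[/S1|/S2].
    by apply: (sfB (gen_sf iota _)); [apply: gen_cat_l | apply: gen_cat_r].
  + move=> [s1 S1 g1] [s2 S2 g2]; exists (s1 ++ s2).
      by move=> v; rewrite mem_cat => /orP[/S1|/S2].
    by apply: (sfM (gen_sf iota _)); [apply: gen_cat_l | apply: gen_cat_r].
  + by move=> [s1 S1 g1]; exists s1 => //; apply: (sfV (gen_sf iota _)).
- by move=> k; exists [::] => //; apply: gen_const.
- by move=> v Sv; exists [:: v]; [move=> w; rewrite inE => /eqP-> | apply: gen_mem; rewrite inE].
Qed.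

Lemma adjoin_finite_all (us : seq F) : (forall u, u \in us -> adjoin iota S u) ->
  exists s : seq F, [/\ uniq s, forall v, v \in s -> S v & forall u, u \in us -> gen iota s u].
Proof.
move=> adj.
suff [s Ss gs] : exists2 s : seq F, (forall v, v \in s -> S v) &
    forall u, u \in us -> gen iota s u.
  exists (undup s); rewrite undup_uniq; split=> // [v|u]; first by rewrite mem_undup => /Ss.
  by move=> /gs; apply: gen_sub => v sv; apply: gen_mem; rewrite mem_undup.
elim: us adj => [_|u us IHus adj]; first by exists [::].
have [|s Ss gs] := IHus; first by move=> v us_v; apply: adj; rewrite inE us_v orbT.
have [s' Ss' gs'] := adjoin_finite (adj u (mem_head _ _)).
exists (s' ++ s); first by move=> v; rewrite mem_cat => /orP[/Ss'|/Ss].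
move=> v; rewrite inE => /predU1P[->|/gs]; [exact: gen_cat_l | exact: gen_cat_r].
Qed.

Lemma alg_independent_indep (s : seq F) : alg_independent iota S -> uniq s ->
  (forall v, v \in s -> S v) -> indep iota (size s) (nth 0 s).
Proof.
move=> indS us Ss p p0; apply: (indS _ (fun i : 'I_(size s) => nth 0 s i)) p0.
  by move=> i j /eqP; rewrite nth_uniq // => /eqP/val_inj.
by move=> i; apply/Ss/mem_nth.
Qed.

Lemma gen_frac (s : seq F) u : gen iota s u -> exists p q : {mpoly K[size s]},
  mev iota (nth 0 s) q != 0 /\ u = mev iota (nth 0 s) p / mev iota (nth 0 s) q.
Proof. by move=> gu; apply: genv_frac; apply/genv_nth => //; rewrite take_size. Qed.

End AdjoinFinite.

(** Cleared of denominators, the relation is a polynomial identity, which can be evaluated at a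
    point of [K] where the denominators do not vanish. *)
Lemma infinite_specialize_norm (K F : fieldType) (iota : {rmorphism K -> F}) (s : seq F)
    (c k : K) (g h : F) :
    infinite K -> indep iota (size s) (nth 0 s) -> gen iota s g -> gen iota s h ->
    iota c = g ^+ 2 + iota k * h ^+ 2 ->
  exists g0 h0, c = g0 ^+ 2 + k * h0 ^+ 2.
Proof.
move=> infK ind /gen_frac[a [q [nzq ->]]] /gen_frac[a' [q' [nzq' ->]]] eq_c.
have nzqq : q * q' != 0.
  by apply: contraTneq (mulf_neq0 nzq nzq') => qq; rewrite -rmorphM qq rmorph0 eqxx.
have [v nzv] := mpoly_nonroot infK nzqq.
have eqp : c%:MP * (q * q') ^+ 2 - ((a * q') ^+ 2 + k%:MP * (a' * q) ^+ 2) = 0.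
  apply: ind; rewrite !(rmorphXn, rmorphB, rmorphD, rmorphM) /= !mevC eq_c.
  by field; rewrite nzq nzq'.
have := congr1 (mev idfun v) eqp.
rewrite [RHS]rmorph0 !(rmorphXn, rmorphB, rmorphD, rmorphM) /= !mevC /=.
move: nzv; rewrite rmorphM mulf_eq0 negb_or => /andP[nz1 nz2] /eqP; rewrite subr_eq0 => /eqP eqv.
exists (mev idfun v a / mev idfun v q), (mev idfun v a' / mev idfun v q').
apply: (mulIf (expf_neq0 2 (mulf_neq0 nz1 nz2))); rewrite eqv.
by field; rewrite nz1 nz2.
Qed.

Section NonRational.
Variables (K F : fieldType) (iota : {rmorphism K -> F}).
Variables (tau : {rmorphism F -> F}) (x1 x2 x3 : F) (b k d : K).
Hypotheses (nz2 : 2%:R != 0 :> K) (nzb : b != 0) (nzk : k != 0) (nzd : d != 0).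
Hypothesis trx : trdeg3 iota x1 x2 x3.
Hypothesis tauC : forall c, tau (iota c) = iota c.
Hypothesis tau1 : tau x1 = - x1.
Hypothesis tau2 : tau x2 = iota b / x2.
Let h := iota k * (x1 ^+ 2 - iota (b * d ^+ 2)).
Hypothesis tau3 : tau x3 = h / x3.

Let M := gen iota [:: x1; x2; x3].
Let HM : is_subfield M. Proof. exact: gen_sf. Qed.
Let Mx1 : M x1. Proof. by apply: gen_mem; rewrite !inE eqxx. Qed.
Let Mx2 : M x2. Proof. by apply: gen_mem; rewrite !inE eqxx orbT. Qed.
Let Mx3 : M x3. Proof. by apply: gen_mem; rewrite !inE eqxx !orbT. Qed.

Let nz2F : 2%:R != 0 :> F.
Proof. by rewrite -(rmorph_nat iota) fmorph_eq0. Qed.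

Let ntr1 : ~ cls iota [::] x1. Proof. by case/trdeg3P: trx. Qed.
Let ntr2 : ~ cls iota [:: x1] x2. Proof. by case/trdeg3P: trx. Qed.
Let ntr3 : ~ cls iota [:: x2; x1] x3.
Proof.
case/trdeg3P: trx => _ _; apply: contra_not; apply: cls_sub => v.
by rewrite !inE => /orP[]/eqP->; apply: cls_mem; rewrite !inE eqxx ?orbT.
Qed.

Let nzx (s : seq F) x : ~ cls iota s x -> x != 0.
Proof. by apply: contra_notN => /eqP->; apply: sf0; apply: cls_sf. Qed.
Let nzx1 : x1 != 0 := nzx ntr1.
Let nzx2 : x2 != 0 := nzx ntr2.
Let nzx3 : x3 != 0 := nzx ntr3.

Let map_trans (p : {poly K}) : (map_poly iota p).[x1] = 0 -> p = 0.
Proof.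
move=> p0; apply/eqP; apply: contra_notT ntr1 => nzp; exists (map_poly iota p).
  by rewrite map_poly_eq0.
by split=> [i|]; [rewrite coef_map; apply: gen_const | apply/rootP].
Qed.

Let nzh : h != 0.
Proof.
rewrite mulf_neq0 ?fmorph_eq0 //.
have -> : x1 ^+ 2 - iota (b * d ^+ 2) = (map_poly iota ('X^2 - (b * d ^+ 2)%:P)).[x1].
  by rewrite -hevE rmorphB rmorphXn hevC hevX.
apply/eqP => /map_trans/eqP; apply/negP; apply: monic_neq0; exact: monicXnsubC.
Qed.

Let tau_h : tau h = h.
Proof. by rewrite /h !(rmorphXn, rmorphB, rmorphM) /= !tauC tau1 sqrrN. Qed.

(** On [K(x1)] the map [tau] is [x1 -> -x1], so with [n = A / B] the equation is one between
    polynomials. Lowest coefficients settle [j = 0]. For [j = 1] and [c = -k] they show that [b] is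
    a square if [i = 0], because [h] has constant term [-k b d^2]; if [i = 1], leading coefficients
    show it. *)
Lemma gen1_norm (c : K) n (i j : bool) : gen iota [:: x1] n -> n != 0 ->
    iota c = n * tau n * iota b ^+ i * h ^+ j -> c != 0 ->
  if j then nonzero_square b \/ c != - k
  else nonzero_square c \/ nonzero_square (b * c).
Proof.
move=> gn nzn eq_n nzc.
pose e := hev iota x1.
have [A [B [nzB def_n]]] : exists A B : {poly K}, e B != 0 /\ n = e A / e B.
  apply: (gn _ (frac_sf e)) => [c0|v]; rewrite ?inE => *; apply: frac_sf_mem.
    by exists c0%:P; rewrite /e hevC.
  by exists 'X; rewrite /e hevX; apply/eqP.
have e_inj p q : e p = e q -> p = q.
  by move=> pq; apply/eqP; rewrite -subr_eq0; apply/eqP/map_trans; rewrite -hevE rmorphB pq subrr.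
pose bar (p : {poly K}) := p \Po (- 'X).
have e_bar p : e (bar p) = tau (e p).
  rewrite /e /bar !hevE map_comp_poly horner_comp rmorphN /= map_polyX hornerN hornerX.
  rewrite -tau1 -horner_map /= -map_poly_comp; congr _.[_]; apply: eq_map_poly => u /=.
  by rewrite tauC.
have nzA : e A != 0.
  by apply: contraNneq nzn => A0; rewrite def_n A0 mul0r.
have [nzA' nzB'] : A != 0 /\ B != 0.
  by split; [apply: contraNneq nzA | apply: contraNneq nzB] => ->; rewrite rmorph0.
have [H [eH H0 lH szH]] : exists H : {poly K},
    [/\ e H = h, H.[0] = - (k * b * d ^+ 2), lead_coef H = k & size H = 3%N].
  exists (k%:P * ('X^2 - (b * d ^+ 2)%:P)); split.
  - by rewrite /e rmorphM rmorphB rmorphXn !hevC hevX.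
  - by rewrite !hornerE expr0n /=; ring.
  - by rewrite lead_coefM lead_coefC (monicP (monicXnsubC _ _)) ?mulr1.
  - by rewrite mul_polyC size_scale // size_XnsubC.
have eqP1 : c%:P * (B * bar B) = A * bar A * (b ^+ i)%:P * H ^+ j.
  apply: e_inj; rewrite !(rmorphXn, rmorphM) eH !e_bar /e !hevC eq_n def_n -/e.
  rewrite fmorph_div; have nzt : tau (e B) != 0 by rewrite fmorph_eq0.
  by field; rewrite nzB nzt.
have barM p q : bar (p * q) = bar p * bar q by rewrite /bar comp_polyM.
have barXn m : bar ('X^m) = ((-1) ^+ m)%:P * 'X^m.
  by rewrite /bar comp_Xn_poly [LHS]exprNn polyC_exp polyCN.
have bar0 p : (bar p).[0] = p.[0] by rewrite /bar horner_comp !hornerE oppr0.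
have [u [A1 [defA A10]]] := poly_lowest nzA'; have [v [B1 [defB B10]]] := poly_lowest nzB'.
have nzH0 : H.[0] != 0 by rewrite H0 oppr_eq0 !mulf_neq0 ?expf_neq0.
have eqP2 : 'X^(v + v) * (((-1) ^+ v * c)%:P * (B1 * bar B1)) =
    'X^(u + u) * (((-1) ^+ u * b ^+ i)%:P * (A1 * bar A1) * H ^+ j).
  rewrite !exprD !polyCM; transitivity (c%:P * (B * bar B)).
    by rewrite defB barM barXn; ring.
  by rewrite eqP1 defA barM barXn; ring.
have nzs m : (-1) ^+ m != 0 :> K by rewrite expf_neq0 // oppr_eq0 oner_neq0.
have [||eq_vu eqP3] := poly_lowest_eq _ _ eqP2.
- by rewrite !hornerM hornerC bar0 !mulf_neq0 ?nzs.
- by rewrite !hornerM hornerC horner_exp bar0 !mulf_neq0 ?nzs ?expf_neq0.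
have {}eq_vu : u = v by apply: double_inj; rewrite -!addnn eq_vu.
have eq0 : c * B1.[0] ^+ 2 = b ^+ i * A1.[0] ^+ 2 * H.[0] ^+ j.
  apply: (mulfI (nzs v)); have := congr1 (fun p => p.[0]) eqP3.
  rewrite !hornerM !hornerC horner_exp !bar0 eq_vu => E0.
  by transitivity ((-1) ^+ v * c * (B1.[0] * B1.[0])); [ring | rewrite E0; ring].
have nzr : A1.[0] / B1.[0] != 0 by rewrite mulf_neq0 ?invr_eq0.
case: j eq_n eqP1 eqP2 eqP3 eq0 => eq_n eqP1 eqP2 eqP3 eq0; last first.
  have def_c : c = b ^+ i * (A1.[0] / B1.[0]) ^+ 2.
    apply: (mulIf (expf_neq0 2 B10)); rewrite eq0 expr0; field; exact: B10.
  case: i {eq_n eqP1 eqP2 eqP3 eq0} def_c => def_c.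
    right; exists (b * (A1.[0] / B1.[0])); first by rewrite mulf_neq0.
    by rewrite def_c expr1; ring.
  by left; exists (A1.[0] / B1.[0]); rewrite // def_c expr0 mul1r.
case: (eqVneq c (- k)) => [def_c|]; [left | by right].
case: i {eq_n eqP2 eqP3} eqP1 eq0 => eqP1 eq0; last first.
  exists (B1.[0] / (d * A1.[0])); first by rewrite mulf_neq0 ?invr_eq0 ?mulf_neq0.
  apply: (mulfI nzk); apply: (mulIf (expf_neq0 2 (mulf_neq0 nzd A10))).
  move: eq0; rewrite def_c H0 expr0 expr1 mul1r => eq0.
  transitivity (- (- k * B1.[0] ^+ 2)); first by rewrite eq0; ring.
  by field; rewrite nzd A10.
have lead_bar p : lead_coef (bar p) = (-1) ^+ (size p).-1 * lead_coef p.
  rewrite /bar lead_coef_comp ?size_polyN ?size_polyX // lead_coefN lead_coefX mulrC.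
  by [].
have sz_bar p : size (bar p) = size p by rewrite /bar size_comp_poly2 ?size_polyN ?size_polyX.
have nzbar p : p != 0 -> bar p != 0 by rewrite -!size_poly_eq0 sz_bar.
(* [H] has degree 2, so the degrees of [B] and [A] differ by one; the resulting sign cancels that of
   [c = -k]. *)
have szAB : (size B).-1 = (size A).-1.+1.
  have := congr1 (fun p : {poly K} => size p) eqP1.
  rewrite expr1 mul_polyC size_scale // size_mul ?nzbar // sz_bar.
  rewrite [A * _ * _]mulrC mul_polyC -scalerAl size_scale ?expf_neq0 //.
  have nzH : H != 0 by rewrite -size_poly_eq0 szH.
  rewrite size_mul ?mulf_neq0 ?nzbar // size_mul ?nzbar // sz_bar szH.
  have := size_poly_gt0 A; have := size_poly_gt0 B; rewrite nzA' nzB'.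
  by move: (size A) (size B) => ? ?; clear; lia.
have := congr1 lead_coef eqP1.
rewrite !lead_coefM !lead_bar !lead_coefC expr1 lH szAB exprS def_c => eql.
have nzlA : lead_coef A != 0 by rewrite lead_coef_eq0.
have nzlB : lead_coef B != 0 by rewrite lead_coef_eq0.
exists (lead_coef B / lead_coef A); first by rewrite mulf_neq0 ?invr_eq0.
apply: (mulfI nzk); apply: (mulIf (expf_neq0 2 nzlA)); apply: (mulfI (nzs (size A).-1)).
transitivity (lead_coef A * ((-1) ^+ (size A).-1 * lead_coef A) * b * k); first by ring.
rewrite -eql; field; exact: nzlA.
Qed.

Let tauK u : M u -> tau (tau u) = u.
Proof.
move=> Mu; apply: (Mu (fun u => tau (tau u) = u)) => [|c|v].
- split=> [|u1 u2 e1 e2|u1 u2 e1 e2|u1 e1]; first by rewrite !rmorph1.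
  + by rewrite !rmorphB e1 e2.
  + by rewrite !rmorphM e1 e2.
  + by rewrite !fmorphV e1.
- by rewrite !tauC.
- rewrite !inE => /or3P[]/eqP->.
  + by rewrite tau1 rmorphN tau1 opprK.
  + rewrite tau2 fmorph_div tauC tau2.
    by have := nzb; rewrite -(fmorph_eq0 iota) => nzbF; field; rewrite nzx2 nzbF.
  + by rewrite tau3 fmorph_div tau_h tau3; field; rewrite nzx3 nzh.
Qed.

Let gen_tau (s : seq F) : (forall v, v \in s -> gen iota s (tau v)) ->
  forall u, gen iota s u -> gen iota s (tau u).
Proof.
have HG := gen_sf iota s; move=> Hs u gu.
apply: (gu (fun u => gen iota s (tau u))) => [|c|//]; last by rewrite tauC; apply: gen_const.
split=> [|u1 u2 g1 g2|u1 u2 g1 g2|u1 g1]; rewrite ?rmorph1 ?rmorphB ?rmorphM ?fmorphV.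
- exact: (sf1 HG).
- exact: (sfB HG).
- exact: (sfM HG).
- exact: (sfV HG).
Qed.

Let gen1_tau u : gen iota [:: x1] u -> gen iota [:: x1] (tau u).
Proof.
apply: gen_tau => v; rewrite inE => /eqP->; rewrite tau1.
by apply: (sfN (gen_sf _ _)); apply: gen_mem; rewrite inE.
Qed.

Let gen2_tau u : gen iota [:: x2; x1] u -> gen iota [:: x2; x1] (tau u).
Proof.
have HG := gen_sf iota [:: x2; x1].
apply: gen_tau => v; rewrite !inE => /orP[]/eqP->; rewrite ?tau1 ?tau2.
  by apply: (sf_div HG); [apply: gen_const | apply: gen_mem; rewrite inE eqxx].
by apply: (sfN HG); apply: gen_mem; rewrite !inE eqxx orbT.
Qed.

Let gen_h s : x1 \in s -> gen iota s h.
Proof.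
move=> sx1; have HG := gen_sf iota s; apply: (sfM HG); first exact: gen_const.
by apply: (sfB HG); [apply: (sfX HG); apply: gen_mem | apply: gen_const].
Qed.

(** [norm_step_sub] eliminates [x3] at the cost of a possible factor [h], then [x2] at the cost of a
    possible factor [b]; [gen1_norm] handles what remains in [K(x1)]. *)
Lemma norm_square_classes G : M G -> G * tau G = iota (- k) ->
  [\/ nonzero_square b, nonzero_square (- k) | nonzero_square (b * - k)].
Proof.
move=> MG GG.
have nzkF : - k != 0 by rewrite oppr_eq0.
have sub1 u : gen iota [:: x1] u -> M u.
  by apply: gen_sub => v; rewrite inE => /eqP->.
have sub2 u : gen iota [:: x2; x1] u -> M u.
  by apply: gen_sub => v; rewrite !inE => /orP[]/eqP->.
have [n [gn nzn Hn]] : exists n, [/\ gen iota [:: x2; x1] n, n != 0 &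
    iota (- k) = n * tau n \/ iota (- k) = n * tau n * h].
  apply: (norm_step_sub (HL := gen_sf iota [:: x2; x1]) gen2_tau (rho := x3) (G := G)) => //.
  - by move=> u /sub2; apply: tauK.
  - by apply: gen_h; rewrite !inE eqxx orbT.
  - by rewrite fmorph_eq0.
  apply: gen_cons_frac; apply: gen_sub MG => v.
  by rewrite !inE => /or3P[]/eqP->; apply: gen_mem; rewrite !inE eqxx ?orbT.
have [j def_k] : exists j : bool, iota (- k) = n * tau n * h ^+ j.
  by case: Hn => Hn; [exists false; rewrite mulr1 | exists true].
have HG1 := gen_sf iota [:: x1].
have nzhj : h ^+ j != 0 by rewrite expf_neq0.
have [m [gm nzm Hm]] : exists m, [/\ gen iota [:: x1] m, m != 0 &
    iota (- k) / h ^+ j = m * tau m \/ iota (- k) / h ^+ j = m * tau m * iota b].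
  apply: (norm_step_sub (HL := gen_sf iota [:: x1]) gen1_tau (rho := x2) (G := n)) => //.
  - by move=> u /sub1; apply: tauK.
  - by rewrite fmorph_eq0.
  - by apply: (sf_div HG1); [apply: gen_const | apply: (sfX HG1); apply: gen_h; rewrite inE].
  - by rewrite mulf_neq0 ?invr_eq0 // fmorph_eq0.
  - by rewrite def_k mulfK.
  exact: gen_cons_frac.
have [i def_k2] : exists i : bool, iota (- k) = m * tau m * iota b ^+ i * h ^+ j.
  case: Hm => Hm; [exists false | exists true];
  by rewrite ?expr0 ?expr1 ?mulr1 -Hm divfK.
have := gen1_norm gm nzm def_k2 nzkF; case: ifP => _ [].
- by constructor 1.
- by rewrite eqxx.
- by constructor 2.
- by constructor 3.
Qed.

Theorem purely_transcendental_nonsquare (L : F -> Prop) :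
    (forall u, L u <-> M u /\ tau u = u) -> purely_transcendental iota L ->
  [\/ nonzero_square b, nonzero_square (- k) | nonzero_square (b * - k)].
Proof.
move=> defL [S indS LS]; apply: NNPP => none.
have infK : infinite K.
  apply: (@three_nonsquares_infinite K b (- k)); rewrite ?oppr_eq0 //.
  - by apply: contra_not none; constructor 1.
  - by apply: contra_not none; constructor 2.
  - by apply: contra_not none; constructor 3.
have MC c : M (iota c) by apply: gen_const.
have M2 : M 2%:R by rewrite -(rmorph_nat iota).
have Mh : M h by apply: gen_h; rewrite !inE eqxx.
have nzbF : iota b != 0 by rewrite fmorph_eq0.
have tauV2 : tau (iota b / x2) = x2.
  by rewrite fmorph_div tauC tau2; field; rewrite nzx2 nzbF.
have tauV3 : tau (h / x3) = x3.
  by rewrite fmorph_div tau_h tau3; field; rewrite nzx3 nzh.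
(* [x2 = P0 + Q0 x1] and [x3 = U0 + V0 x1] with invariant coordinates; the values of [tau] at [x2]
   and [x3] become two conics over [t]. *)
pose t := x1 ^+ 2; pose P0 := (x2 + iota b / x2) / 2%:R.
pose Q0 := (x2 - iota b / x2) / (2%:R * x1).
pose U0 := (x3 + h / x3) / 2%:R; pose V0 := (x3 - h / x3) / (2%:R * x1).
have Mdiv := sf_div HM; have MD := sfD HM; have MB := sfB HM; have MM := sfM HM.
have tau2n : tau 2%:R = 2%:R by rewrite rmorph_nat.
have [s [us Ss gs]] : exists s : seq F, [/\ uniq s, forall v, v \in s -> S v &
    forall u, u \in [:: t; P0; Q0; U0; V0] -> gen iota s u].
  apply: adjoin_finite_all => u; rewrite !inE => Hu; apply/LS/defL; move: Hu.
  case/or4P=> [/eqP->|/eqP->|/eqP->|/orP[]/eqP->].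
  - by split; [apply: (sfX HM) | rewrite /t rmorphXn tau1 sqrrN].
  - split; first by apply: (Mdiv) => //; apply: (MD) => //; apply: (Mdiv).
    by rewrite /P0 fmorph_div rmorphD tauV2 tau2 tau2n addrC.
  - split; first by apply: (Mdiv); [apply: (MB) => //; apply: (Mdiv) | apply: (MM)].
    rewrite /Q0 fmorph_div rmorphB rmorphM tauV2 tau2 tau1 tau2n.
    by field; rewrite ?oppr_eq0 ?nzx2 ?nzx1 ?nz2F.
  - split; first by apply: (Mdiv) => //; apply: (MD) => //; apply: (Mdiv).
    by rewrite /U0 fmorph_div rmorphD tauV3 tau3 tau2n addrC.
  - split; first by apply: (Mdiv); [apply: (MB) => //; apply: (Mdiv) | apply: (MM)].
    rewrite /V0 fmorph_div rmorphB rmorphM tauV3 tau3 tau1 tau2n.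
    by field; rewrite ?oppr_eq0 ?nzx3 ?nzx1 ?nz2F.
have ind_s := alg_independent_indep indS us Ss.
pose e : {rmorphism {mpoly K[size s]} -> F} := mev iota (nth 0 s).
have e_inj p q : e p = e q -> p = q.
  by move=> pq; apply/eqP; rewrite -subr_eq0; apply/eqP/ind_s; rewrite -/(e _) rmorphB pq subrr.
have eC c : e c%:MP = iota c by rewrite /e /= mevC.
have [a1 [b1 [nz1 def_t]]] := gen_frac (gs t (mem_head _ _)).
have [a2 [b2 [nz2' def_P]]] : exists p q, e q != 0 /\ P0 = e p / e q.
  by apply: gen_frac; apply: gs; rewrite !inE eqxx orbT.
have [a3 [b3 [nz3 def_Q]]] : exists p q, e q != 0 /\ Q0 = e p / e q.
  by apply: gen_frac; apply: gs; rewrite !inE eqxx !orbT.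
have [a4 [b4 [nz4 def_U]]] : exists p q, e q != 0 /\ U0 = e p / e q.
  by apply: gen_frac; apply: gs; rewrite !inE eqxx !orbT.
have [a5 [b5 [nz5 def_V]]] : exists p q, e q != 0 /\ V0 = e p / e q.
  by apply: gen_frac; apply: gs; rewrite !inE eqxx !orbT.
rewrite -/(e _) in nz1; rewrite -/(e _) -/(e b1) in def_t.
(* A common denominator; [T], [P], [Q], [U], [V] are scaled by the powers of it that keep both
   conics polynomial. *)
pose D := b1 * b2 * b3 * b4 * b5.
have eD : e D = e b1 * e b2 * e b3 * e b4 * e b5 by rewrite /D !rmorphM.
have nzeD : e D != 0 by rewrite eD !mulf_neq0.
pose T := a1 * b1 * (b2 * b3 * b4 * b5) ^+ 2.
have eT : e T = t * e D ^+ 2.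
  rewrite eD def_t /T !(rmorphXn, rmorphM).
  by field.
pose P := a2 * (b1 * b3 * b4 * b5) * D.
have eP : e P = P0 * e D ^+ 2.
  by rewrite /P rmorphM !expr2 mulrA; congr (_ * _); rewrite eD def_P !rmorphM; field.
pose Q := a3 * (b1 * b2 * b4 * b5).
have eQ : e Q = Q0 * e D by rewrite /Q eD def_Q !rmorphM; field.
pose U := a4 * (b1 * b2 * b3 * b5) * D.
have eU : e U = U0 * e D ^+ 2.
  by rewrite /U rmorphM !expr2 mulrA; congr (_ * _); rewrite eD def_U !rmorphM; field.
pose V := a5 * (b1 * b2 * b3 * b4).
have eV : e V = V0 * e D by rewrite /V eD def_V !rmorphM; field.
move: D T P Q U V eT eP eQ eU eV nzeD {eD} => D T P Q U V eT eP eQ eU eV nzeD.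
have nzt : t != 0 by rewrite expf_neq0.
have R1 : P ^+ 2 - T * Q ^+ 2 = b%:MP * (D ^+ 2) ^+ 2.
  apply: e_inj; rewrite !(rmorphXn, rmorphB, rmorphM) eC eP eQ eT.
  have : P0 ^+ 2 - t * Q0 ^+ 2 = iota b.
    by rewrite /P0 /Q0 /t; field; rewrite ?nzx1 ?nzx2 ?nz2F.
  by move=> <-; ring.
have R2 : U ^+ 2 - T * V ^+ 2 = k%:MP * (T - (b * d ^+ 2)%:MP * D ^+ 2) * D ^+ 2.
  have R0 : U0 ^+ 2 - t * V0 ^+ 2 = iota k * (t - iota (b * d ^+ 2)).
    rewrite -[RHS]/h /U0 /V0; move: (h) => h'.
    by rewrite /t; field; rewrite ?nzx1 ?nzx3 ?nz2F.
  apply: e_inj; move: R0; rewrite -(eC (b * d ^+ 2)); move: ((b * d ^+ 2)%:MP) => bd R0.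
  rewrite !(rmorphXn, rmorphB, rmorphM) eC eU eV eT.
  transitivity ((U0 ^+ 2 - t * V0 ^+ 2) * e D ^+ 4); first by ring.
  by rewrite R0; ring.
have nzD : D != 0 by apply: contraNneq nzeD => ->; rewrite rmorph0.
have nzT : T != 0.
  have : e T != 0 by rewrite eT mulf_neq0 ?expf_neq0.
  by apply: contraNneq => ->; rewrite rmorph0.
have [c nzc [G [H [W [nzW eqW]]]]] := frac_line_norm infK nz2 nzb nzk nzd nzD nzT R1 R2.
have nzeW : e W != 0.
  by apply: contraNneq nzW => eW; apply/eqP/e_inj; rewrite eW rmorph0.
have eq_t : iota c * t = (e G / (e D * e W)) ^+ 2 + iota k * (e H / (e D * e W)) ^+ 2.
  apply: (mulIf (expf_neq0 2 (mulf_neq0 nzeD nzeW))).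
  have := congr1 e eqW; rewrite !(rmorphXn, rmorphD, rmorphM) !eC eT => eqW'.
  transitivity (iota c * (t * e D ^+ 2) * e W ^+ 2); first by ring.
  by rewrite eqW'; field; rewrite nzeD nzeW.
have HS := adjoin_sf iota S.
have Le p : adjoin iota S (e p).
  have := (@genv_nth K F iota s (size s) (e p) (leqnn _)).1 (@mev_genv K F iota _ (nth 0 s) p).
  rewrite take_size.
  by apply: adjoin_sub => v /Ss; apply: adjoin_mem.
move: (e G / _) (e H / _) eq_t (sf_div HS (Le G) (sfM HS (Le D) (Le W)))
  (sf_div HS (Le H) (sfM HS (Le D) (Le W))) => g g' eq_t.
move=> /LS/defL[Mg tau_g] /LS/defL[Mg' tau_g'].
(* Since [t = x1^2], division by [x1] exhibits [c] itself as a norm over [M], hence over [K]. *)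
have [g0 [h0 def_c]] : exists g0 h0, c = g0 ^+ 2 + k * h0 ^+ 2.
  apply: (@infinite_specialize_norm K F iota [:: x1; x2; x3] c k (g / x1) (g' / x1)) => //.
  - exact: Mdiv.
  - exact: Mdiv.
  - by apply: (mulIf nzt); rewrite eq_t /t; field.
have nzcF : iota c != 0 by rewrite fmorph_eq0.
(* Composition of the form [X^2 + k Y^2] with itself divides [c] out and keeps the coordinates
   invariant. *)
pose g1 := (g * iota g0 - iota k * g' * iota h0) / iota c.
pose g2 := (g * iota h0 + g' * iota g0) / iota c.
have eq_t2 : t = g1 ^+ 2 + iota k * g2 ^+ 2.
  apply: (mulfI nzcF); rewrite eq_t; apply: (mulIf nzcF).
  transitivity ((g * iota g0 - iota k * g' * iota h0) ^+ 2 +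
      iota k * (g * iota h0 + g' * iota g0) ^+ 2); last by rewrite /g1 /g2; field.
  by rewrite def_c !(rmorphXn, rmorphD, rmorphM); ring.
have Mg1 : M g1 by apply: (Mdiv) => //; apply: (MB); [apply: (MM) | apply: (MM) => //; apply: (MM)].
have Mg2 : M g2 by apply: (Mdiv) => //; apply: (MD); apply: (MM).
have tg1 : tau g1 = g1.
  by rewrite /g1 fmorph_div rmorphB !rmorphM !tauC tau_g tau_g'.
have tg2 : tau g2 = g2.
  by rewrite /g2 fmorph_div rmorphD !rmorphM !tauC tau_g tau_g'.
(* Otherwise [x1] would be [g1] or [-g1], both of which are invariant. *)
have nzg2 : g2 != 0.
  apply/eqP => g20; move: eq_t2; rewrite g20 expr0n mulr0 addr0 => /eqP; rewrite eqf_sqr.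
  have x1N : x1 = - x1 -> False.
    move=> x1E; have /eqP : 2%:R * x1 = 0 by rewrite mulr_natl mulr2n {1}x1E addNr.
    by rewrite mulf_eq0 (negPf nz2F) (negPf nzx1).
  by case/orP=> /eqP x1E; apply: x1N; move: tau1; rewrite {1}x1E ?rmorphN tg1 -x1E.
(* The product of this element with its image under [tau] is [(g1^2 - x1^2) / g2^2 = -k]. *)
apply: none; apply: (@norm_square_classes ((x1 + g1) / g2)).
  by apply: (Mdiv) => //; apply: (MD).
rewrite fmorph_div rmorphD tg1 tg2 tau1 rmorphN.
apply: (mulIf (expf_neq0 2 nzg2)).
transitivity (g1 ^+ 2 - t); first by rewrite /t; field.
by rewrite eq_t2; ring.
Qed.

End NonRational.

(** * Base change to a quadratic extension *)

Section Quadratic.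
Variables (K : fieldType) (dl : K) (nsq : forall x : K, x ^+ 2 != dl).

(** Pairs [u + v sqrt dl]; the same construction serves for [K] and for [F], and maps between them
    act coordinatewise. The proof that [dl] is no square belongs to the type because the field
    structure depends on it. *)
Definition quad (_ : forall x : K, x ^+ 2 != dl) : Type := (K * K)%type.
Local Notation Q := (quad nsq).

HB.instance Definition _ := GRing.Zmodule.copy Q (K * K)%type.

Definition qre (u : Q) : K := u.1.
Definition qim (u : Q) : K := u.2.
Definition qmk (u v : K) : Q := (u, v).

Lemma qeqP (u v : Q) : qre u = qre v -> qim u = qim v -> u = v.
Proof. by case: u v => [a b] [c d]; rewrite /qre /qim /= => -> ->. Qed.

Definition qmul (u v : Q) : Q :=
  qmk (qre u * qre v + dl * (qim u * qim v)) (qre u * qim v + qim u * qre v).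
Definition qinv (u : Q) : Q :=
  let n := qre u ^+ 2 - dl * qim u ^+ 2 in qmk (qre u / n) (- qim u / n).

Lemma qmulA : associative qmul.
Proof. by move=> u v w; apply: qeqP; rewrite /qmul /qre /qim /=; ring. Qed.
Lemma qmulC : commutative qmul.
Proof. by move=> u v; apply: qeqP; rewrite /qmul /qre /qim /=; ring. Qed.
Lemma qmul1 : left_id (qmk 1 0) qmul.
Proof. by move=> u; apply: qeqP; rewrite /qmul /qre /qim /=; ring. Qed.
Lemma qmulDl : left_distributive qmul +%R.
Proof. by move=> u v w; apply: qeqP; rewrite /qmul /qre /qim /=; ring. Qed.
Lemma q1_neq0 : qmk 1 0 != 0 :> Q.
Proof. by apply/eqP => /(congr1 qre)/eqP; rewrite /qre /= oner_eq0. Qed.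

HB.instance Definition _ := GRing.Zmodule_isComNzRing.Build Q
  qmulA qmulC qmul1 qmulDl q1_neq0.

Lemma qnorm_neq0 (u : Q) : u != 0 -> qre u ^+ 2 - dl * qim u ^+ 2 != 0.
Proof.
move=> nzu; apply/eqP => /subr0_eq eq_u.
have [v0|nzv] := eqVneq (qim u) 0.
  move: eq_u; rewrite v0 expr0n mulr0 => /eqP; rewrite expf_eq0 /= => /eqP u0.
  by move/eqP: nzu; apply; apply: qeqP.
by have /eqP := nsq (qre u / qim u); apply; rewrite expr_div_n eq_u mulfK ?expf_neq0.
Qed.

Lemma qmulV (u : Q) : u != 0 -> qinv u * u = 1.
Proof.
move=> /qnorm_neq0; rewrite /qre /qim => nz_n.
by apply: qeqP; rewrite /qinv /qre /qim /=; field.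
Qed.
Lemma qinv0 : qinv 0 = 0.
Proof. by apply: qeqP; rewrite /qinv /qre /qim /= ?oppr0 mul0r. Qed.

HB.instance Definition _ := GRing.ComNzRing_isField.Build Q qmulV qinv0.

Lemma qreB (u v : Q) : qre (u - v) = qre u - qre v. Proof. by []. Qed.
Lemma qimB (u v : Q) : qim (u - v) = qim u - qim v. Proof. by []. Qed.
Lemma qreD (u v : Q) : qre (u + v) = qre u + qre v. Proof. by []. Qed.
Lemma qimD (u v : Q) : qim (u + v) = qim u + qim v. Proof. by []. Qed.
Lemma qreM (u v : Q) : qre (u * v) = qre u * qre v + dl * (qim u * qim v).
Proof. by []. Qed.
Lemma qimM (u v : Q) : qim (u * v) = qre u * qim v + qim u * qre v.
Proof. by []. Qed.
Lemma qreV (u : Q) : qre u^-1 = qre u / (qre u ^+ 2 - dl * qim u ^+ 2).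
Proof. by []. Qed.
Lemma qimV (u : Q) : qim u^-1 = - qim u / (qre u ^+ 2 - dl * qim u ^+ 2).
Proof. by []. Qed.

Definition qemb (u : K) : Q := qmk u 0.

Lemma qemb_zmod : zmod_morphism qemb.
Proof. by move=> u v; apply: qeqP; rewrite // qimB /qim /= subr0. Qed.
Lemma qemb_monoid : monoid_morphism qemb.
Proof.
split=> // u v; apply: qeqP; rewrite ?qreM ?qimM /qre /qim /=; ring.
Qed.
HB.instance Definition _ := GRing.isZmodMorphism.Build K Q qemb qemb_zmod.
HB.instance Definition _ := GRing.isMonoidMorphism.Build K Q qemb qemb_monoid.

Definition qroot : Q := qmk 0 1.

Lemma qrootX2 : qroot ^+ 2 = qemb dl.
Proof. by apply: qeqP; rewrite expr2 ?qreM ?qimM /qre /qim /=; ring. Qed.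

Lemma qE (u : Q) : u = qemb (qre u) + qemb (qim u) * qroot.
Proof.
by apply: qeqP; rewrite ?qreD ?qimD ?qreM ?qimM /qre /qim /=; ring.
Qed.

(** The imaginary part of [u^2] is twice the product of the coordinates of [u], so one of these
    vanishes. *)
Lemma qemb_square z : 2%:R != 0 :> K -> nonzero_square (qemb z) ->
  nonzero_square z \/ nonzero_square (z * dl).
Proof.
move=> nz2 [u nzu eq_u].
have def_z : z = qre u * qre u + dl * (qim u * qim u).
  by rewrite -qreM -expr2 -eq_u.
have /eqP : 2%:R * (qim u * qre u) = 0.
  have : qim (u * u) = 0 by rewrite -expr2 -eq_u.
  by rewrite qimM => <-; ring.
rewrite !mulf_eq0 (negPf nz2) /=.
case/orP=> /eqP v0; [left; exists (qre u) | right; exists (qim u * dl)].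
- by apply: contraNneq nzu => u0; apply/eqP; apply: qeqP.
- by rewrite def_z v0; ring.
- rewrite mulf_neq0 //; last by apply: contraNneq (nsq 0) => ->; rewrite expr0n.
  by apply: contraNneq nzu => u0; apply/eqP; apply: qeqP.
- by rewrite def_z v0; ring.
Qed.

End Quadratic.

Section QuadraticMap.
Variables (K F : fieldType) (iota : {rmorphism K -> F}) (dl : K) (dlF : F).
Variables (nsqK : forall x : K, x ^+ 2 != dl) (nsqF : forall x : F, x ^+ 2 != dlF).
Hypothesis iota_dl : iota dl = dlF.

(** Root goes to root; this extends the structure map as well as [tau]. *)
Definition qmap (_ : iota dl = dlF) (u : quad nsqK) : quad nsqF :=
  qmk nsqF (iota (qre u)) (iota (qim u)).

Lemma qmap_zmod : zmod_morphism (qmap iota_dl).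
Proof. by move=> u v; apply: qeqP; rewrite /qmap ?qreB ?qimB /= /qre /qim /= rmorphB. Qed.
Lemma qmap_monoid : monoid_morphism (qmap iota_dl).
Proof.
split=> [|u v]; apply: qeqP; rewrite ?qreM ?qimM /qre /qim /= -?iota_dl.
- by rewrite rmorph1.
- by rewrite rmorph0.
- by rewrite -!rmorphM -rmorphD.
- by rewrite -!rmorphM -rmorphD.
Qed.
HB.instance Definition _ := GRing.isZmodMorphism.Build _ _ (qmap iota_dl) qmap_zmod.
HB.instance Definition _ := GRing.isMonoidMorphism.Build _ _ (qmap iota_dl) qmap_monoid.

Lemma qmap_emb u : qmap iota_dl (qemb nsqK u) = qemb nsqF (iota u).
Proof. by apply: qeqP; rewrite // /qim /= rmorph0. Qed.
Lemma qmap_root : qmap iota_dl (qroot nsqK) = qroot nsqF.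
Proof. by apply: qeqP; rewrite /qre /qim /= ?rmorph0 ?rmorph1. Qed.

(** As the values lie in [F], each coordinate of the relation is a relation over [K], whose
    coefficients are the corresponding coordinates of those of [p]. *)
Lemma qmap_mmap n (y : 'I_n -> F) (p : {mpoly (quad nsqK)[n]}) :
    (forall q : {mpoly K[n]}, mmap iota y q = 0 -> q = 0) ->
  mmap (qmap iota_dl) (fun i => qemb nsqF (y i)) p = 0 -> p = 0.
Proof.
move=> ind p0.
have comp (pr : quad nsqK -> K) (prF : quad nsqF -> F) :
    (forall u v, prF (qmap iota_dl u * qemb nsqF v) = iota (pr u) * v) ->
    (forall u v, prF (u - v) = prF u - prF v) -> pr 0 = 0 ->
    forall m, pr p@_m = 0.
  move=> prM prB pr0 m.
  have prF0 : prF 0 = 0 by rewrite -(subrr 0) prB subrr.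
  have prD u v : prF (u + v) = prF u + prF v.
    by rewrite -[v in LHS]opprK prB -[- v]sub0r prB prF0 sub0r opprK.
  pose q := \sum_(m <- msupp p) pr p@_m *: 'X_[m] : {mpoly K[n]}.
  have q0 : q = 0.
    apply: ind; rewrite /q rmorph_sum /=.
    transitivity (prF (mmap (qmap iota_dl) (fun i => qemb nsqF (y i)) p)); last by rewrite p0.
    rewrite [mmap (qmap _) _ p]/mmap (big_morph prF prD prF0); apply: eq_bigr => m' _.
    rewrite mmapZ mmapX -prM; congr (prF (_ * _)).
    by rewrite /mmap1 rmorph_prod; apply: eq_bigr => i _; rewrite rmorphXn.
  have [m_in|/memN_msupp_eq0-> //] := boolP (m \in msupp p).
  have := congr1 (mcoeff m) q0; rewrite mcoeff0 /q raddf_sum /=.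
  rewrite (bigD1_seq m) ?msupp_uniq //= mcoeffZ mcoeffX eqxx mulr1 big1 ?addr0 //.
  by move=> m' /negPf ne; rewrite mcoeffZ mcoeffX ne mulr0.
apply/mpolyP => m; rewrite mcoeff0; apply: qeqP.
  apply: (comp (@qre _ _ _) (@qre _ _ _)) => // u v.
  by rewrite qreM /qre /qim /=; ring.
apply: (comp (@qim _ _ _) (@qim _ _ _)) => // u v.
by rewrite qimM /qre /qim /=; ring.
Qed.

Definition qset (S : F -> Prop) (u : quad nsqF) := exists2 v, S v & u = qemb nsqF v.

Lemma qset_alg_independent S :
  alg_independent iota S -> alg_independent (qmap iota_dl) (qset S).
Proof.
move=> ind n y inj_y Sy p p0.
have defy i : y i = qemb nsqF (qre (y i)) by have [v _ ->] := Sy i.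
apply: (@qmap_mmap _ (fun i => qre (y i))) => [q|].
  apply: ind => [i j eq_ij|i]; first by apply: inj_y; rewrite (defy i) (defy j) eq_ij.
  by have [v Sv ->] := Sy i.
rewrite -[RHS]p0; apply: eq_bigr => m _; congr (_ * _); apply: mmap1_eq => i.
by rewrite -defy.
Qed.

(** Pairs with both coordinates in [K(S)] form a field because [dlF] comes from [K]; so generating a
    field commutes with the base change. *)
Lemma qset_adjoin S u : adjoin (qmap iota_dl) (qset S) u <->
  adjoin iota S (qre u) /\ adjoin iota S (qim u).
Proof.
have HS := adjoin_sf iota S; have HS' := adjoin_sf (qmap iota_dl) (qset S).
have SM := sfM HS; have SD := sfD HS; have SB := sfB HS.
have Sdl : adjoin iota S dlF by rewrite -iota_dl; apply: adjoin_const.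
split=> [|[S1 S2]].
  move=> au; apply: (au (fun u => adjoin iota S (qre u) /\ adjoin iota S (qim u)))
    => [|k|v [w Sw ->]].
  - split=> [|u1 u2 [a1 b1] [a2 b2]|u1 u2 [a1 b1] [a2 b2]|u1 [a1 b1]].
    + by split; [apply: (sf1 HS) | apply: (sf0 HS)].
    + by rewrite qreB qimB; split; apply: (SB).
    + by rewrite qreM qimM; split; apply: (SD); apply: (SM) => //; apply: (SM).
    + have Sn : adjoin iota S (qre u1 ^+ 2 - dlF * qim u1 ^+ 2).
        by apply: (SB); [|apply: (SM) => //]; apply: (sfX HS).
      by rewrite qreV qimV; split; apply: (sf_div HS) => //; apply: (sfN HS).
  - by split; apply: adjoin_const.
  - by split; [apply: adjoin_mem | apply: (sf0 HS)].
have emb v : adjoin iota S v -> adjoin (qmap iota_dl) (qset S) (qemb nsqF v).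
  move=> Sv; apply: (Sv (fun v => adjoin (qmap iota_dl) (qset S) (qemb nsqF v))) => [|k|w Sw].
  - split=> [|u1 u2 a1 a2|u1 u2 a1 a2|u1 a1].
    + by rewrite rmorph1; apply: (sf1 HS').
    + by rewrite rmorphB; apply: (sfB HS').
    + by rewrite rmorphM; apply: (sfM HS').
    + by rewrite fmorphV; apply: (sfV HS').
  - by rewrite -qmap_emb; apply: adjoin_const.
  - by apply: adjoin_mem; exists w.
rewrite (qE u); apply: (sfD HS'); first exact: emb.
by apply: (sfM HS'); [apply: emb | rewrite -qmap_root; apply: adjoin_const].
Qed.

End QuadraticMap.

Section NonRationalBaseChange.
Variables (K F : fieldType) (iota : {rmorphism K -> F}).
Variables (tau : {rmorphism F -> F}) (x1 x2 x3 : F) (b k dl : K).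
Hypotheses (nz2 : 2%:R != 0 :> K) (nzb : b != 0) (nzk : k != 0) (nzdl : dl != 0).
Hypothesis nsq_iota : ~ nonzero_square dl -> forall u : F, u ^+ 2 != iota dl.
Hypothesis trx : trdeg3 iota x1 x2 x3.
Hypothesis tauC : forall c, tau (iota c) = iota c.
Hypothesis tau1 : tau x1 = - x1.
Hypothesis tau2 : tau x2 = iota b / x2.
Hypothesis tau3 : tau x3 = iota k * (x1 ^+ 2 - iota (b * dl)) / x3.

(** If [dl] is not a square already, fixed field, generators and transcendence basis are extended to
    [K(sqrt dl)], where [dl] becomes the [d^2] of the criterion; [qemb_square] brings the square
    class back to [K]. *)
Theorem purely_transcendental_square_classes (L : F -> Prop) :
    (forall u, L u <-> gen iota [:: x1; x2; x3] u /\ tau u = u) ->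
    purely_transcendental iota L ->
  exists2 z, z \in [:: b; - k; b * - k] & nonzero_square z \/ nonzero_square (z * dl).
Proof.
move=> defL ptL.
have [[d nzd def_dl]|nsq] := excluded_middle_informative (nonzero_square dl).
  have := @purely_transcendental_nonsquare K F iota tau x1 x2 x3 b k d nz2 nzb nzk nzd
    trx tauC tau1 tau2 _ L defL ptL.
  rewrite -def_dl => /(_ tau3)[] Hz; [exists b|exists (- k)|exists (b * - k)];
    by rewrite ?inE ?eqxx ?orbT //; left.
have nsqK (x : K) : x ^+ 2 != dl.
  apply/eqP => def_dl; apply: nsq; exists x => //.
  by apply: contraNneq nzdl => x0; rewrite -def_dl x0 expr0n.
have nsqF := nsq_iota nsq.
pose iota' : {rmorphism quad nsqK -> quad nsqF} := @qmap _ _ iota _ _ nsqK nsqF (erefl (iota dl)).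
have tau_dl := tauC dl.
pose tau' : {rmorphism quad nsqF -> quad nsqF} := @qmap _ _ tau _ _ nsqF nsqF tau_dl.
pose jF : {rmorphism F -> quad nsqF} := qemb nsqF.
pose jK : {rmorphism K -> quad nsqK} := qemb nsqK.
have iotaE u : iota' (jK u) = jF (iota u) by apply: qmap_emb.
have tauE u : tau' (jF u) = jF (tau u) by apply: qmap_emb.
have genE u : gen iota' [:: jF x1; jF x2; jF x3] u <->
    gen iota [:: x1; x2; x3] (qre u) /\ gen iota [:: x1; x2; x3] (qim u).
  rewrite -(@qset_adjoin _ _ iota _ _ nsqK nsqF (erefl _) (fun v => v \in [:: x1; x2; x3])).
  split; apply: adjoin_sub => v.
    rewrite !inE => /or3P[]/eqP->; apply: adjoin_mem.
    - by exists x1; rewrite ?inE ?eqxx.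
    - by exists x2; rewrite ?inE ?eqxx ?orbT.
    - by exists x3; rewrite ?inE ?eqxx ?orbT.
  by case=> w; rewrite !inE => /or3P[]/eqP-> ->; apply: adjoin_mem; rewrite !inE eqxx ?orbT.
pose L' (u : quad nsqF) := L (qre u) /\ L (qim u).
have ptL' : purely_transcendental iota' L'.
  case: ptL => S indS LS; exists (qset S); first exact: qset_alg_independent.
  by move=> u; rewrite qset_adjoin /L' !LS.
have defL' (u : quad nsqF) : L' u <-> gen iota' [:: jF x1; jF x2; jF x3] u /\ tau' u = u.
  rewrite /L' !defL genE; split=> [[[g1 t1] [g2 t2]]|[[g1 g2] tu]].
    by split=> //; apply: qeqP.
  have t1 := congr1 (@qre _ _ _) tu; have t2 := congr1 (@qim _ _ _) tu.
  by split; split.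
have trx' : trdeg3 iota' (jF x1) (jF x2) (jF x3).
  rewrite /trdeg3 /indep => p p0.
  apply: (@qmap_mmap _ _ iota _ _ nsqK nsqF (erefl _) _ (fun i : 'I_3 => nth 0 [:: x1; x2; x3] i)).
    exact: trx.
  rewrite -[RHS]p0; apply: eq_bigr => m _; congr (_ * _); apply: mmap1_eq.
  by case=> -[|[|[|]]].
have nz2' : 2%:R != 0 :> quad nsqK by rewrite -(rmorph_nat jK) fmorph_eq0.
have nzb' : jK b != 0 by rewrite fmorph_eq0.
have nzk' : jK k != 0 by rewrite fmorph_eq0.
have nzr : qroot nsqK != 0.
  apply: contraNneq nzdl => r0; have := qrootX2 nsqK.
  by rewrite r0 expr0n => /eqP; rewrite eq_sym (fmorph_eq0 jK).
have tauC' (c : quad nsqK) : tau' (iota' c) = iota' c.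
  by apply: qeqP; rewrite /qre /qim /= tauC.
have iota_bdl : iota' (jK b * qroot nsqK ^+ 2) = jF (iota (b * dl)).
  by rewrite qrootX2 -[qemb _ dl]/(jK dl) -rmorphM iotaE.
have t1' : tau' (jF x1) = - jF x1 by rewrite tauE tau1 rmorphN.
have t2' : tau' (jF x2) = iota' (jK b) / jF x2 by rewrite tauE tau2 fmorph_div iotaE.
have t3' : tau' (jF x3) =
    iota' (jK k) * (jF x1 ^+ 2 - iota' (jK b * qroot nsqK ^+ 2)) / jF x3.
  by rewrite iota_bdl iotaE tauE tau3 fmorph_div rmorphM rmorphB rmorphXn.
have := purely_transcendental_nonsquare nz2' nzb' nzk' nzr trx' tauC' t1' t2' t3' defL' ptL'.
case=> Hz; [exists b|exists (- k)|exists (b * - k)];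
  rewrite ?inE ?eqxx ?orbT //; apply: (qemb_square (nsq := nsqK)) => //.
- by move: Hz; rewrite -rmorphN.
- by move: Hz; rewrite -rmorphN -rmorphM.
Qed.

End NonRationalBaseChange.

(** * Explicit generators *)

Ltac nz := rewrite ?(mulf_eq0, negb_or, oppr_eq0, invr_eq0, expf_eq0) /=;
  repeat match goal with H : is_true (?x != 0) |- _ => progress (rewrite ?H) end; try done.

Ltac in_sf H := repeat first
  [ assumption | done | apply: (sfD H) | apply: (sfN H) | apply: (sfM H)
  | apply: (sfV H) | apply: (sfX H) | apply: (sf_natmul H) | exact: (sf1 H) | exact: (sf0 H) ].

Ltac in_gen := repeat first
  [ assumption | apply: gen_const | solve [apply: gen_mem; rewrite !inE ?eqxx ?orbT //]
  | apply: (sfD (gen_sf _ _)) | apply: (sfN (gen_sf _ _)) | apply: (sfM (gen_sf _ _))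
  | apply: (sfV (gen_sf _ _)) | apply: (sfX (gen_sf _ _)) | apply: (sf_natmul (gen_sf _ _))
  | apply: (sf1 (gen_sf _ _)) | apply: (sf0 (gen_sf _ _)) ].

Ltac in_cls := repeat first
  [ assumption | apply: cls_const | solve [apply: cls_mem; rewrite !inE ?eqxx ?orbT //]
  | apply: (sfD (cls_sf _ _)) | apply: (sfN (cls_sf _ _)) | apply: (sfM (cls_sf _ _))
  | apply: (sfV (cls_sf _ _)) | apply: (sfX (cls_sf _ _)) | apply: (sf_natmul (cls_sf _ _))
  | apply: (sf1 (cls_sf _ _)) | apply: (sf0 (cls_sf _ _)) ].

Section QuadraticClosure.
Variables (F : fieldType) (N : F -> Prop) (HN : is_subfield N) (w : F).
Hypothesis Nw2 : N (w ^+ 2).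

(** [w] may lie in [N], so [A] and [B] need not be unique. *)
Definition quad_ext u := exists A B, [/\ N A, N B & u = A + B * w].

Lemma quad_ext_sub u : N u -> quad_ext u.
Proof. by move=> Nu; exists u, 0; rewrite mul0r addr0; split=> //; apply: sf0 HN. Qed.

Lemma quad_ext_root : quad_ext w.
Proof. by exists 0, 1; rewrite mul1r add0r; split=> //; [apply: sf0 HN | apply: sf1 HN]. Qed.

Lemma quad_ext_sf : is_subfield quad_ext.
Proof.
split=> [|u v [A [B [NA NB ->]]] [A' [B' [NA' NB' ->]]]
          |u v [A [B [NA NB ->]]] [A' [B' [NA' NB' ->]]]|u [A [B [NA NB ->]]]].
- exact: quad_ext_sub (sf1 HN).
- by exists (A - A'), (B - B'); split; [in_sf HN | in_sf HN | ring].
- exists (A * A' + B * B' * w ^+ 2), (A * B' + B * A').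
  by split; [in_sf HN | in_sf HN | ring].
(* The conjugate can vanish when [w] is in [N]; the element is then [2 A]. *)
have [AB|nzAB] := eqVneq (A - B * w) 0.
  apply: quad_ext_sub; have -> : A + B * w = A + A by rewrite [in RHS]( subr0_eq AB) (subr0_eq AB).
  by in_sf HN.
have [AB'|nzAB'] := eqVneq (A + B * w) 0.
  by apply: quad_ext_sub; rewrite AB' invr0; apply: sf0 HN.
exists (A / (A ^+ 2 - B ^+ 2 * w ^+ 2)), (- B / (A ^+ 2 - B ^+ 2 * w ^+ 2)).
split; [by in_sf HN | by in_sf HN |].
have -> : A ^+ 2 - B ^+ 2 * w ^+ 2 = (A - B * w) * (A + B * w) by ring.
by field; nz.
Qed.

(** [A + B w] is fixed only if [2 B w = 0]. Invariant fields below are found this way: [N] is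
    generated by invariants, and an anti-invariant [w] with square in [N] is shown to produce the
    rest. *)
Lemma quad_ext_fixed (s : {rmorphism F -> F}) u : 2%:R != 0 :> F -> w != 0 ->
  (forall v, N v -> s v = v) -> s w = - w -> quad_ext u -> s u = u -> N u.
Proof.
move=> nz2 nzw sN sw [A [B [NA NB ->]]].
rewrite rmorphD rmorphM sw (sN A) // (sN B) // => /addrI/eqP.
rewrite mulrN -subr_eq0 -opprD oppr_eq0 -mulr2n -mulr_natl !mulf_eq0 (negPf nz2) (negPf nzw) orbF.
by move=> /eqP->; rewrite mul0r addr0.
Qed.

End QuadraticClosure.

(** * Rationality of the threefold [(p^2 + q^2) (y^2 + b) = x^2 + c] *)

Section Ambient.
Variables (K F : fieldType) (iota : {rmorphism K -> F}) (X1 X2 X3 : F).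
Hypothesis nz2 : 2%:R != 0 :> F.
Hypothesis trX : trdeg3 iota X1 X2 X3.

Notation gen := (gen iota).
Notation cls := (cls iota).

Definition spans s := [/\ cls s X1, cls s X2 & cls s X3].

Lemma spans_sub s s' : spans s -> (forall v, v \in s -> cls s' v) -> spans s'.
Proof. by move=> [c1 c2 c3] ss'; split; apply: cls_sub ss' _. Qed.

(** Main source of nonvanishing facts: if the expression were zero, everything would be algebraic
    over two elements. *)
Lemma spans2 u v : spans [:: u; v] -> False.
Proof. by move=> [c1 c2 c3]; apply: trdeg3_not_cls2 trX c1 c2 c3. Qed.

Lemma spans3 z1 z2 z3 : spans [:: z1; z2; z3] -> trdeg3 iota z1 z2 z3.
Proof. by move=> [c1 c2 c3]; apply: trdeg3_cls trX c1 c2 c3. Qed.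

Lemma spans_purely_transcendental L s z1 z2 z3 :
    (forall u, L u <-> gen s u) -> spans s ->
    (forall v, v \in s -> gen [:: z1; z2; z3] v) ->
    (forall v, v \in [:: z1; z2; z3] -> gen s v) ->
  purely_transcendental iota L.
Proof.
move=> defL sp sz zs.
have [c1 c2 c3] : spans [:: z1; z2; z3].
  by apply: spans_sub sp _ => v /sz; apply: cls_gen.
apply: (trdeg3_purely_transcendental trX _ c1 c2 c3) => u; rewrite defL.
by split; apply: gen_sub.
Qed.

Section TwoConics.
Variables (L : F -> Prop) (p q x y : F) (b c : K).
Hypothesis defL : forall u, L u <-> gen [:: p; q; x; y] u.
Hypothesis spL : spans [:: p; q; x; y].
Hypothesis rel : (p ^+ 2 + q ^+ 2) * (y ^+ 2 + iota b) = x ^+ 2 + iota c.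

Let no2 u v : cls [:: u; v] p -> cls [:: u; v] q -> cls [:: u; v] x -> cls [:: u; v] y -> False.
Proof.
move=> cp cq cx cy; apply: (@spans2 u v); apply: spans_sub spL _ => z.
by rewrite !inE => /or4P[]/eqP->.
Qed.

Lemma two_conics_neq0 : p ^+ 2 + q ^+ 2 != 0 /\ y ^+ 2 + iota b != 0.
Proof.
split; apply/eqP => e0; move: rel; rewrite e0 ?mul0r ?mulr0 => /esym/eqP;
  rewrite addr_eq0 => /eqP def_x; move/eqP: e0; rewrite addr_eq0 => /eqP e0.
  apply: (@no2 q y); try by in_cls.
    by apply: cls_sqrt; rewrite e0; in_cls.
  by apply: cls_sqrt; rewrite def_x; in_cls.
apply: (@no2 p q); try by in_cls.
  by apply: cls_sqrt; rewrite def_x; in_cls.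
by apply: cls_sqrt; rewrite e0; in_cls.
Qed.

(** With [i] the form [p^2 + q^2] factors as [r r'], and the relation gives [r'] from [x], [y],
    [r]. *)
Lemma two_conics_rational_m1 i : i ^+ 2 = -1 :> K -> purely_transcendental iota L.
Proof.
move=> i2; have [nzt nzy] := two_conics_neq0.
have I2 : iota i ^+ 2 = -1 by rewrite -rmorphXn i2 rmorphN1.
have nzi : iota i != 0.
  apply/eqP => i0; move/eqP: I2.
  by rewrite i0 expr0n eq_sym oppr_eq0 oner_eq0.
have fact : p ^+ 2 + q ^+ 2 = (p + iota i * q) * (p - iota i * q).
  transitivity (p ^+ 2 - iota i ^+ 2 * q ^+ 2); last by ring.
  by rewrite I2; ring.
have nzr : p + iota i * q != 0 by apply: contraNneq nzt => r0; rewrite fact r0 mul0r.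
pose r := p + iota i * q; pose r' := (x ^+ 2 + iota c) / ((y ^+ 2 + iota b) * r).
have def_r' : r' = p - iota i * q.
  by rewrite /r' -rel fact -/r; field; nz.
apply: (spans_purely_transcendental (z1 := x) (z2 := y) (z3 := r) defL spL) => v.
  have gr' : gen [:: x; y; r] r' by rewrite /r'; in_gen.
  rewrite !inE => /or4P[]/eqP->; try by in_gen.
    have -> : p = (r + r') / 2%:R by rewrite def_r' /r; field; nz.
    by in_gen.
  have -> : q = (r - r') / (2%:R * iota i) by rewrite def_r' /r; field; nz.
  by in_gen.
by rewrite !inE => /or3P[]/eqP->; rewrite /r; in_gen.
Qed.

(** By composition the left side is again a sum of two squares [p'^2 + q'^2]. The equation becomes
    [(p' - x) (p' + x) = c - q'^2], which gives one factor from the other and [q']. *)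
Lemma two_conics_rational_sqr e : e != 0 -> b = e ^+ 2 -> purely_transcendental iota L.
Proof.
move=> nze def_b; have [nzt nzy] := two_conics_neq0.
move: rel nzy; rewrite def_b rmorphXn; set f := iota e => rel' nzy.
pose p' := p * y - q * f; pose q' := p * f + q * y; pose s := p' + x.
have rel2 : (p' - x) * s = iota c - q' ^+ 2.
  transitivity ((p ^+ 2 + q ^+ 2) * (y ^+ 2 + f ^+ 2) - x ^+ 2 - q' ^+ 2).
    by rewrite /s /p' /q'; ring.
  by rewrite rel'; ring.
have def_p : p = (p' * y + q' * f) / (y ^+ 2 + f ^+ 2) by rewrite /p' /q'; field; nz.
have def_q : q = (q' * y - p' * f) / (y ^+ 2 + f ^+ 2) by rewrite /p' /q'; field; nz.
have nzs : s != 0.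
  apply/eqP => s0; move: rel2; rewrite s0 mulr0 => /esym/eqP; rewrite subr_eq0 => /eqP q'2.
  have cq' : cls [:: x; y] q' by apply: cls_sqrt; rewrite -q'2; in_cls.
  have cp' : cls [:: x; y] p'.
    by move/eqP: s0; rewrite addr_eq0 => /eqP->; in_cls.
  by apply: (@no2 x y); rewrite ?def_p ?def_q /f; in_cls.
pose r := (iota c - q' ^+ 2) / s.
have def_r : r = p' - x by rewrite /r -rel2 mulfK.
apply: (spans_purely_transcendental (z1 := y) (z2 := q') (z3 := s) defL spL) => v.
  have gr : gen [:: y; q'; s] r by rewrite /r; in_gen.
  have gp' : gen [:: y; q'; s] p'.
    have -> : p' = (s + r) / 2%:R by rewrite def_r /s; field; nz.
    by in_gen.
  have gx : gen [:: y; q'; s] x.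
    have -> : x = (s - r) / 2%:R by rewrite def_r /s; field; nz.
    by in_gen.
  by rewrite !inE => /or4P[]/eqP->; rewrite ?def_p ?def_q /f; in_gen.
by rewrite !inE => /or3P[]/eqP->; rewrite /s /p' /q' /f; in_gen.
Qed.

(** [y^2 - e^2] splits. After scaling [p] and [q] by [y - e], only the ratio [(y + e) / (y - e)]
    enters the relation, which then determines [y]. *)
Lemma two_conics_rational_oppsqr e : e != 0 -> b = - e ^+ 2 -> purely_transcendental iota L.
Proof.
move=> nze def_b; have [nzt nzy] := two_conics_neq0.
move: rel nzy; rewrite def_b rmorphN rmorphXn; set f := iota e => rel' nzy.
have nzf : f != 0 by rewrite fmorph_eq0.
have fact : y ^+ 2 - f ^+ 2 = (y - f) * (y + f) by ring.
have nz1 : y - f != 0 by apply: contraNneq nzy => y0; rewrite fact y0 mul0r.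
pose p1 := p * (y - f); pose q1 := q * (y - f).
have fact1 : p1 ^+ 2 + q1 ^+ 2 = (p ^+ 2 + q ^+ 2) * (y - f) ^+ 2 by rewrite /p1 /q1; ring.
have nzt1 : p1 ^+ 2 + q1 ^+ 2 != 0 by rewrite fact1; nz.
pose Y := (x ^+ 2 + iota c) / (p1 ^+ 2 + q1 ^+ 2).
have def_Y : Y = (y + f) / (y - f).
  by rewrite /Y -rel' fact1 fact; field; nz.
have nzY : Y - 1 != 0.
  have -> : Y - 1 = 2%:R * f / (y - f) by rewrite def_Y; field; nz.
  by nz.
apply: (spans_purely_transcendental (z1 := p1) (z2 := q1) (z3 := x) defL spL) => v.
  have gY : gen [:: p1; q1; x] Y by rewrite /Y; in_gen.
  have gy : gen [:: p1; q1; x] y.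
    have -> : y = f * (Y + 1) / (Y - 1).
      by apply: (mulIf nzY); rewrite divfK // def_Y; field; nz.
    by rewrite /f; in_gen.
  rewrite !inE => /or4P[]/eqP->; try by in_gen.
    by have -> : p = p1 / (y - f) by [rewrite /p1; field; nz|]; rewrite /f; in_gen.
  by have -> : q = q1 / (y - f) by [rewrite /q1; field; nz|]; rewrite /f; in_gen.
by rewrite !inE => /or3P[]/eqP->; rewrite /p1 /q1 /f; in_gen.
Qed.

(** Scaling by [b / e] turns [c] into [b], so that [p'^2 + q'^2] is the norm of [(x' + sqrt(-b)) /
    (y + sqrt(-b)) = u + v sqrt(-b)]. The quadric [p'^2 - u^2 = b v^2 - q'^2] is rational because
    its left side factors. *)
Lemma two_conics_rational_mul e : e != 0 -> b != 0 -> b * c = e ^+ 2 ->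
  purely_transcendental iota L.
Proof.
move=> nze nzb def_e; have [nzt nzy] := two_conics_neq0.
pose B := iota b; pose f := iota e.
have nzf : f != 0 by rewrite fmorph_eq0.
have nzB : B != 0 by rewrite fmorph_eq0.
pose x' := B * x / f; pose p' := p * B / f; pose q' := q * B / f.
have rel' : (p' ^+ 2 + q' ^+ 2) * (y ^+ 2 + B) = x' ^+ 2 + B.
  transitivity ((B / f) ^+ 2 * ((p ^+ 2 + q ^+ 2) * (y ^+ 2 + B))).
    by rewrite /p' /q'; ring.
  rewrite rel; have -> : iota c = f ^+ 2 / B.
    by apply: (mulfI nzB); rewrite -rmorphM def_e rmorphXn mulrC divfK.
  by rewrite /x'; field; nz.
have nzt' : p' ^+ 2 + q' ^+ 2 != 0.
  by have -> : p' ^+ 2 + q' ^+ 2 = (p ^+ 2 + q ^+ 2) * (B / f) ^+ 2 by [rewrite /p' /q'; ring|]; nz.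
have def_p : p = p' * f / B by rewrite /p'; field; nz.
have def_q : q = q' * f / B by rewrite /q'; field; nz.
have def_x : x = x' * f / B by rewrite /x'; field; nz.
have no2' u v : cls [:: u; v] p' -> cls [:: u; v] q' -> cls [:: u; v] x' -> cls [:: u; v] y -> False.
  by move=> *; apply: (@no2 u v); rewrite ?def_p ?def_q ?def_x /f /B; in_cls.
pose u := (x' * y + B) / (y ^+ 2 + B); pose v := (y - x') / (y ^+ 2 + B).
have relu : p' ^+ 2 + q' ^+ 2 = u ^+ 2 + B * v ^+ 2.
  apply: (mulIf nzy); rewrite rel' /u /v -/B; move: nzy; rewrite -/B => nzy'.
  by field; nz.
have nzv : v != 0.
  apply/eqP => /eqP; rewrite mulf_eq0 invr_eq0 (negPf nzy) orbF subr_eq0 => /eqP yx.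
  have t1 : p' ^+ 2 + q' ^+ 2 = 1.
    by apply: (mulIf nzy); rewrite mul1r rel' yx.
  have cq : cls [:: p'; y] q'.
    by apply: cls_sqrt; have -> : q' ^+ 2 = 1 - p' ^+ 2 by [rewrite -t1; ring|]; in_cls.
  by apply: (@no2' p' y); rewrite -?yx; in_cls.
have nzy' : y ^+ 2 + B != 0 by [].
have def_y : y = (1 - u) / v.
  have -> : 1 - u = v * y by rewrite /u /v; field; nz.
  by field.
have def_x' : x' = y - v * (y ^+ 2 + B) by rewrite /v; field; nz.
have go z : z \in [:: p'; q'; u; v] -> gen [:: p; q; x; y] z.
  by rewrite !inE => /or4P[]/eqP->; rewrite /u /v /p' /q' /x' /f /B; in_gen.
clearbody u v x' p' q'.
pose Q := q' / v; pose R := (p' + u) / v.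
have relR : (p' - u) / v * R = B - Q ^+ 2.
  apply: (mulIf (expf_neq0 2 nzv)).
  transitivity (p' ^+ 2 - u ^+ 2); first by rewrite /R; field; nz.
  by rewrite -(addrK (q' ^+ 2) (p' ^+ 2)) relu /Q; field; nz.
have nzR : R != 0.
  apply/eqP => R0; move: relR; rewrite R0 mulr0 => /esym/eqP; rewrite subr_eq0 => /eqP Q2.
  have cQ : cls [:: u; v] Q by apply: cls_sqrt; rewrite -Q2 /B; in_cls.
  have cq : cls [:: u; v] q'.
    by have -> : q' = Q * v by [rewrite /Q divfK|]; in_cls.
  have cp : cls [:: u; v] p'.
    move/eqP: R0; rewrite mulf_eq0 invr_eq0 (negPf nzv) orbF addr_eq0 => /eqP->.
    by in_cls.
  have cy : cls [:: u; v] y by rewrite def_y; in_cls.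
  by apply: (@no2' u v) => //; rewrite def_x' /B; in_cls.
pose W := (B - Q ^+ 2) / R.
have def_W : W = (p' - u) / v by rewrite /W -relR mulfK.
apply: (spans_purely_transcendental (z1 := v) (z2 := Q) (z3 := R) defL spL) => z.
  have gW : gen [:: v; Q; R] W by rewrite /W /B; in_gen.
  have gp : gen [:: v; Q; R] p'.
    have -> : p' = (R + W) / 2%:R * v by rewrite def_W /R; field; nz.
    by in_gen.
  have gu : gen [:: v; Q; R] u.
    have -> : u = (R - W) / 2%:R * v by rewrite def_W /R; field; nz.
    by in_gen.
  have gq : gen [:: v; Q; R] q'.
    by have -> : q' = Q * v by [rewrite /Q divfK|]; in_gen.
  have gy : gen [:: v; Q; R] y by rewrite def_y; in_gen.
  have gx : gen [:: v; Q; R] x' by rewrite def_x' /B; in_gen.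
  by rewrite !inE => /or4P[]/eqP->; rewrite ?def_p ?def_q ?def_x /f /B; in_gen.
have gp0 : gen [:: p; q; x; y] p' by apply: go; rewrite !inE eqxx.
have gq0 : gen [:: p; q; x; y] q' by apply: go; rewrite !inE eqxx orbT.
have gu0 : gen [:: p; q; x; y] u by apply: go; rewrite !inE eqxx !orbT.
have gv0 : gen [:: p; q; x; y] v by apply: go; rewrite !inE eqxx !orbT.
by rewrite !inE => /or3P[]/eqP->; rewrite /R /Q; in_gen.
Qed.

End TwoConics.

(** Dividing [p] and [q] by [p^2 + q^2] inverts the sum of squares and exchanges [(b, y)] with
    [(c, x)], so the cases in [c] reduce to those in [b]. *)
Theorem two_conics_rational L p q x y (b c : K) :
    (forall u, L u <-> gen [:: p; q; x; y] u) -> spans [:: p; q; x; y] ->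
    (p ^+ 2 + q ^+ 2) * (y ^+ 2 + iota b) = x ^+ 2 + iota c -> b != 0 ->
    [\/ nonzero_square (-1 : K) \/ nonzero_square b, nonzero_square (- b)
      , nonzero_square c \/ nonzero_square (- c) | nonzero_square (b * c)] ->
  purely_transcendental iota L.
Proof.
move=> defL spL rel nzb.
have [nzt nzy] := two_conics_neq0 spL rel.
pose t := p ^+ 2 + q ^+ 2; pose p' := p / t; pose q' := q / t.
have rel' : (p' ^+ 2 + q' ^+ 2) * (x ^+ 2 + iota c) = y ^+ 2 + iota b.
  by rewrite -rel /p' /q' /t; field; nz.
have tE : t = (p' ^+ 2 + q' ^+ 2)^-1.
  by rewrite /p' /q' /t; field; nz.
have sub1 v : v \in [:: p; q; x; y] -> gen [:: p'; q'; y; x] v.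
  have gt : gen [:: p'; q'; y; x] t by rewrite tE; in_gen.
  have -> : p = p' * t by rewrite /p' divfK.
  have -> : q = q' * t by rewrite /q' divfK.
  by rewrite !inE => /or4P[]/eqP->; in_gen.
have sub2 v : v \in [:: p'; q'; y; x] -> gen [:: p; q; x; y] v.
  by rewrite !inE => /or4P[]/eqP->; rewrite /p' /q' /t; in_gen.
have defL' u : L u <-> gen [:: p'; q'; y; x] u by rewrite defL; split; apply: gen_sub.
have spL' : spans [:: p'; q'; y; x].
  by apply: spans_sub spL _ => v /sub1; apply: cls_gen.
case=> [[[i _ def_i]|[e nze def_b]]|[e nze def_b]|[[e nze def_c]|[e nze def_c]]|[e nze def_bc]].
- exact: (two_conics_rational_m1 defL spL rel (esym def_i)).
- exact: (two_conics_rational_sqr defL spL rel nze def_b).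
- by apply: (two_conics_rational_oppsqr defL spL rel nze); rewrite -def_b opprK.
- exact: (two_conics_rational_sqr defL' spL' rel' nze def_c).
- by apply: (two_conics_rational_oppsqr defL' spL' rel' nze); rewrite -def_c opprK.
- exact: (two_conics_rational_mul defL spL rel nze nzb def_bc).
Qed.

End Ambient.

(** * Fixed fields *)

Section FixedFields.
Variables (K F : fieldType) (iota : {rmorphism K -> F}) (X1 X2 X3 : F).
Hypothesis nz2 : 2%:R != 0 :> F.
Hypothesis trX : trdeg3 iota X1 X2 X3.

Notation gen := (gen iota).
Notation cls := (cls iota).
Notation spans := (spans iota X1 X2 X3).

Lemma spans3_drop u v w : spans [:: u; v; w] -> ~ cls [:: v; w] u.
Proof.
move=> sp cu; apply: (spans2 trX (u := v) (v := w)); apply: spans_sub sp _ => z.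
by rewrite !inE => /or3P[]/eqP->; in_cls.
Qed.

Lemma spans_perm s s' : (forall v, v \in s -> v \in s') -> spans s -> spans s'.
Proof. by move=> ss' sp; apply: spans_sub sp _ => v /ss'; apply: cls_mem. Qed.

Lemma quad_ext_cls s w u : gen s (w ^+ 2) -> quad_ext (gen s) w u -> cls s u.
Proof.
move=> gw [A [B [gA gB ->]]].
have cw : cls s w by apply: cls_sqrt; apply: cls_gen.
by apply: (sfD (cls_sf _ _)); [|apply: (sfM (cls_sf _ _)) => //]; apply: cls_gen.
Qed.

Lemma gen_fixed (s : {rmorphism F -> F}) l : (forall k, s (iota k) = iota k) ->
  (forall v, v \in l -> s v = v) -> forall u, gen l u -> s u = u.
Proof.
move=> sC sl u gu; apply: (gu (fun u => s u = u)) => [|k|v] //; last exact: sl.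
split=> [|u1 u2 e1 e2|u1 u2 e1 e2|u1 e1]; first by rewrite rmorph1.
- by rewrite rmorphB e1 e2.
- by rewrite rmorphM e1 e2.
- by rewrite fmorphV e1.
Qed.

(** Over the fixed field, [x2 = P + Q x1] and [x3 = U + V x1]. The norm equation
    [P^2 - x1^2 Q^2 = b] expresses [x1^2] by [P] and [Q], and the norm equation for [x3] remains as
    the relation. *)
Lemma two_conics_model (tau : {rmorphism F -> F}) (L : F -> Prop) x1 x2 x3 (b k1 k0 : K) :
    (forall k, tau (iota k) = iota k) -> spans [:: x1; x2; x3] ->
    tau x1 = - x1 -> tau x2 = iota b / x2 ->
    tau x3 = (iota k1 * x1 ^+ 2 + iota k0) / x3 ->
    (forall u, L u <-> gen [:: x1; x2; x3] u /\ tau u = u) -> b != 0 ->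
  exists P Q U V, [/\ Q != 0, forall u, L u <-> gen [:: P; Q; U; V] u, spans [:: P; Q; U; V]
    & let t := (P ^+ 2 - iota b) / Q ^+ 2 in U ^+ 2 - t * V ^+ 2 = iota k1 * t + iota k0].
Proof.
move=> tauC sp t1 t2 t3 defL nzb.
have nzB : iota b != 0 by rewrite fmorph_eq0.
have n1 := spans3_drop sp.
have n2 : ~ cls [:: x1; x3] x2.
  apply: spans3_drop; apply: spans_perm sp => v; rewrite !inE.
  by case/or3P=> ->; rewrite ?orbT.
have n3 : ~ cls [:: x1; x2] x3.
  apply: spans3_drop; apply: spans_perm sp => v; rewrite !inE.
  by case/or3P=> ->; rewrite ?orbT.
have nzx1 : x1 != 0 by apply: contra_notN n1 => /eqP->; in_cls.
have nzx2 : x2 != 0 by apply: contra_notN n2 => /eqP->; in_cls.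
have nzx3 : x3 != 0 by apply: contra_notN n3 => /eqP->; in_cls.
have nzd : x2 ^+ 2 - iota b != 0.
  apply: contra_notN n2; rewrite subr_eq0 => /eqP x2b.
  by apply: cls_sqrt; rewrite x2b; in_cls.
pose h := iota k1 * x1 ^+ 2 + iota k0; rewrite -/h in t3.
have th : tau h = h by rewrite /h rmorphD rmorphM rmorphXn !tauC t1 sqrrN.
have nzh : h != 0.
  have : tau x3 != 0 by rewrite fmorph_eq0.
  by rewrite t3 mulf_eq0 negb_or => /andP[].
have t2' : tau (iota b / x2) = x2 by rewrite fmorph_div tauC t2; field; nz.
have t3' : tau (h / x3) = x3 by rewrite fmorph_div th t3; field; nz.
pose P := (x2 + iota b / x2) / 2%:R; pose Q := (x2 - iota b / x2) / (2%:R * x1).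
pose U := (x3 + h / x3) / 2%:R; pose V := (x3 - h / x3) / (2%:R * x1).
have t2n : tau 2%:R = 2%:R by rewrite rmorph_nat.
have tP : tau P = P by rewrite /P fmorph_div rmorphD t2 t2' t2n addrC.
have tQ : tau Q = Q.
  by rewrite /Q fmorph_div rmorphB rmorphM t1 t2 t2' t2n; field; nz.
have tU : tau U = U by rewrite /U fmorph_div rmorphD t3 t3' t2n addrC.
have tV : tau V = V.
  by rewrite /V fmorph_div rmorphB rmorphM t1 t3 t3' t2n; move: (h) => h'; field; nz.
have defQ : Q = (x2 ^+ 2 - iota b) / (2%:R * x1 * x2) by rewrite /Q; field; nz.
have nzQ : Q != 0 by rewrite defQ; nz.
have def_t : x1 ^+ 2 = (P ^+ 2 - iota b) / Q ^+ 2.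
  by apply: (mulIf (expf_neq0 2 nzQ)); rewrite divfK ?expf_neq0 // /P /Q; field; nz.
have def_h : U ^+ 2 - x1 ^+ 2 * V ^+ 2 = h.
  by rewrite /U /V; move: (h) => h'; field; nz.
have def_x2 : x2 = P + Q * x1 by rewrite /P /Q; field; nz.
have def_x3 : x3 = U + V * x1 by rewrite /U /V; move: (h) => h'; field; nz.
have gPQ v : v \in [:: P; Q; U; V] -> gen [:: x1; x2; x3] v.
  by rewrite !inE => /or4P[]/eqP->; rewrite /P /Q /U /V /h; in_gen.
clearbody P Q U V.
have gw : gen [:: P; Q; U; V] (x1 ^+ 2) by rewrite def_t; in_gen.
have HG := gen_sf iota [:: P; Q; U; V].
have ext v : v \in [:: x1; x2; x3] -> quad_ext (gen [:: P; Q; U; V]) x1 v.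
  rewrite !inE => /or3P[]/eqP->; first exact: quad_ext_root.
    by exists P, Q; split=> //; in_gen.
  by exists U, V; split=> //; in_gen.
have gfix v : gen [:: P; Q; U; V] v -> tau v = v.
  by apply: gen_fixed => // z; rewrite !inE => /or4P[]/eqP->.
exists P, Q, U, V; split=> //.
- move=> u; rewrite defL; split=> [[gu tu]|gu]; last first.
    by split; [apply: gen_sub gu | apply: gfix].
  apply: (quad_ext_fixed (s := tau) (w := x1) nz2 nzx1) => //.
  apply: (gu (quad_ext (gen [:: P; Q; U; V]) x1)) => [|k|v /ext //].
    exact: quad_ext_sf.
  by apply: quad_ext_sub => //; in_gen.
- by apply: spans_sub sp _ => v /ext/(quad_ext_cls gw).
- by rewrite /= -def_t def_h.
Qed.

(* A square root of [-1] makes the equation for [(U, V)] linear in [g]. *)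
Lemma twisted_conic_rational (L : F -> Prop) (i b : K) (la g X Y l0 l1 : F) :
    let mu := la ^+ 2 - iota b in
    let m1 := 1 - mu * g ^+ 2 in let m2 := 1 - la * g in
    i ^+ 2 = -1 -> g != 0 -> mu != 0 -> m1 != 0 -> m2 != 0 -> Y != 0 -> l1 != 0 ->
    gen [:: la] l0 -> gen [:: la] l1 ->
    X ^+ 2 - 4%:R * mu * m2 ^+ 2 / m1 * Y ^+ 2 = 16%:R * (l0 + l1 * g) / g ^+ 2 ->
    spans [:: la; g^-1; X; Y] -> (forall u, L u <-> gen [:: la; g^-1; X; Y] u) ->
  purely_transcendental iota L.
Proof.
move=> mu m1 m2 i2 nzg nzmu nzm1 nzm2 nzY nzl1 gl0 gl1 rel spG defLG.
have gl s u : gen [:: la] u -> gen (la :: s) u.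
  by apply: gen_sub => v; rewrite inE => /eqP->; in_gen.
have cl s u : gen [:: la] u -> cls (la :: s) u by move=> /(gl s); apply: cls_gen.
have nz4 : 4%:R != 0 :> F by rewrite (natrM _ 2 2) mulf_neq0.
have gmu s : gen (la :: s) mu by rewrite /mu; in_gen.
have cmu s : cls (la :: s) mu by rewrite /mu; in_cls.
have m1E : m1 = 1 - mu * g ^+ 2 by [].
have m2E : m2 = 1 - la * g by [].
clearbody mu m1 m2.
pose I := iota i.
have I2 : I ^+ 2 = -1 by rewrite -rmorphXn i2 rmorphN1.
have nzI : I != 0.
  apply/eqP => i0; move/eqP: I2.
  by rewrite i0 expr0n eq_sym oppr_eq0 oner_eq0.
have gI s : gen s I by apply: gen_const.
have cI s : cls s I by apply: cls_const.
clearbody I.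
(* Division by [Y^2] and rescaling give [U^2 + mu^2 g^2 = mu + (l0 + l1 g) V^2]. *)
pose e := 2%:R * g * m2 * Y; pose U := m1 * X * g / e; pose V := 4%:R * m1 / e.
have nze : e != 0 by rewrite /e !mulf_neq0.
have nzV : V != 0 by rewrite /V !mulf_neq0 ?invr_eq0.
have defY : Y = e / (2%:R * g * m2) by rewrite /e; field; nz.
have relU : U ^+ 2 + mu ^+ 2 * g ^+ 2 = mu + (l0 + l1 * g) * V ^+ 2.
  have -> : U ^+ 2 = (m1 * g / e) ^+ 2 * X ^+ 2 by rewrite /U; field; nz.
  have -> : X ^+ 2 = 16%:R * (l0 + l1 * g) / g ^+ 2 + 4%:R * mu * m2 ^+ 2 / m1 * Y ^+ 2.
    by rewrite -rel; ring.
  rewrite defY /V; move: (e) nze => e' nze'.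
  transitivity (mu * m1 + (l0 + l1 * g) * (4%:R * m1 / e') ^+ 2 + mu ^+ 2 * g ^+ 2).
    by field; nz.
  by rewrite m1E; ring.
have defX : X = U * e / (m1 * g) by rewrite /U; move: (e) nze => e' nze'; field; nz.
have defe : e = 4%:R * m1 / V by rewrite /V; move: (e) nze => e' nze'; field; nz.
have gUV : gen [:: la; g^-1; X; Y] U /\ gen [:: la; g^-1; X; Y] V.
  set s0 := [:: la; g^-1; X; Y].
  have gg : gen s0 (g^-1)^-1 by apply: (sfV (gen_sf _ _)); rewrite /s0; in_gen.
  rewrite invrK in gg.
  have gmu0 : gen s0 mu by apply: gmu.
  have gla : gen s0 la by rewrite /s0; in_gen.
  have gX : gen s0 X by rewrite /s0; in_gen.
  have gY : gen s0 Y by rewrite /s0; in_gen.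
  by split; rewrite /U /V /e m1E m2E; in_gen.
clearbody e; clearbody U V.
(* [J (J - 2 i mu g) = U^2 + mu^2 g^2] absorbs the square of [g]. *)
pose J := U + I * mu * g; pose den := 2%:R * I * mu * J + l1 * V ^+ 2.
have linear : J ^+ 2 - l0 * V ^+ 2 - mu = g * den.
  have e1 : J * (J - 2%:R * I * mu * g) = U ^+ 2 + mu ^+ 2 * g ^+ 2.
    transitivity (U ^+ 2 - I ^+ 2 * mu ^+ 2 * g ^+ 2); first by rewrite /J; ring.
    by rewrite I2; ring.
  apply/eqP; rewrite -subr_eq0; apply/eqP.
  transitivity (J * (J - 2%:R * I * mu * g) - (mu + (l0 + l1 * g) * V ^+ 2)).
    by rewrite /den; ring.
  by rewrite e1 relU subrr.
have defU : U = J - I * mu * g by rewrite /J; ring.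
(* Otherwise [J] would be a multiple of [V^2] and [V] a root of a quartic over [K(la)], so that [la]
   and [g] would span everything. *)
have nzden : den != 0.
  apply/eqP => den0; move: linear; rewrite den0 mulr0 => lin0.
  have defJ : J = - (l1 * V ^+ 2) / (2%:R * I * mu).
    have -> : l1 * V ^+ 2 = - (2%:R * I * mu * J) by apply/eqP; rewrite -addr_eq0 addrC -/den den0.
    by field; nz.
  have quartic : (l1 ^+ 2 * V ^+ 2 + 2%:R * mu ^+ 2 * l0) ^+ 2 =
      4%:R * mu ^+ 4 * l0 ^+ 2 - 4%:R * mu ^+ 3 * l1 ^+ 2.
    have J2 : J ^+ 2 = l0 * V ^+ 2 + mu.
      by apply/eqP; rewrite -subr_eq0 -[X in _ == X]lin0; apply/eqP; ring.
    have l1V : (l1 * V ^+ 2) ^+ 2 = - 4%:R * mu ^+ 2 * (l0 * V ^+ 2 + mu).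
      rewrite -J2 defJ; transitivity (I ^+ 2 * - 1 * (l1 * V ^+ 2) ^+ 2); first by rewrite I2; ring.
      have I2' : - 4%:R * mu ^+ 2 * (- (l1 * V ^+ 2) / (2%:R * I * mu)) ^+ 2 =
        - ((l1 * V ^+ 2) ^+ 2) / I ^+ 2 by field; nz.
      by rewrite I2' I2; field; rewrite oppr_eq0 oner_neq0.
    transitivity (l1 ^+ 2 * (l1 * V ^+ 2) ^+ 2 +
        4%:R * l1 ^+ 2 * V ^+ 2 * mu ^+ 2 * l0 + 4%:R * mu ^+ 4 * l0 ^+ 2); first by ring.
    by rewrite l1V; ring.
  have cl0 := cl [:: g] _ gl0; have cl1 := cl [:: g] _ gl1; have cmu0 := cmu [:: g].
  have cV : cls [:: la; g] V.
    apply: cls_sqrt.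
    have cq : cls [:: la; g] (l1 ^+ 2 * V ^+ 2 + 2%:R * mu ^+ 2 * l0).
      by apply: cls_sqrt; rewrite quartic; in_cls.
    have -> : V ^+ 2 = (l1 ^+ 2 * V ^+ 2 + 2%:R * mu ^+ 2 * l0 - 2%:R * mu ^+ 2 * l0) / l1 ^+ 2.
      by field; nz.
    move: cq; move: (_ + _ * l0) => q cq; in_cls.
  have cI0 := cI [:: la; g].
  have cJ : cls [:: la; g] J by rewrite defJ; in_cls.
  have cU : cls [:: la; g] U by rewrite defU; in_cls.
  have cm1 : cls [:: la; g] m1 by rewrite m1E; in_cls.
  have cm2 : cls [:: la; g] m2 by rewrite m2E; in_cls.
  have ce : cls [:: la; g] e by rewrite defe; in_cls.
  apply: (spans2 trX (u := la) (v := g)); apply: spans_sub spG _ => v.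
  by rewrite !inE => /or4P[]/eqP->; rewrite ?defX ?defY; in_cls.
have defg : g = (J ^+ 2 - l0 * V ^+ 2 - mu) / den by rewrite linear mulfK.
apply: (spans_purely_transcendental trX (z1 := la) (z2 := V) (z3 := J) defLG spG) => v.
  set s0 := [:: la; V; J].
  have l0' : gen s0 l0 by apply: gl.
  have l1' : gen s0 l1 by apply: gl.
  have mu' : gen s0 mu by apply: gmu.
  have I' : gen s0 I by apply: gI.
  have V' : gen s0 V by rewrite /s0; in_gen.
  have J' : gen s0 J by rewrite /s0; in_gen.
  have la' : gen s0 la by rewrite /s0; in_gen.
  have g' : gen s0 g by rewrite defg /den; in_gen.
  have m1' : gen s0 m1 by rewrite m1E; in_gen.
  have m2' : gen s0 m2 by rewrite m2E; in_gen.
  have e' : gen s0 e by rewrite defe; in_gen.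
  have U' : gen s0 U by rewrite defU; in_gen.
  by rewrite !inE => /or4P[]/eqP->; rewrite ?defX ?defY; in_gen.
have [gU gV] := gUV.
set s0 := [:: la; g^-1; X; Y] in gU gV *.
have gg : gen s0 (g^-1)^-1 by apply: (sfV (gen_sf _ _)); rewrite /s0; in_gen.
rewrite invrK in gg.
have mu' : gen s0 mu by apply: gmu.
have I' : gen s0 I by apply: gI.
have la' : gen s0 la by rewrite /s0; in_gen.
by rewrite !inE => /or3P[]/eqP->; rewrite /J; in_gen.
Qed.

(** * The dihedral action on [K(w, r, z)] *)

Section D4Tail.
Variables (s1 s2 : {rmorphism F -> F}) (w r z : F) (b : K).
Hypotheses (s1C : forall k, s1 (iota k) = iota k) (s2C : forall k, s2 (iota k) = iota k).
Hypothesis nzb : b != 0.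
Hypothesis s1w : s1 w = - iota b / w.
Hypothesis s1r : s1 r = iota b / r.
Hypothesis thw : s1 (s2 w) = - w.
Hypothesis thr : s1 (s2 r) = r.
Hypothesis sp : spans [:: w; r; z].
Variable L : F -> Prop.
Hypothesis defL : forall u, L u <-> s1 u = u /\ s2 u = u.
Hypothesis Lgen : forall u, L u -> gen [:: w; r; z] u.

Let th : {rmorphism F -> F} := s1 \o s2.
Let thC k : th (iota k) = iota k. Proof. by rewrite /th /= s2C s1C. Qed.
Let th2 : th 2%:R = 2%:R. Proof. exact: rmorph_nat. Qed.
Let s12 : s1 2%:R = 2%:R. Proof. exact: rmorph_nat. Qed.
Let nzB : iota b != 0. Proof. by rewrite fmorph_eq0. Qed.

Let ncw : ~ cls [:: r; z] w. Proof. exact: spans3_drop sp. Qed.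
Let ncr : ~ cls [:: w; z] r.
Proof.
apply: spans3_drop; apply: spans_perm sp => v; rewrite !inE.
by case/or3P=> ->; rewrite ?orbT.
Qed.
Let ncz : ~ cls [:: w; r] z.
Proof.
apply: spans3_drop; apply: spans_perm sp => v; rewrite !inE.
by case/or3P=> ->; rewrite ?orbT.
Qed.
Let nzw : w != 0. Proof. by apply: contra_notN ncw => /eqP->; in_cls. Qed.
Let nzr : r != 0. Proof. by apply: contra_notN ncr => /eqP->; in_cls. Qed.
Let nzz : z != 0. Proof. by apply: contra_notN ncz => /eqP->; in_cls. Qed.

Lemma D4_fixedP u : L u <-> s1 u = u /\ th u = u.
Proof.
rewrite defL; split=> -[e1 e2]; split=> //; first by rewrite /th /= e2.
by apply: (fmorph_inj s1); rewrite -[LHS]/(th u) e2 e1.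
Qed.

(** Quadratic step for [th], with [w] as anti-invariant; the identity [X^2 - w^2 (Y / r)^2 = g]
    recovers [w^2] from [X], [r], [Y]. *)
Lemma D4_step2 (al c : K) : al ^+ 2 = 1 -> s1 z = iota al * z ->
    s1 (s2 z) = iota (al * c) / z ->
  exists X Y, [/\ spans [:: X; r; Y],
    s1 X = iota al * X,
    s1 Y = - iota al * (X ^+ 2 - iota (al * c)) / Y &
    forall u, L u <-> gen [:: X; r; Y] u /\ s1 u = u].
Proof.
move=> al2 s1z; set g := iota (al * c) => thz.
have nzal : iota al != 0.
  rewrite fmorph_eq0; apply/eqP => al0; move/eqP: al2.
  by rewrite al0 expr0n eq_sym oner_eq0.
have nzg : g != 0.
  have : th z != 0 by rewrite fmorph_eq0.
  by rewrite /th /= thz mulf_eq0 negb_or => /andP[].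
have AL2 : iota al ^+ 2 = 1 by rewrite -rmorphXn al2 rmorph1.
have thg : th g = g by apply: thC.
have s1g : s1 g = g by apply: s1C.
have gg s : gen s g by apply: gen_const.
have cg s : cls s g by apply: cls_const.
clearbody g.
have thz' : th z = g / z := thz.
have thw' : th w = - w := thw.
have thr' : th r = r := thr.
have thz2 : th (g / z) = z by rewrite fmorph_div thg thz'; field; nz.
have s1z2 : s1 (g / z) = iota al * (g / z).
  rewrite fmorph_div s1g s1z -[LHS]mul1r -AL2.
  by field; nz.
(* The factor [r] is present because [s1] maps [r / w] to [- w / r], which makes [Y * s1 Y] a
   polynomial in [X]. *)
pose X := (z + g / z) / 2%:R; pose Y := (z - g / z) / (2%:R * w) * r.
have thX : th X = X by rewrite /X fmorph_div rmorphD thz2 thz' th2 addrC.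
have thY : th Y = Y.
  rewrite /Y rmorphM fmorph_div rmorphB rmorphM thz2 thz' thw' thr' th2.
  by field; nz.
have nzd : z ^+ 2 - g != 0.
  apply: contra_notN ncz; rewrite subr_eq0 => /eqP z2.
  by apply: cls_sqrt; rewrite z2; apply: cg.
have defY : Y = (z ^+ 2 - g) * r / (2%:R * w * z) by rewrite /Y; field; nz.
have nzY : Y != 0 by rewrite defY; nz.
have nzYr : Y / r != 0 by rewrite mulf_neq0 ?invr_eq0.
have def_w2 : w ^+ 2 = (X ^+ 2 - g) / (Y / r) ^+ 2.
  apply: (mulIf (expf_neq0 2 nzYr)); rewrite divfK ?expf_neq0 // /X /Y.
  by field; nz.
have def_z : z = X + Y / r * w by rewrite /X /Y; field; nz.
have s1X : s1 X = iota al * X.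
  by rewrite /X fmorph_div rmorphD s1z2 s1z s12; field; nz.
have s1Y : s1 Y = - iota al * (X ^+ 2 - g) / Y.
  apply: (mulIf nzY); rewrite divfK //.
  transitivity (- iota al * w ^+ 2 * (Y / r) ^+ 2); last first.
    by rewrite def_w2 -mulrA divfK ?expf_neq0.
  rewrite /Y rmorphM fmorph_div rmorphB rmorphM s1z2 s1z s1w s1r s12.
  by field; nz.
have nzXY : forall u, L u -> gen [:: X; r; Y] u.
  move=> u Lu; have [_ thu] := (D4_fixedP u).1 Lu.
  have gw : gen [:: X; r; Y] (w ^+ 2) by rewrite def_w2; have gg0 := gg [:: X; r; Y]; in_gen.
  have HG := gen_sf iota [:: X; r; Y].
  apply: (quad_ext_fixed (s := th) (w := w) nz2 nzw) => //.
    by apply: gen_fixed => // v; rewrite !inE => /or3P[]/eqP->.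
  apply: (Lgen Lu) => [|k|v].
  - exact: quad_ext_sf.
  - by apply: quad_ext_sub => //; in_gen.
  rewrite !inE => /or3P[]/eqP->; first exact: quad_ext_root.
    by apply: quad_ext_sub => //; in_gen.
  by exists X, (Y / r); split=> //; in_gen.
exists X, Y; split=> //.
- have cw : cls [:: X; r; Y] w by apply: cls_sqrt; rewrite def_w2; have cg0 := cg [:: X; r; Y]; in_cls.
  apply: spans_sub sp _ => v; rewrite !inE => /or3P[]/eqP-> //; first by in_cls.
  by rewrite def_z; in_cls.
move=> u; split=> [Lu|[gu s1u]].
  by split; [apply: nzXY | have [] := (D4_fixedP u).1 Lu].
apply/D4_fixedP; split=> //; apply: gen_fixed gu => // v.
by rewrite !inE => /or3P[]/eqP->.
Qed.

(** [s1] fixes [X] and inverts [r] and [Y] up to factors in [K(X)]. With the anti-invariant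
    [w3 = r - b / r], the invariants satisfy [y0^2 - w3^2 y1^2 = c - X^2] and [w3^2 = 4 r0^2 - 4 b].
    The part [y0^2 - 4 r0^2 y1^2] factors, which solves for [y0] and [r0]. *)
Lemma D4_alpha1 (c : K) : s1 z = z -> s1 (s2 z) = iota c / z ->
  purely_transcendental iota L.
Proof.
move=> s1z thz.
have [|||X [Y [spX s1X s1Y defLX]]] := @D4_step2 1 c; rewrite ?expr1n ?rmorph1 ?mul1r //.
rewrite rmorph1 !mul1r in s1X s1Y; rewrite mulN1r opprB in s1Y.
pose A := iota c - X ^+ 2; rewrite -/A in s1Y.
have ncX : ~ cls [:: r; Y] X by apply: spans3_drop spX.
have ncY : ~ cls [:: X; r] Y.
  apply: spans3_drop; apply: spans_perm spX => v; rewrite !inE.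
  by case/or3P=> ->; rewrite ?orbT.
have ncr' : ~ cls [:: X; Y] r.
  apply: spans3_drop; apply: spans_perm spX => v; rewrite !inE.
  by case/or3P=> ->; rewrite ?orbT.
have nzY : Y != 0 by apply: contra_notN ncY => /eqP->; in_cls.
have nzdr : r ^+ 2 - iota b != 0.
  apply: contra_notN ncr'; rewrite subr_eq0 => /eqP r2.
  by apply: cls_sqrt; rewrite r2; in_cls.
have nzdY : Y ^+ 2 - A != 0.
  apply: contra_notN ncY; rewrite subr_eq0 => /eqP Y2.
  by apply: cls_sqrt; rewrite Y2 /A; in_cls.
have cA : cls [:: X; r] A by rewrite /A; in_cls.
have s1A : s1 A = A by rewrite /A rmorphB rmorphXn s1C s1X.
have nzA : A != 0.
  have : s1 Y != 0 by rewrite fmorph_eq0.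
  by rewrite s1Y mulf_eq0 negb_or => /andP[].
have s1Y2 : s1 (A / Y) = Y by rewrite fmorph_div s1A s1Y; field; nz.
have s1r2 : s1 (iota b / r) = r by rewrite fmorph_div s1C s1r; field; nz.
pose r0 := (r + iota b / r) / 2%:R; pose w3 := r - iota b / r.
pose y0 := (Y + A / Y) / 2%:R; pose y1 := (Y - A / Y) / (2%:R * w3).
have def_w3 : w3 = (r ^+ 2 - iota b) / r by rewrite /w3; field; nz.
have nzw3 : w3 != 0 by rewrite def_w3; nz.
have s1w3 : s1 w3 = - w3 by rewrite /w3 rmorphB s1r2 s1r opprB.
have s1r0 : s1 r0 = r0 by rewrite /r0 fmorph_div rmorphD s1r2 s1r s12 addrC.
have s1y0 : s1 y0 = y0 by rewrite /y0 fmorph_div rmorphD s1Y2 s1Y s12 addrC.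
have s1y1 : s1 y1 = y1.
  rewrite /y1 fmorph_div rmorphB rmorphM s1Y2 s1Y s1w3 s12.
  by move: (w3) nzw3 (A) => w3' nzw3' A'; field; nz.
have w32 : w3 ^+ 2 = 4%:R * r0 ^+ 2 - 4%:R * iota b by rewrite /w3 /r0; field; nz.
have def_r : r = r0 + w3 / 2%:R by rewrite /r0 /w3; field; nz.
have def_Y : Y = y0 + y1 * w3.
  by rewrite /y0 /y1; move: (w3) nzw3 (A) => w3' nzw3' A'; field; nz.
have nzy1 : y1 != 0.
  have -> : y1 = (Y ^+ 2 - A) / (2%:R * w3 * Y).
    by rewrite /y1; move: (w3) nzw3 (A) => w3' nzw3' A'; field; nz.
  by nz.
have rel : y0 ^+ 2 - y1 ^+ 2 * w3 ^+ 2 = A.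
  by rewrite /y0 /y1; move: (w3) nzw3 (A) => w3' nzw3' A'; field; nz.
have g0 v : v \in [:: r0; y0; y1] -> gen [:: X; r; Y] v.
  by rewrite !inE => /or3P[]/eqP->; rewrite /r0 /y0 /y1 /w3 /A; in_gen.
clearbody r0 w3 y0 y1.
pose z2 := y0 + 2%:R * y1 * r0.
have rel2 : (y0 - 2%:R * y1 * r0) * z2 = A - 4%:R * iota b * y1 ^+ 2.
  transitivity (y0 ^+ 2 - y1 ^+ 2 * w3 ^+ 2 - 4%:R * iota b * y1 ^+ 2).
    by rewrite w32 /z2; ring.
  by rewrite rel.
have nz4 : 4%:R != 0 :> F by rewrite (natrM _ 2 2) mulf_neq0.
have nzz2 : z2 != 0.
  apply/eqP => z20; move: rel2; rewrite z20 mulr0 => /esym/eqP.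
  rewrite subr_eq0 => /eqP defA.
  have cy1 : cls [:: X; r0] y1.
    apply: cls_sqrt; have -> : y1 ^+ 2 = A / (4%:R * iota b) by rewrite defA; field; nz.
    by rewrite /A; in_cls.
  have cy0 : cls [:: X; r0] y0.
    by move/eqP: z20; rewrite addr_eq0 => /eqP->; in_cls.
  have cw3 : cls [:: X; r0] w3 by apply: cls_sqrt; rewrite w32; in_cls.
  apply: (spans2 trX (u := X) (v := r0)); apply: spans_sub spX _ => v.
  by rewrite !inE => /or3P[]/eqP->; rewrite ?def_r ?def_Y; in_cls.
pose z3 := (A - 4%:R * iota b * y1 ^+ 2) / z2.
have def_z3 : z3 = y0 - 2%:R * y1 * r0 by rewrite /z3 -rel2 mulfK.
have gz3 : gen [:: X; y1; z2] z3 by rewrite /z3 /A; in_gen.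
have gy0 : gen [:: X; y1; z2] y0.
  have -> : y0 = (z2 + z3) / 2%:R by rewrite def_z3 /z2; field; nz.
  by in_gen.
have gr0 : gen [:: X; y1; z2] r0.
  have -> : r0 = (z2 - z3) / (4%:R * y1) by rewrite def_z3 /z2; field; nz.
  by in_gen.
have gw3 : gen [:: X; y1; z2] (w3 ^+ 2) by rewrite w32; in_gen.
have HG := gen_sf iota [:: X; y1; z2].
have ext v : v \in [:: X; r; Y] -> quad_ext (gen [:: X; y1; z2]) w3 v.
  rewrite !inE => /or3P[]/eqP->.
  - by apply: quad_ext_sub => //; in_gen.
  - by exists r0, 2%:R^-1; split; [in_gen | in_gen | rewrite def_r mulrC].
  - by exists y0, y1; split=> //; in_gen.
have s1z2' : s1 z2 = z2 by rewrite /z2 rmorphD !rmorphM s1y0 s1y1 s1r0 s12.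
have gz v : v \in [:: X; y1; z2] -> gen [:: X; r; Y] v.
  have gr0' : gen [:: X; r; Y] r0 by apply: g0; rewrite !inE eqxx.
  have gy0' : gen [:: X; r; Y] y0 by apply: g0; rewrite !inE eqxx orbT.
  have gy1' : gen [:: X; r; Y] y1 by apply: g0; rewrite !inE eqxx !orbT.
  by rewrite !inE => /or3P[]/eqP->; rewrite /z2; in_gen.
apply: (@spans_purely_transcendental K F iota X1 X2 X3 trX L [:: X; y1; z2] X y1 z2).
- move=> u; rewrite defLX; split=> [[gu s1u]|gu].
    apply: (quad_ext_fixed (s := s1) (w := w3) nz2 nzw3) => //.
      by apply: gen_fixed => // v; rewrite !inE => /or3P[]/eqP->.
    apply: (gu (quad_ext (gen [:: X; y1; z2]) w3)) => [|k|v /ext //].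
      exact: quad_ext_sf.
    by apply: quad_ext_sub => //; in_gen.
  split; first by apply: gen_sub gu.
  by apply: gen_fixed gu => // v; rewrite !inE => /or3P[]/eqP->.
- by apply: spans_sub spX _ => v /ext/(quad_ext_cls gw3).
- by move=> v; apply: gen_mem.
- by move=> v; apply: gen_mem.
Qed.

(** After [D4_step2] the involution [s1] has the shape of the non-rationality criterion, with
    [k = 1] and [d^2 = - c / b]. The classes [b], [-1], [-b] and their products with [- c / b] are
    the six listed. *)
Lemma D4_alphaN1 (c : K) : c != 0 -> s1 z = - z -> s1 (s2 z) = - iota c / z ->
    (infinite K -> forall dl : K, dl != 0 -> ~ nonzero_square dl ->
       forall u : F, u ^+ 2 != iota dl) ->
  purely_transcendental iota L <->
  [\/ nonzero_square (-1 : K) \/ nonzero_square b, nonzero_square (- b)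
    , nonzero_square c \/ nonzero_square (- c) | nonzero_square (b * c)].
Proof.
move=> nzc s1z thz nsqF.
have [|||X [Y [spX s1X s1Y defLX]]] := @D4_step2 (-1) c.
- by rewrite sqrrN expr1n.
- by rewrite rmorphN1 mulN1r.
- by rewrite mulN1r rmorphN.
rewrite rmorphN1 mulN1r in s1X; rewrite mulN1r !rmorphN rmorph1 !opprK mul1r in s1Y.
have nz2K : 2%:R != 0 :> K by rewrite -(fmorph_eq0 iota) rmorph_nat.
split.
  have nzdl : - c / b != 0 by rewrite mulf_neq0 ?oppr_eq0 ?invr_eq0.
  have s1Y' : s1 Y = iota 1 * (X ^+ 2 - iota (b * (- c / b))) / Y.
    have -> : b * (- c / b) = - c by field.
    by rewrite rmorph1 mul1r rmorphN opprK.
  (* The negated conclusion makes [K] infinite, so that [- c / b], if not a square in [K], is none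
     in [F]. *)
  move=> ptL; apply: NNPP => none.
  have infK : infinite K.
    apply: (@three_nonsquares_infinite K b (-1)); rewrite ?oppr_eq0 ?oner_neq0 //.
    - by apply: contra_not none => H; constructor 1; right.
    - by apply: contra_not none => H; constructor 1; left.
    - by rewrite mulrN1; apply: contra_not none => H; constructor 2.
  apply: none.
  have [zz] := purely_transcendental_square_classes nz2K nzb (oner_neq0 _) nzdl
    (nsqF infK _ nzdl) (spans3 trX spX) s1C s1X s1r s1Y' defLX ptL.
  have sq_mul u v : nonzero_square u -> v != 0 -> nonzero_square (u * v ^+ 2).
    by case=> e nze -> nzv; exists (e * v); rewrite ?mulf_neq0 // exprMn.
  rewrite !inE => /or3P[]/eqP-> [] Hz.
  - by constructor 1; right.
  - constructor 3; right; suff -> : - c = b * (- c / b) by [].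
    by field.
  - by constructor 1; left.
  - constructor 4; suff -> : b * c = -1 * (- c / b) * b ^+ 2 by apply: sq_mul.
    by field.
  - by constructor 2; move: Hz; rewrite mulrN1.
  - constructor 3; left; suff -> : c = b * -1 * (- c / b) by [].
    by field.
have s1Y1 : s1 Y = (iota 1 * X ^+ 2 + iota c) / Y by rewrite rmorph1 mul1r.
have [P [Q [U [V [nzQ defLP spP rel]]]]] := two_conics_model s1C spX s1X s1r s1Y1 defLX nzb.
have gl v : v \in [:: P; Q; U; V] -> gen [:: V / Q; Q^-1; U; P] v.
  set l := [:: V / Q; Q^-1; U; P].
  have gQ : gen l (Q^-1)^-1 by apply: (sfV (gen_sf _ _)); rewrite /l; in_gen.
  rewrite invrK in gQ; have gVQ : gen l (V / Q) by rewrite /l; in_gen.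
  have gV : gen l (V / Q * Q) by apply: (sfM (gen_sf _ _)).
  by rewrite divfK // in gV; rewrite !inE => /or4P[]/eqP->; rewrite // /l; in_gen.
move=> sq; apply: (@two_conics_rational K F iota X1 X2 X3 nz2 trX L (V / Q) (Q^-1) U P (- b) (- c)).
- move=> u; rewrite defLP; split; apply: gen_sub => v; first exact: gl.
  by rewrite !inE => /or4P[]/eqP->; in_gen.
- by apply: spans_sub spP _ => v /gl; apply: cls_gen.
- rewrite !rmorphN; move: rel => /=; rewrite rmorph1 mul1r => rel.
  transitivity ((P ^+ 2 - iota b) / Q ^+ 2 * V ^+ 2 + (P ^+ 2 - iota b) / Q ^+ 2); first by field.
  have -> : U ^+ 2 = (P ^+ 2 - iota b) / Q ^+ 2 * V ^+ 2 + ((P ^+ 2 - iota b) / Q ^+ 2 + iota c).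
    by rewrite -rel; ring.
  by ring.
- by rewrite oppr_eq0.
rewrite !opprK mulrNN; case: sq => [[]|||] H.
- by constructor 1; left.
- by constructor 2.
- by constructor 1; right.
- by constructor 3; case: H; [right|left].
- by constructor 4.
Qed.

(** [f] is the Cayley transform of [w^2 / r^2], which [s1] inverts, so [s1 f = - f]; and [g1],
    [1 / g] are the invariant coordinates in [r = g1 + f / g]. As [w - b / w] is fixed by [s1] and
    negated by [th], writing [z = X + Y (w - b / w)] adds a conic over [K(g1, g)]. *)
Lemma D4_alphaI (i : K) (C l0 l1 : F) :
    let g1 := (r + iota b / r) / 2%:R in
    let f := (r ^+ 2 - w ^+ 2) / (r ^+ 2 + w ^+ 2) in
    let g := 2%:R * f / (r - iota b / r) in
    i ^+ 2 = -1 -> s1 z = z -> s1 (s2 z) = C / z ->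
    gen [:: g1] l0 -> gen [:: g1] l1 -> l1 != 0 -> C * g ^+ 2 = 16%:R * (l0 + l1 * g) ->
  purely_transcendental iota L.
Proof.
move=> g1 f g i2 s1z thz gl0 gl1 nzl1 defC.
have nzdr : r ^+ 2 - iota b != 0.
  apply: contra_notN ncr; rewrite subr_eq0 => /eqP e; apply: cls_sqrt; rewrite e; in_cls.
have nzdw : w ^+ 2 - iota b != 0.
  apply: contra_notN ncw; rewrite subr_eq0 => /eqP e; apply: cls_sqrt; rewrite e; in_cls.
have nzrw : r ^+ 2 - w ^+ 2 != 0.
  apply: contra_notN ncr; rewrite subr_eq0 => /eqP e; apply: cls_sqrt; rewrite e; in_cls.
have nzrw' : r ^+ 2 + w ^+ 2 != 0.
  apply: contra_notN ncr; rewrite addr_eq0 => /eqP e; apply: cls_sqrt; rewrite e; in_cls.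
have thw' : th w = - w := thw.
have thr' : th r = r := thr.
pose wm := w - iota b / w; pose rm := r - iota b / r.
have def_wm : wm = (w ^+ 2 - iota b) / w by rewrite /wm; field; nz.
have nzwm : wm != 0 by rewrite def_wm; nz.
have def_rm : rm = (r ^+ 2 - iota b) / r by rewrite /rm; field; nz.
have nzrm : rm != 0 by rewrite def_rm; nz.
have s1wm : s1 wm = wm by rewrite /wm rmorphB fmorph_div s1C s1w; field; nz.
have thwm : th wm = - wm by rewrite /wm rmorphB fmorph_div thC thw'; field; nz.
have s1rm : s1 rm = - rm by rewrite /rm rmorphB fmorph_div s1C s1r; field; nz.
have thrm : th rm = rm by rewrite /rm rmorphB fmorph_div thC thr'.
have s1f : s1 f = - f.
  rewrite /f fmorph_div rmorphB rmorphD !rmorphXn s1w s1r.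
  have e1 : (iota b / r) ^+ 2 - (- iota b / w) ^+ 2 = - iota b ^+ 2 * (r ^+ 2 - w ^+ 2) / (r ^+ 2 * w ^+ 2).
    by field; nz.
  have e2 : (iota b / r) ^+ 2 + (- iota b / w) ^+ 2 = iota b ^+ 2 * (r ^+ 2 + w ^+ 2) / (r ^+ 2 * w ^+ 2).
    by field; nz.
  by rewrite e1 e2; field; nz.
have thf : th f = f by rewrite /f fmorph_div rmorphB rmorphD !rmorphXn thw' thr' sqrrN.
have nzf : f != 0 by rewrite /f; nz.
have s1g1 : s1 g1 = g1 by rewrite /g1 fmorph_div rmorphD fmorph_div s1C s1r s12; field; nz.
have thg1 : th g1 = g1 by rewrite /g1 fmorph_div rmorphD fmorph_div thC thr' th2.
have defg : g = 2%:R * f / rm by [].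
have s1g : s1 g = g by rewrite defg fmorph_div rmorphM s1f s1rm s12; field; nz.
have thg : th g = g by rewrite defg fmorph_div rmorphM thf thrm th2.
have nzg : g != 0 by rewrite defg !mulf_neq0 ?invr_eq0.
have s1l u : gen [:: g1] u -> s1 u = u.
  by apply: gen_fixed => // v; rewrite inE => /eqP->.
have thl u : gen [:: g1] u -> th u = u.
  by apply: gen_fixed => // v; rewrite inE => /eqP->.
have nat16 (s : {rmorphism F -> F}) : s 16%:R = 16%:R by apply: rmorph_nat.
have defC' : C = 16%:R * (l0 + l1 * g) / g ^+ 2 by rewrite -defC mulfK ?expf_neq0.
have s1Cc : s1 C = C.
  apply: (mulIf (expf_neq0 2 nzg)); rewrite defC.
  transitivity (s1 (C * g ^+ 2)); first by rewrite rmorphM [s1 (g ^+ 2)]rmorphXn s1g.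
  by rewrite defC rmorphM nat16 rmorphD [s1 (l1 * g)]rmorphM s1g !s1l.
have thCc : th C = C.
  apply: (mulIf (expf_neq0 2 nzg)); rewrite defC.
  transitivity (th (C * g ^+ 2)); first by rewrite rmorphM [th (g ^+ 2)]rmorphXn thg.
  by rewrite defC rmorphM nat16 rmorphD [th (l1 * g)]rmorphM thg !thl.
have thz' : th z = C / z := thz.
have nzC : C != 0.
  have : th z != 0 by rewrite fmorph_eq0.
  by rewrite thz' mulf_eq0 negb_or => /andP[].
have thz2 : th (C / z) = z by rewrite fmorph_div thCc thz'; field; nz.
have cg1 : cls [:: w; r] g1 by rewrite /g1; in_cls.
have cg : cls [:: w; r] g by rewrite /g /f; in_cls.
have cl u : gen [:: g1] u -> cls [:: w; r] u.
  move=> /(cls_gen (s := [:: g1])); apply: cls_sub => v.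
  by rewrite inE => /eqP->.
have nzd : z ^+ 2 - C != 0.
  apply: contra_notN ncz; rewrite subr_eq0 => /eqP z2; apply: cls_sqrt; rewrite z2 defC'.
  by have cl0 := cl _ gl0; have cl1 := cl _ gl1; in_cls.
pose X := (z + C / z) / 2%:R; pose Y := (z - C / z) / (2%:R * wm).
have s1X : s1 X = X by rewrite /X fmorph_div rmorphD fmorph_div s1Cc s1z s12.
have s1Y : s1 Y = Y by rewrite /Y fmorph_div rmorphB rmorphM fmorph_div s1Cc s1z s12 s1wm.
have thX : th X = X by rewrite /X fmorph_div rmorphD thz2 thz' th2 addrC.
have thY : th Y = Y.
  rewrite /Y fmorph_div rmorphB rmorphM thz2 thz' th2 thwm.
  by move: (wm) nzwm => wm' nzwm'; field; nz.
have relX : X ^+ 2 - wm ^+ 2 * Y ^+ 2 = C.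
  by rewrite /X /Y; move: (wm) nzwm => wm' nzwm'; field; nz.
have def_z : z = X + Y * wm.
  by rewrite /X /Y; move: (wm) nzwm => wm' nzwm'; field; nz.
have nzY : Y != 0.
  have -> : Y = (z ^+ 2 - C) / (2%:R * wm * z).
    by rewrite /Y; move: (wm) nzwm => wm' nzwm'; field; nz.
  by rewrite !mulf_neq0 ?invr_eq0 ?mulf_neq0.
clearbody X Y.
pose g2 := g^-1.
have def_r : r = g1 + g2 * f.
  rewrite /g2 defg; have e : (2%:R * f / rm)^-1 * f = rm / 2%:R.
    by move: (f) nzf (rm) nzrm => f' nzf' rm' nzrm'; field; nz.
  by rewrite e /g1 /rm; field; nz.
pose mu := g1 ^+ 2 - iota b.
have def_mu : mu = (rm / 2%:R) ^+ 2 by rewrite /mu /g1 /rm; field; nz.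
have nzmu : mu != 0 by rewrite def_mu expf_neq0 // mulf_neq0 ?invr_eq0.
have f2 : f ^+ 2 = mu * g ^+ 2.
  by rewrite def_mu defg; move: (f) (rm) nzrm => f' rm' nzrm'; field; nz.
have nz1pf : 1 + f != 0.
  have -> : 1 + f = 2%:R * r ^+ 2 / (r ^+ 2 + w ^+ 2) by rewrite /f; field; nz.
  by nz.
have nz1mf : 1 - f != 0.
  have -> : 1 - f = 2%:R * w ^+ 2 / (r ^+ 2 + w ^+ 2) by rewrite /f; field; nz.
  by nz.
have def_T : w ^+ 2 = r ^+ 2 * (1 - f) / (1 + f).
  have -> : 1 - f = 2%:R * w ^+ 2 / (r ^+ 2 + w ^+ 2) by rewrite /f; field; nz.
  have -> : 1 + f = 2%:R * r ^+ 2 / (r ^+ 2 + w ^+ 2) by rewrite /f; field; nz.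
  by field; nz.
have Tb : w ^+ 2 - iota b = 2%:R * r * f * (g2 - g1) / (1 + f).
  apply: (mulIf nz1pf); rewrite divfK // mulrBl.
  have -> : w ^+ 2 * (1 + f) = r ^+ 2 * (1 - f) by rewrite def_T divfK.
  have e1 : g2 * f = rm / 2%:R.
    by rewrite /g2 defg; move: (f) nzf (rm) nzrm => f' nzf' rm' nzrm'; field; nz.
  transitivity (2%:R * r * (g2 * f) - 2%:R * r * f * g1); last by ring.
  by rewrite e1 /rm /g1; move: (f) => f'; field; nz.
pose m1 := 1 - mu * g ^+ 2; pose m2 := 1 - g1 * g.
have nzm1 : m1 != 0.
  by rewrite /m1 -f2; have -> : 1 - f ^+ 2 = (1 - f) * (1 + f) by [ring|]; rewrite mulf_neq0.
have m2E : g2 - g1 = m2 / g.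
  by rewrite /g2 /m2; move: (g) nzg => g' nzg'; field.
have nzm2 : m2 != 0.
  by apply: contraNneq nzdw => m20; rewrite Tb m2E m20 mul0r mulr0 mul0r.
have wm2 : wm ^+ 2 = 4%:R * mu * m2 ^+ 2 / m1.
  have -> : wm ^+ 2 = (w ^+ 2 - iota b) ^+ 2 / w ^+ 2 by rewrite def_wm expr_div_n.
  rewrite Tb def_T m2E.
  have -> : m1 = (1 - f) * (1 + f) by rewrite /m1 -f2; ring.
  have -> : mu = f ^+ 2 / g ^+ 2 by rewrite f2 mulfK ?expf_neq0.
  move: (f) nz1pf nz1mf (g) nzg (m2) => f' nz1' nz2' g' nzg' m2'.
  by field; nz.
have HI : iota i ^+ 2 = -1 by rewrite -rmorphXn i2 rmorphN1.
have nzI : iota i != 0.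
  apply/eqP => i0; move/eqP: HI.
  by rewrite i0 expr0n eq_sym oppr_eq0 oner_eq0.
(* Two quadratic steps: [w] is anti-invariant for [th], then [f] for [s1]. *)
have [spG defLG] : spans [:: g1; g2; X; Y] /\ forall u, L u <-> gen [:: g1; g2; X; Y] u.
  set s3 := [:: g1; g2; X; Y]; have HG3 := gen_sf iota s3.
  have gf2 : gen s3 (f ^+ 2).
    have -> : f ^+ 2 = mu / g2 ^+ 2 by rewrite f2 /g2 exprVn invrK.
    by rewrite /mu /s3; in_gen.
  have HE3 := quad_ext_sf HG3 gf2; have Ef := quad_ext_root HG3 f.
  have E3 v : v \in s3 -> quad_ext (gen s3) f v.
    by move=> sv; apply: quad_ext_sub => //; apply: gen_mem.
  have Er : quad_ext (gen s3) f r.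
    by rewrite def_r; apply: (sfD HE3); [|apply: (sfM HE3) => //]; apply: E3; rewrite !inE eqxx ?orbT.
  have ET : quad_ext (gen s3) f (w ^+ 2).
    rewrite def_T; have E1 := sf1 HE3; in_sf HE3.
  have E2 v : v \in [:: r; w ^+ 2; X; Y] -> quad_ext (gen s3) f v.
    by rewrite !inE => /or4P[]/eqP-> //; apply: E3; rewrite !inE eqxx ?orbT.
  set s2' := [:: r; w ^+ 2; X; Y]; have HG2 := gen_sf iota s2'.
  have gw2 : gen s2' (w ^+ 2) by rewrite /s2'; in_gen.
  have gX2 : gen s2' X by rewrite /s2'; in_gen.
  have gY2 : gen s2' (Y * (1 - iota b / w ^+ 2)) by rewrite /s2'; in_gen.
  have E1 v : v \in [:: w; r; z] -> quad_ext (gen s2') w v.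
    rewrite !inE => /or3P[]/eqP->; first exact: quad_ext_root.
      by apply: quad_ext_sub => //; rewrite /s2'; in_gen.
    exists X, (Y * (1 - iota b / w ^+ 2)); split=> //.
    by rewrite def_z /wm; field; nz.
  have g23 u : gen s2' u -> quad_ext (gen s3) f u.
    by move=> gu; apply: (gu _ HE3) => // k; apply: quad_ext_sub => //; in_gen.
  have fix3 u : gen s3 u -> s1 u = u.
    apply: gen_fixed => // v; rewrite !inE => /or4P[]/eqP-> //.
    by rewrite /g2 fmorphV s1g.
  have fix3' u : gen s3 u -> th u = u.
    apply: gen_fixed => // v; rewrite !inE => /or4P[]/eqP-> //.
    by rewrite /g2 fmorphV thg.
  split.
    apply: spans_sub sp _ => v /E1.
    have cT : cls s3 (w ^+ 2) by apply: quad_ext_cls ET.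
    have cw := cls_sqrt cT.
    have c2 u : gen s2' u -> cls s3 u by move=> /g23; apply: quad_ext_cls.
    move=> [A [B [/c2 cA /c2 cB ->]]].
    by apply: (sfD (cls_sf _ _)) => //; apply: (sfM (cls_sf _ _)).
  move=> u; split=> [Lu|gu]; last by apply/D4_fixedP; split; [apply: fix3 | apply: fix3'].
  have [s1u thu] := (D4_fixedP u).1 Lu.
  apply: (quad_ext_fixed (s := s1) (w := f) nz2 nzf) => //.
  apply: g23; apply: (quad_ext_fixed (s := th) (w := w) nz2 nzw) => //.
    apply: gen_fixed => // v; rewrite !inE => /or4P[]/eqP-> //.
    by rewrite rmorphXn thw' sqrrN.
  apply: (Lgen Lu) => [|k|v /E1 //]; first exact: quad_ext_sf.
  by apply: quad_ext_sub => //; in_gen.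
have rel : X ^+ 2 - 4%:R * mu * m2 ^+ 2 / m1 * Y ^+ 2 = 16%:R * (l0 + l1 * g) / g ^+ 2.
  by rewrite -wm2 relX defC'.
exact: (twisted_conic_rational i2 nzg nzmu nzm1 nzm2 nzY nzl1 gl0 gl1 rel spG defLG).
Qed.

End D4Tail.
End FixedFields.

(** * The two group actions *)

(** The left side arises as the norm of [B1 - alpha B2] when [alpha^2 = -1]; it is needed in terms
    of [w] and [r]. *)
Lemma two_squares_center (F : fieldType) (x1 x2 a : F) :
    x1 != 0 -> x2 != 0 -> x1 - x2 != 0 -> x1 + x2 != 0 ->
    x1 ^+ 2 - a != 0 -> x2 ^+ 2 - a != 0 -> 2%:R != 0 :> F ->
  let w := (x1 * x2 - a) / (x1 - x2) in let r := (x1 * x2 + a) / (x1 + x2) in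
  (x1 - a / x1) ^+ 2 + (x2 - a / x2) ^+ 2 =
  8%:R * (w ^+ 2 + r ^+ 2) * (r ^+ 2 - a) * (w ^+ 2 - a) / (w ^+ 2 - r ^+ 2) ^+ 2.
Proof.
move=> n1 n2 nm np na1 na2 nz2 w r.
have dwr : w ^+ 2 - r ^+ 2 = 4%:R * x1 * x2 * (x1 ^+ 2 - a) * (x2 ^+ 2 - a) /
    ((x1 - x2) ^+ 2 * (x1 + x2) ^+ 2) by rewrite /w /r; field; nz.
have nz4 : 4%:R != 0 :> F by rewrite (natrM _ 2 2) mulf_neq0.
rewrite dwr /w /r; field; nz.
Qed.

(** Brings the constant of the conic to the form required by [D4_alphaI], with [l0 = c] and
    [l1 = - c g1]. *)
Lemma norm_constant_eps1 (F : fieldType) (w r B c : F) :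
    r != 0 -> r ^+ 2 - w ^+ 2 != 0 -> r ^+ 2 + w ^+ 2 != 0 -> r ^+ 2 - B != 0 ->
    2%:R != 0 :> F ->
  let g1 := (r + B / r) / 2%:R in
  let g := 2%:R * ((r ^+ 2 - w ^+ 2) / (r ^+ 2 + w ^+ 2)) / (r - B / r) in
  8%:R * c * (w ^+ 2 + r ^+ 2) * (r ^+ 2 - B) * (w ^+ 2 - B) / (w ^+ 2 - r ^+ 2) ^+ 2 * g ^+ 2
    = 16%:R * (c + (- c * g1) * g).
Proof.
move=> nr nm np nb nz2 g1 g.
have -> : (w ^+ 2 - r ^+ 2) ^+ 2 = (r ^+ 2 - w ^+ 2) ^+ 2 by ring.
have defg : g = 2%:R * (r ^+ 2 - w ^+ 2) * r / ((r ^+ 2 + w ^+ 2) * (r ^+ 2 - B)).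
  have e : r - B / r = (r ^+ 2 - B) / r by field.
  by rewrite /g e; field; nz.
by rewrite defg /g1; field; nz.
Qed.

(** For [eps = -1] the roles of [w] and [r] are exchanged and [B] stands for [- a], which puts [mu]
    into the denominator of [l0]. *)
Lemma norm_constant_epsN1 (F : fieldType) (w r B c : F) :
    r != 0 -> r ^+ 2 - w ^+ 2 != 0 -> r ^+ 2 + w ^+ 2 != 0 -> r ^+ 2 - B != 0 ->
    2%:R != 0 :> F ->
  let g1 := (r + B / r) / 2%:R in let mu := g1 ^+ 2 - B in
  let g := 2%:R * ((r ^+ 2 - w ^+ 2) / (r ^+ 2 + w ^+ 2)) / (r - B / r) in
  - 8%:R * c * (w ^+ 2 + r ^+ 2) * (r ^+ 2 + B) * (w ^+ 2 + B) / (w ^+ 2 - r ^+ 2) ^+ 2 * g ^+ 2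
    = 16%:R * (- c * g1 ^+ 2 / mu + c * g1 * g).
Proof.
move=> nr nm np nb nz2 g1 mu g.
have -> : (w ^+ 2 - r ^+ 2) ^+ 2 = (r ^+ 2 - w ^+ 2) ^+ 2 by ring.
have defg : g = 2%:R * (r ^+ 2 - w ^+ 2) * r / ((r ^+ 2 + w ^+ 2) * (r ^+ 2 - B)).
  have e : r - B / r = (r ^+ 2 - B) / r by field.
  by rewrite /g e; field; nz.
have defmu : mu = (r ^+ 2 - B) ^+ 2 / (2%:R * r) ^+ 2 by rewrite /mu /g1; field; nz.
by rewrite defg defmu /g1; field; nz.
Qed.

Section Actions.
Variables (K F : fieldType) (iota : {rmorphism K -> F}) (x1 x2 x3 : F).
Hypothesis nz2 : 2%:R != 0 :> F.
Hypothesis trx : trdeg3 iota x1 x2 x3.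
Hypothesis genx : forall u, gen iota [:: x1; x2; x3] u.

Notation gen := (gen iota).
Notation cls := (cls iota).
Notation spans := (spans iota x1 x2 x3).

Let spx : spans [:: x1; x2; x3].
Proof. by split; in_cls. Qed.

(** Specialization of a norm with [k = 0]: a square root of a constant specializes to one in [K]. *)
Lemma infinite_nonsquare : infinite K -> forall dl : K, dl != 0 -> ~ nonzero_square dl ->
  forall u : F, u ^+ 2 != iota dl.
Proof.
move=> infK dl nzdl nsq u; apply/eqP => u2.
have [||g0 [h0]] :=
  @infinite_specialize_norm K F iota [:: x1; x2; x3] dl 0 u 0 infK trx (genx u).
- by apply: genx.
- by rewrite rmorph0 mul0r addr0.
rewrite mul0r addr0 => def_dl; apply: nsq; exists g0 => //.
by apply: contraNneq nzdl => g00; rewrite def_dl g00 expr0n.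
Qed.

(** The criterion applies with [-1] as its [b] and [b] as its [k], again with [d^2 = - c / b]; the
    six classes come out as for [D4_alphaN1], in another order. *)
Lemma tau_rational_iff (tau : {rmorphism F -> F}) (L : F -> Prop) (b c : K) :
    (forall k, tau (iota k) = iota k) -> b != 0 -> c != 0 ->
    tau x1 = - x1 -> tau x2 = -1 / x2 ->
    tau x3 = (iota b * x1 ^+ 2 - iota c) / x3 ->
    (forall u, L u <-> tau u = u) ->
  purely_transcendental iota L <->
  [\/ nonzero_square (-1 : K) \/ nonzero_square b, nonzero_square (- b)
    , nonzero_square c \/ nonzero_square (- c) | nonzero_square (b * c)].
Proof.
move=> tauC nzb nzc t1 t2 t3 defL.
have nz2K : 2%:R != 0 :> K by rewrite -(fmorph_eq0 iota) rmorph_nat.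
have nzN1 : -1 != 0 :> K by rewrite oppr_eq0 oner_neq0.
have defL' u : L u <-> gen [:: x1; x2; x3] u /\ tau u = u.
  by rewrite defL; split=> [|[]].
have t2' : tau x2 = iota (-1) / x2 by rewrite rmorphN1.
split.
  have nzdl : - c / b != 0 by rewrite mulf_neq0 ?oppr_eq0 ?invr_eq0.
  have t3' : tau x3 = iota b * (x1 ^+ 2 - iota (-1 * (- c / b))) / x3.
    rewrite t3; congr (_ / _); rewrite mulrBr -rmorphM.
    by have -> : b * (-1 * (- c / b)) = c by field.
  move=> ptL; apply: NNPP => none.
  have infK : infinite K.
    apply: (@three_nonsquares_infinite K b (-1)) => //.
    - by apply: contra_not none => H; constructor 1; right.
    - by apply: contra_not none => H; constructor 1; left.
    - by rewrite mulrN1; apply: contra_not none => H; constructor 2.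
  apply: none.
  have [zz] := purely_transcendental_square_classes nz2K nzN1 nzb nzdl
    (infinite_nonsquare infK nzdl) trx tauC t1 t2' t3' defL' ptL.
  have sq_mul u v : nonzero_square u -> v != 0 -> nonzero_square (u * v ^+ 2).
    by case=> e nze -> nzv; exists (e * v); rewrite ?mulf_neq0 // exprMn.
  rewrite !inE => /or3P[]/eqP-> [] Hz.
  - by constructor 1; left.
  - constructor 4; suff -> : b * c = -1 * (- c / b) * b ^+ 2 by apply: sq_mul.
    by field.
  - by constructor 2.
  - constructor 3; left; suff -> : c = - b * (- c / b) by [].
    by field.
  - by constructor 1; right; move: Hz; rewrite mulrNN mul1r.
  - constructor 3; right; suff -> : - c = -1 * - b * (- c / b) by [].
    by field.
have t3m : tau x3 = (iota b * x1 ^+ 2 + iota (- c)) / x3 by rewrite rmorphN.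
have [P [Q [U [V [nzQ defLP spP rel]]]]] := two_conics_model nz2 trx tauC spx t1 t2' t3m defL' nzN1.
have gl v : v \in [:: P; Q; U; V] -> gen [:: P / Q; Q^-1; U; V] v.
  set l := [:: P / Q; Q^-1; U; V].
  have gQ : gen l (Q^-1)^-1 by apply: (sfV (gen_sf _ _)); rewrite /l; in_gen.
  rewrite invrK in gQ; have gPQ : gen l (P / Q) by rewrite /l; in_gen.
  have gP : gen l (P / Q * Q) by apply: (sfM (gen_sf _ _)).
  by rewrite divfK // in gP; rewrite !inE => /or4P[]/eqP->; rewrite // /l; in_gen.
move=> sq; apply: (@two_conics_rational K F iota x1 x2 x3 nz2 trx L (P / Q) (Q^-1) U V b c) => //.
- move=> u; rewrite defLP; split; apply: gen_sub => v; first exact: gl.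
  by rewrite !inE => /or4P[]/eqP->; in_gen.
- by apply: spans_sub spP _ => v /gl; apply: cls_gen.
move: rel => /=; rewrite !rmorphN rmorph1 opprK => rel.
have -> : U ^+ 2 = (P ^+ 2 + 1) / Q ^+ 2 * V ^+ 2 + (iota b * ((P ^+ 2 + 1) / Q ^+ 2) - iota c).
  by rewrite -rel; ring.
by field.
Qed.

(** * The dihedral action on [K(x1, x2, x3)] *)

Section D4.
Variables (s1 s2 : {rmorphism F -> F}) (a c eps al : K) (L : F -> Prop).
Hypotheses (s1C : forall k, s1 (iota k) = iota k) (s2C : forall k, s2 (iota k) = iota k).
Hypotheses (nza : a != 0) (nzc : c != 0) (eps2 : eps ^+ 2 = 1).
Hypotheses (s1x1 : s1 x1 = iota a / x2) (s1x2 : s1 x2 = x1) (s1x3 : s1 x3 = iota al * x3).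
Hypotheses (s2x1 : s2 x1 = iota eps * x1) (s2x2 : s2 x2 = iota (eps * a) / x2)
  (s2x3 : s2 x3 = iota c / x3).
Hypothesis defL : forall u, L u <-> s1 u = u /\ s2 u = u.

Let A := iota a.
Let nzA : A != 0. Proof. by rewrite fmorph_eq0. Qed.
Let e := iota eps.
Let e2 : e ^+ 2 = 1. Proof. by rewrite -rmorphXn eps2 rmorph1. Qed.
Let nze : e != 0.
Proof. by apply/eqP => e0; move/eqP: e2; rewrite e0 expr0n eq_sym oner_eq0. Qed.
Let eV : e^-1 = e.
Proof. by apply: (mulfI nze); rewrite mulfV // -expr2. Qed.

Let nc1 : ~ cls [:: x2; x3] x1. Proof. exact: spans3_drop trx _ _ _ spx. Qed.
Let nc2 : ~ cls [:: x1; x3] x2.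
Proof.
apply: (spans3_drop trx); apply: spans_perm spx => v; rewrite !inE.
by case/or3P=> ->; rewrite ?orbT.
Qed.
Let nc3 : ~ cls [:: x1; x2] x3.
Proof.
apply: (spans3_drop trx); apply: spans_perm spx => v; rewrite !inE.
by case/or3P=> ->; rewrite ?orbT.
Qed.
Let n1 : x1 != 0. Proof. by apply: contra_notN nc1 => /eqP->; in_cls. Qed.
Let n2 : x2 != 0. Proof. by apply: contra_notN nc2 => /eqP->; in_cls. Qed.
Let n3 : x3 != 0. Proof. by apply: contra_notN nc3 => /eqP->; in_cls. Qed.
Let nm : x1 - x2 != 0.
Proof. by apply: contra_notN nc1; rewrite subr_eq0 => /eqP->; in_cls. Qed.
Let np : x1 + x2 != 0.
Proof. by apply: contra_notN nc1; rewrite addr_eq0 => /eqP->; in_cls. Qed.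
Let na1 : x1 ^+ 2 - A != 0.
Proof.
apply: contra_notN nc1; rewrite subr_eq0 => /eqP x1A; apply: cls_sqrt.
by rewrite x1A /A; in_cls.
Qed.
Let na2 : x2 ^+ 2 - A != 0.
Proof.
apply: contra_notN nc2; rewrite subr_eq0 => /eqP x2A; apply: cls_sqrt.
by rewrite x2A /A; in_cls.
Qed.
Let ncx1 u : cls [:: x2; x3] u -> x1 * x2 != u.
Proof.
move=> cu; apply: contra_notN nc1 => /eqP x12.
have -> : x1 = u / x2 by rewrite -x12 mulfK.
by in_cls.
Qed.
Let npa : x1 * x2 + A != 0.
Proof.
rewrite addr_eq0; apply: ncx1; rewrite /A; in_cls.
Qed.
Let nma : x1 * x2 - A != 0.
Proof.
rewrite subr_eq0; apply: ncx1; rewrite /A; in_cls.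
Qed.

(** The square of [s1] sends [x1], [x2] to [a / x1], [a / x2]. It fixes [w0] and [r0] and negates
    [w1], the anti-invariant of this step. *)
Let w0 := (x1 * x2 - A) / (x1 - x2).
Let r0 := (x1 * x2 + A) / (x1 + x2).
Let w1 := x1 * x2 - A ^+ 2 / (x1 * x2).

Let nw0 : w0 != 0. Proof. by rewrite /w0 mulf_neq0 ?invr_eq0. Qed.
Let nr0 : r0 != 0. Proof. by rewrite /r0 mulf_neq0 ?invr_eq0. Qed.
Let s1A : s1 A = A. Proof. exact: s1C. Qed.
Let s2A : s2 A = A. Proof. exact: s2C. Qed.
Let s2x2' : s2 x2 = e * A / x2. Proof. by rewrite s2x2 rmorphM. Qed.

Let s1w0 : s1 w0 = - A / w0.
Proof.
rewrite /w0 fmorph_div !rmorphB rmorphM s1A s1x1 s1x2 -/A.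
have -> : A / x2 - x1 = - (x1 * x2 - A) / x2 by field.
by field; nz.
Qed.
Let s1r0 : s1 r0 = A / r0.
Proof.
rewrite /r0 fmorph_div !rmorphD rmorphM s1A s1x1 s1x2 -/A.
have -> : A / x2 + x1 = (x1 * x2 + A) / x2 by field.
by field; nz.
Qed.
Let s2w0 : s2 w0 = e * A / w0.
Proof.
rewrite /w0 fmorph_div !rmorphB rmorphM s2A s2x1 s2x2' -/e.
have -> : e * x1 * (e * A / x2) = e ^+ 2 * x1 * A / x2 by ring.
have -> : e * x1 - e * A / x2 = e * (x1 * x2 - A) / x2 by field.
rewrite e2 -[e in RHS]eV; by field; nz.
Qed.
Let s2r0 : s2 r0 = e * A / r0.
Proof.
rewrite /r0 fmorph_div !rmorphD rmorphM s2A s2x1 s2x2' -/e.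
have -> : e * x1 * (e * A / x2) = e ^+ 2 * x1 * A / x2 by ring.
have -> : e * x1 + e * A / x2 = e * (x1 * x2 + A) / x2 by field.
rewrite e2 -[e in RHS]eV; by field; nz.
Qed.
Let dwr : w0 ^+ 2 - r0 ^+ 2 = 4%:R * x1 * x2 * (x1 ^+ 2 - A) * (x2 ^+ 2 - A) /
    ((x1 - x2) ^+ 2 * (x1 + x2) ^+ 2).
Proof. by rewrite /w0 /r0; field; nz. Qed.
Let nz4 : 4%:R != 0 :> F. Proof. by rewrite (natrM _ 2 2) mulf_neq0. Qed.
Let nwr : w0 ^+ 2 - r0 ^+ 2 != 0. Proof. by rewrite dwr; nz. Qed.

Let nw1 : w1 != 0.
Proof.
have -> : w1 = (x1 * x2 - A) * (x1 * x2 + A) / (x1 * x2) by rewrite /w1; field; nz.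
by nz.
Qed.

(** [j = x1 x2 + a^2 / (x1 x2)] is rational in [w0], [r0], and [w1^2 = j^2 - 4 a^2]. So adjoining
    [w1] yields [x1 x2], then [x1 + x2 = (x1 x2 + a) / r0] and [x1 - x2 = (x1 x2 - a) / w0]. The
    third generator [z] is left open since the square of [s1] multiplies [x3] by [alpha^2]. *)
Lemma D4_step1 z : s1 (s1 z) = z -> gen [:: x1; x2; z] x3 ->
  spans [:: w0; r0; z] /\ forall u, L u -> gen [:: w0; r0; z] u.
Proof.
move=> s11z gx3; set s0 := [:: w0; r0; z].
have gw0 : gen s0 w0 by rewrite /s0; in_gen.
have gr0 : gen s0 r0 by rewrite /s0; in_gen.
have gA : gen s0 A by apply: gen_const.
have HG := gen_sf iota s0.
pose j := (4%:R * r0 ^+ 2 * w0 ^+ 2 - 2%:R * A * (w0 ^+ 2 + r0 ^+ 2)) / (w0 ^+ 2 - r0 ^+ 2).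
have def_j : j = x1 * x2 + A ^+ 2 / (x1 * x2).
  apply: (mulIf nwr); rewrite divfK // dwr /w0 /r0.
  by field; nz.
have gj : gen s0 j by rewrite /j; in_gen.
have gw1 : gen s0 (w1 ^+ 2).
  have -> : w1 ^+ 2 = j ^+ 2 - 4%:R * A ^+ 2 by rewrite def_j /w1; field; nz.
  by in_gen.
have HE := quad_ext_sf HG gw1.
have EN u : gen s0 u -> quad_ext (gen s0) w1 u by apply: quad_ext_sub.
have Ew1 : quad_ext (gen s0) w1 w1 by apply: quad_ext_root.
have Ej := EN _ gj; have Ew0 := EN _ gw0; have Er0 := EN _ gr0; have EA := EN _ gA.
have EP : quad_ext (gen s0) w1 (x1 * x2).
  have -> : x1 * x2 = (j + w1) / 2%:R by rewrite def_j /w1; field; nz.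
  by in_sf HE.
have Ex1 : quad_ext (gen s0) w1 x1.
  have -> : x1 = ((x1 * x2 + A) / r0 + (x1 * x2 - A) / w0) / 2%:R by rewrite /r0 /w0; field; nz.
  move: EP; move: (x1 * x2) => P EP; in_sf HE.
have Ex2 : quad_ext (gen s0) w1 x2.
  have -> : x2 = ((x1 * x2 + A) / r0 - (x1 * x2 - A) / w0) / 2%:R by rewrite /r0 /w0; field; nz.
  move: EP; move: (x1 * x2) => P EP; in_sf HE.
have Ex3 : quad_ext (gen s0) w1 x3.
  apply: (gx3 _ HE) => [k|v]; first by apply: EN; apply: gen_const.
  by rewrite !inE => /or3P[]/eqP-> //; apply: EN; rewrite /s0; in_gen.
have Ex v : v \in [:: x1; x2; x3] -> quad_ext (gen s0) w1 v.
  by rewrite !inE => /or3P[]/eqP->.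
split; first by apply: spans_sub spx _ => v /Ex; apply: quad_ext_cls.
move=> u /defL[s1u _].
pose s11 : {rmorphism F -> F} := s1 \o s1.
have s11A : s11 A = A by rewrite /s11 /= !s1A.
apply: (quad_ext_fixed (s := s11) (w := w1) nz2 nw1) => //.
- apply: gen_fixed => [k|v]; first by rewrite /s11 /= !s1C.
  rewrite !inE /s11 /= => /or3P[]/eqP-> //.
    by rewrite s1w0 fmorph_div rmorphN s1A s1w0; field; nz.
  by rewrite s1r0 fmorph_div s1A s1r0; field; nz.
- have s11x1 : s11 x1 = A / x1 by rewrite /s11 /= s1x1 fmorph_div s1x2 s1C.
  have s11x2 : s11 x2 = A / x2 by rewrite /s11 /= s1x2 s1x1.
  rewrite /w1 rmorphB fmorph_div rmorphXn !rmorphM s11A s11x1 s11x2.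
  by field; nz.
- apply: (genx u) => // k; by apply: EN; apply: gen_const.
by rewrite /s11 /= !s1u.
Qed.

Let b := eps * a.
Let nzb : b != 0.
Proof.
rewrite /b mulf_neq0 //.
by apply/eqP => e0; move/eqP: eps2; rewrite e0 expr0n eq_sym oner_eq0.
Qed.

(** For [eps = -1], exchanging [w0] and [r0] restores the same normal form with [b = eps a], so both
    signs share the later steps. *)
Lemma D4_wr : exists w r, [/\ s1 w = - iota b / w, s1 r = iota b / r,
  s1 (s2 w) = - w, s1 (s2 r) = r &
  [/\ eps = 1, w = w0 & r = r0] \/ [/\ eps = -1, w = r0 & r = w0]].
Proof.
have s1e : s1 e = e by apply: s1C.
have thw0 : s1 (s2 w0) = - e * w0.
  by rewrite s2w0 fmorph_div rmorphM s1e s1A s1w0; field; nz.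
have thr0 : s1 (s2 r0) = e * r0.
  by rewrite s2r0 fmorph_div rmorphM s1e s1A s1r0; field; nz.
have : eps ^+ 2 == 1 ^+ 2 by rewrite eps2 expr1n.
rewrite eqf_sqr => /orP[]/eqP eE.
  have eE' : e = 1 by rewrite /e eE rmorph1.
  exists w0, r0; split; last by left.
  - by rewrite /b eE mul1r s1w0.
  - by rewrite /b eE mul1r s1r0.
  - by rewrite thw0 eE' mulN1r.
  - by rewrite thr0 eE' mul1r.
have eE' : e = -1 by rewrite /e eE rmorphN1.
exists r0, w0; split; last by right.
- by rewrite /b eE mulN1r rmorphN opprK s1r0.
- by rewrite /b eE mulN1r rmorphN s1w0.
- by rewrite thr0 eE' mulN1r.
- by rewrite thw0 eE' opprK mul1r.
Qed.

Lemma D4_step1_wr z w r : s1 (s1 z) = z -> gen [:: x1; x2; z] x3 ->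
    [/\ eps = 1, w = w0 & r = r0] \/ [/\ eps = -1, w = r0 & r = w0] ->
  spans [:: w; r; z] /\ forall u, L u -> gen [:: w; r; z] u.
Proof.
move=> s11z gx3 Hwr; have [sp Lg] := D4_step1 s11z gx3.
have sub v : v \in [:: w0; r0; z] -> v \in [:: w; r; z].
  by case: Hwr => -[_ -> ->] //; rewrite !inE => /or3P[]->; rewrite ?orbT.
split; first exact: spans_perm sp.
by move=> u /Lg; apply: gen_sub => v /sub; apply: gen_mem.
Qed.

Let gx3 : gen [:: x1; x2; x3] x3. Proof. exact: genx. Qed.

Lemma D4_rational_1 : al = 1 -> purely_transcendental iota L.
Proof.
move=> al1; have s1z : s1 x3 = x3 by rewrite s1x3 al1 rmorph1 mul1r.
have [w [r [s1w s1r thw thr Hwr]]] := D4_wr.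
have [|sp Lg] := @D4_step1_wr x3 w r _ gx3 Hwr; first by rewrite !s1z.
apply: (D4_alpha1 nz2 trx s1C s2C nzb s1w s1r thw thr sp defL Lg (c := c)) => //.
by rewrite s2x3 fmorph_div s1C s1z.
Qed.

Lemma D4_rational_iff_N1 : al = -1 ->
  purely_transcendental iota L <->
  [\/ nonzero_square (-1 : K) \/ nonzero_square b, nonzero_square (- b)
    , nonzero_square c \/ nonzero_square (- c) | nonzero_square (b * c)].
Proof.
move=> alN1; have s1z : s1 x3 = - x3 by rewrite s1x3 alN1 rmorphN1 mulN1r.
have [w [r [s1w s1r thw thr Hwr]]] := D4_wr.
have [|sp Lg] := @D4_step1_wr x3 w r _ gx3 Hwr; first by rewrite s1z rmorphN s1z opprK.
apply: (D4_alphaN1 nz2 trx s1C s2C nzb s1w s1r thw thr sp defL Lg nzc s1z).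
  by rewrite s2x3 fmorph_div s1C s1z invrN mulrN mulNr.
exact: infinite_nonsquare.
Qed.

(** The square of [s1] negates [x3], so [x3] is multiplied by [B1 - alpha B2], on which [s1] acts as
    [alpha^-1]. The product [z] is fixed by [s1], at the price that [th z = C / z] with [C] no
    longer constant. *)
Lemma D4_rational_i : al ^+ 2 = -1 -> purely_transcendental iota L.
Proof.
move=> al2; pose AL := iota al.
have AL2 : AL ^+ 2 = -1 by rewrite -rmorphXn al2 rmorphN1.
have nzAL : AL != 0.
  apply/eqP => i0; move/eqP: AL2.
  by rewrite i0 expr0n eq_sym oppr_eq0 oner_eq0.
have ALV : AL^-1 = - AL by apply: (mulfI nzAL); rewrite mulfV // mulrN -expr2 AL2 opprK.
pose B1 := x1 - A / x1; pose B2 := x2 - A / x2.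
have s1B1 : s1 B1 = - B2.
  by rewrite /B1 rmorphB fmorph_div s1A s1x1 -/A /B2; field; nz.
have s1B2 : s1 B2 = B1 by rewrite /B2 rmorphB fmorph_div s1A s1x2.
have s2B1 : s2 B1 = e * B1.
  by rewrite /B1 rmorphB fmorph_div s2A s2x1 -/e invfM eV; field; nz.
have s2B2 : s2 B2 = - e * B2.
  rewrite /B2 rmorphB fmorph_div s2A s2x2'.
  have -> : A / (e * A / x2) = e^-1 * x2 by field; nz.
  by rewrite eV; field; nz.
have s1AL : s1 AL = AL by apply: s1C.
have s2AL : s2 AL = AL by apply: s2C.
have s1e : s1 e = e by apply: s1C.
have gAL s : gen s AL by apply: gen_const.
have cAL s : cls s AL by apply: cls_const.
have s1x3' : s1 x3 = AL * x3 := s1x3.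
clearbody AL.
(* Vanishing would be a quadratic equation for [x1] over [K(x2)], solved by completing the
   square. *)
have nzB : B1 - AL * B2 != 0.
  apply: contra_notN nc1; rewrite subr_eq0 => /eqP B12.
  have cAL0 := cAL [:: x2; x3].
  have cB2 : cls [:: x2; x3] B2 by rewrite /B2 /A; in_cls.
  have csq : cls [:: x2; x3] (2%:R * x1 - AL * B2).
    apply: cls_sqrt; have -> : (2%:R * x1 - AL * B2) ^+ 2 = (AL * B2) ^+ 2 + 4%:R * A.
      by rewrite -B12 /B1; field; nz.
    by rewrite /A; in_cls.
  have -> : x1 = (2%:R * x1 - AL * B2 + AL * B2) / 2%:R by field.
  by move: csq; move: (2%:R * x1 - AL * B2) => q csq; in_cls.
pose z := x3 * (B1 - AL * B2).
have s1z : s1 z = z.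
  rewrite /z rmorphM rmorphB rmorphM s1x3' s1B1 s1B2 s1AL.
  transitivity (x3 * (- AL ^+ 2 * B1 - AL * B2)); first by ring.
  by rewrite AL2; ring.
have gz : gen [:: x1; x2; z] x3.
  have -> : x3 = z / (B1 - AL * B2) by rewrite /z mulfK.
  have gAL0 := gAL [:: x1; x2; z].
  by rewrite /B1 /B2 /A; in_gen.
pose C := iota c * e * (B1 ^+ 2 + B2 ^+ 2).
have thz : s1 (s2 z) = C / z.
  have -> : s2 z = iota c / x3 * (e * B1 - AL * (- e * B2)).
    by rewrite [s2 z]rmorphM [s2 (B1 - _)]rmorphB [s2 (AL * _)]rmorphM s2x3 s2B1 s2B2 s2AL.
  have -> : s1 (iota c / x3 * (e * B1 - AL * (- e * B2))) =
      iota c / (AL * x3) * (e * - B2 - AL * (- e * B1)).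
    rewrite [LHS]rmorphM [s1 (_ / x3)]fmorph_div [s1 (_ - _)]rmorphB [s1 (e * _)]rmorphM.
    by rewrite [s1 (AL * _)]rmorphM [s1 (- e * _)]rmorphM rmorphN s1C s1e s1AL s1x3' s1B1 s1B2.
  rewrite invfM ALV /z; have -> : C = iota c * e * (B1 ^+ 2 - AL ^+ 2 * B2 ^+ 2) by rewrite /C AL2; ring.
  transitivity (iota c * e * (- AL ^+ 2 * B1 + AL * B2) / x3); first by field.
  have -> : - AL ^+ 2 = 1 by rewrite AL2 opprK.
  by move: (B1) (B2) nzB => b1 b2 nzB'; field; nz.
have [w [r [s1w s1r thw thr Hwr]]] := D4_wr.
have [|sp Lg] := @D4_step1_wr z w r _ gz Hwr; first by rewrite !s1z.
have ncr : ~ cls [:: w; z] r.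
  apply: (spans3_drop trx); apply: spans_perm sp => v; rewrite !inE.
  by case/or3P=> ->; rewrite ?orbT.
have nzr : r != 0 by apply: contra_notN ncr => /eqP->; in_cls.
have nsq u : cls [:: w; z] u -> r ^+ 2 - u != 0.
  by move=> cu; apply: contra_notN ncr; rewrite subr_eq0 => /eqP r2; apply: cls_sqrt; rewrite r2.
have nz1 : r ^+ 2 - w ^+ 2 != 0 by apply: nsq; in_cls.
have nz3 : r ^+ 2 + w ^+ 2 != 0 by rewrite -[w ^+ 2]opprK; apply: nsq; in_cls.
have nz5 : r ^+ 2 - iota b != 0 by apply: nsq; in_cls.
have nz6 : r ^+ 2 + iota b != 0 by rewrite -[iota b]opprK; apply: nsq; in_cls.
pose g1 := (r + iota b / r) / 2%:R.
have nzg1 : g1 != 0.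
  have -> : g1 = (r ^+ 2 + iota b) / (2%:R * r) by rewrite /g1; field; nz.
  by nz.
have nzcF : iota c != 0 by rewrite fmorph_eq0.
have defC := two_squares_center n1 n2 nm np na1 na2 nz2; rewrite /= -/w0 -/r0 -/B1 -/B2 in defC.
case: (Hwr) => -[epsE wE rE].
  apply: (D4_alphaI nz2 trx s1C s2C nzb s1w s1r thw thr sp defL Lg (C := C)
    (l0 := iota c) (l1 := - iota c * g1) al2 s1z thz).
  - by in_gen.
  - by rewrite -/g1; in_gen.
  - by rewrite mulf_neq0 ?oppr_eq0.
  rewrite -norm_constant_eps1 //; congr (_ * _ ^+ 2).
  by rewrite /C defC /e epsE rmorph1 mulr1 /b epsE mul1r -/A wE rE; ring.
have bE : iota b = - A by rewrite /b epsE mulN1r rmorphN.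
apply: (D4_alphaI nz2 trx s1C s2C nzb s1w s1r thw thr sp defL Lg (C := C)
  (l0 := - iota c * g1 ^+ 2 / (g1 ^+ 2 - iota b)) (l1 := iota c * g1) al2 s1z thz).
- by rewrite -/g1; in_gen.
- by rewrite -/g1; in_gen.
- by rewrite mulf_neq0.
rewrite -norm_constant_epsN1 //; congr (_ * _ ^+ 2).
rewrite /C defC /e epsE rmorphN1 bE wE rE.
have -> : (r0 ^+ 2 - w0 ^+ 2) ^+ 2 = (w0 ^+ 2 - r0 ^+ 2) ^+ 2 by ring.
by ring.
Qed.

End D4.
End Actions.

(** * Conclusion over the rational function field *)

Lemma generated_fixedP (F : Type) (gens : (F -> F) -> Prop) u :
  fixed_field (generated gens) u <-> forall f, gens f -> f u = u.
Proof.
split=> [fix_u f gf|fix_u f]; first exact/fix_u/generated_base.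
elim=> {f} [f /fix_u//| //|f g _ fu _ gu|f g _ fu fK _] /=; first by rewrite gu.
by rewrite -{1}fu.
Qed.

Section RationalFunctions.
Variable K : fieldType.

Let X (i : nat) := nth 0 [:: X1 K; X2 K; X3 K] i.

Lemma mev_ratfun3 (p : {mpoly K[3]}) : mev (ratfun3C K) X p = tofrac p.
Proof.
move: p; apply: (@mpoly_rmorph_ext _ _ _ (mev (ratfun3C K) X) (@tofrac _)) => [k|i] /=.
  by rewrite mevC.
rewrite mevX /X; case: i => -[|[|[|]]] //= lt_i; congr (tofrac 'X__); exact: val_inj.
Qed.

Lemma ratfun3_trdeg3 : trdeg3 (ratfun3C K) (X1 K) (X2 K) (X3 K).
Proof.
by move=> p; rewrite mev_ratfun3 => /eqP; rewrite tofrac_eq0 => /eqP.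
Qed.

Lemma ratfun3_gen u : gen (ratfun3C K) [:: X1 K; X2 K; X3 K] u.
Proof.
have [p [q [_ ->]]] := fracP u; rewrite -!mev_ratfun3.
have mevg (s : {mpoly K[3]}) : gen (ratfun3C K) [:: X1 K; X2 K; X3 K] (mev (ratfun3C K) X s).
  exact: ((@genv_nth _ _ (ratfun3C K) [:: X1 K; X2 K; X3 K] 3 _ isT).1
    (@mev_genv _ _ (ratfun3C K) 3 X s)).
by apply: (sf_div (gen_sf _ _)); apply: mevg.
Qed.

End RationalFunctions.

Theorem theorem7 (K : fieldType) (hK : 2%N \notin [pchar K])
  (a c eps alpha : K) (ha : a != 0) (hc : c != 0)
  (heps : eps = 1 \/ eps = -1) (halpha : alpha ^+ 4 = 1)
  (sigma1 sigma2 : {rmorphism ratfun3 K -> ratfun3 K})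
  (hsigma1 : is_automorphism_over (ratfun3C K) sigma1)
  (hsigma1x1 : sigma1 (X1 K) = ratfun3C K a / X2 K)
  (hsigma1x2 : sigma1 (X2 K) = X1 K)
  (hsigma1x3 : sigma1 (X3 K) = ratfun3C K alpha * X3 K)
  (hsigma2 : is_automorphism_over (ratfun3C K) sigma2)
  (hsigma2x1 : sigma2 (X1 K) = ratfun3C K eps * X1 K)
  (hsigma2x2 : sigma2 (X2 K) = ratfun3C K (eps * a) / X2 K)
  (hsigma2x3 : sigma2 (X3 K) = ratfun3C K c / X3 K) :
  let FG := fixed_field (generated (fun f => f = sigma1 \/ f = sigma2)) in
  (nonzero_square (-1 : K) \/ alpha = 1 ->
     purely_transcendental (ratfun3C K) FG) /\
  (~ nonzero_square (-1 : K) -> alpha = -1 ->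
   forall tau : {rmorphism ratfun3 K -> ratfun3 K},
     is_automorphism_over (ratfun3C K) tau ->
     tau (X1 K) = - X1 K ->
     tau (X2 K) = -1 / X2 K ->
     tau (X3 K) =
       (ratfun3C K (eps * a) * X1 K ^+ 2 - ratfun3C K c) / X3 K ->
     let FT := fixed_field (generated (fun f => f = tau)) in
     (purely_transcendental (ratfun3C K) FG <->
      purely_transcendental (ratfun3C K) FT) /\
     (purely_transcendental (ratfun3C K) FT <->
      [\/ nonzero_square a \/ nonzero_square (- a),
          nonzero_square c \/ nonzero_square (- c)
        | nonzero_square (eps * a * c)])).
Proof.
have nz2K : 2%:R != 0 :> K.
  by apply: contra hK => /eqP two0; rewrite inE /= two0 eqxx.
have nz2 : 2%:R != 0 :> ratfun3 K by rewrite -(rmorph_nat (ratfun3C K)) fmorph_eq0.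
have eps2 : eps ^+ 2 = 1 by case: heps => ->; rewrite ?sqrrN expr1n.
move=> FG.
have defG u : FG u <-> sigma1 u = u /\ sigma2 u = u.
  rewrite /FG generated_fixedP; split=> [fix_u|[fix1 fix2] f [->|->] //].
  by split; apply: fix_u; [left | right].
have tr := @ratfun3_trdeg3 K; have gX := @ratfun3_gen K.
have [_ s1C] := hsigma1; have [_ s2C] := hsigma2.
have iffN1 := D4_rational_iff_N1 nz2 tr gX s1C s2C ha hc eps2 hsigma1x1 hsigma1x2 hsigma1x3
  hsigma2x1 hsigma2x2 hsigma2x3 defG.
split=> [sq|nsq alN1 tau [_ tauC] t1 t2 t3 FT].
  (* As [alpha^4 = 1], the cases are [alpha = 1], [alpha = -1] and [alpha^2 = -1]. *)
  have [al1|nal1] := eqVneq alpha 1.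
    exact: (D4_rational_1 nz2 tr gX s1C s2C ha eps2 hsigma1x1 hsigma1x2 hsigma1x3
      hsigma2x1 hsigma2x2 hsigma2x3 defG al1).
  have sqN1 : nonzero_square (-1 : K) by case: sq => // al1; rewrite al1 eqxx in nal1.
  have [alN1|nalN1] := eqVneq alpha (-1).
    by apply/(iffN1 alN1); constructor 1; left.
  apply: (D4_rational_i nz2 tr gX s1C s2C ha hc eps2 hsigma1x1 hsigma1x2 hsigma1x3
    hsigma2x1 hsigma2x2 hsigma2x3 defG).
  have : (alpha ^+ 2) ^+ 2 == 1 ^+ 2 by rewrite -exprM halpha expr1n.
  rewrite eqf_sqr => /orP[|/eqP//].
  by rewrite -[X in _ == X](expr1n K 2) eqf_sqr (negPf nal1) (negPf nalN1).
have nzb : eps * a != 0.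
  by rewrite mulf_neq0 //; case: heps => ->; rewrite ?oppr_eq0 oner_neq0.
have defT u : FT u <-> tau u = u.
  by rewrite /FT generated_fixedP; split=> [fix_u|fix_u f ->] //; apply: fix_u.
have iffT := tau_rational_iff nz2 tr gX tauC nzb hc t1 t2 t3 defT.
(* Both fields have the same criterion, which yields their equivalence. *)
split; first by rewrite (iffN1 alN1) iffT.
rewrite iffT.
have eps_sq : (nonzero_square (eps * a) \/ nonzero_square (- (eps * a))) <->
    (nonzero_square a \/ nonzero_square (- a)).
  by case: heps => ->; rewrite ?mul1r // mulN1r opprK; split=> -[]; by [left | right].
split.
  case=> [[//|sqb]|sqb|sqc|sqbc].
  - by constructor 1; apply/eps_sq; left.
  - by constructor 1; apply/eps_sq; right.
  - by constructor 2.
  - by constructor 3.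
case=> [/eps_sq[sqb|sqb]|sqc|sqbc].
- by constructor 1; right.
- by constructor 2.
- by constructor 3.
- by constructor 4.
Qed.
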